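(* Let $M, N_1, N_2$ be separable tracial von Neumann algebras. Assume that the central sequence algebra $M'\cap M^{\omega}$ is abelian. Then $M'\cap (M\bar{\otimes}N_1)^{\omega}$ and $M'\cap (M\bar{\otimes}N_2)^{\omega}$ commute in $(M\bar{\otimes}N_1\bar{\otimes}N_2)^{\omega}$; that is, $xy=yx$ for all $x\in M'\cap (M\bar{\otimes}N_1)^{\omega}$ and $y\in M'\cap (M\bar{\otimes}N_2)^{\omega}$.
   Context: A tracial von Neumann algebra $(M,\tau)$ is a von Neumann algebra $M$ with a faithful normal tracial state $\tau$; put $\|x\|_2=\tau(x^*x)^{1/2}$. $M$ is separable if it is separable for $\|\cdot\|_2$. Tensor products $\bar{\otimes}$ are von Neumann algebra tensor products, equipped with the product trace. Throughout, $\omega$ is a fixed free ultrafilter on $\mathbb{N}$. The ultraproduct $M^{\omega}$ is the quotient of $\{(x_n)_n\in\prod_n M : \sup_n\|x_n\|<\infty\}$ by $\{(x_n)_n : \lim_{n\to\omega}\|x_n\|_2=0\}$; it is a tracial von Neumann algebra with trace $\tau((x_n)_n)=\lim_{n\to\omega}\tau(x_n)$. $M$ is regarded as a subalgebra of $M^{\omega}$ via constant sequences. For a trace-preserving inclusion $P\subset Q$, $P^{\omega}$ is regarded as a subalgebra of $Q^{\omega}$, and $P'\cap Q^{\omega}$ denotes the relative commutant of $P$ in $Q^{\omega}$. $M$, $M\bar{\otimes}N_1$ and $M\bar{\otimes}N_2$ are regarded as subalgebras of $M\bar{\otimes}N_1\bar{\otimes}N_2$ in the natural way (e.g. $M=M\otimes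 1\otimes 1$, $M\bar{\otimes}N_1=M\bar{\otimes}N_1\otimes 1$, and $M\bar{\otimes}N_2=M\bar{\otimes}1\bar{\otimes}N_2$), hence $(M\bar{\otimes}N_i)^{\omega}\subset (M\bar{\otimes}N_1\bar{\otimes}N_2)^{\omega}$. *)

(* Defs.v *)
From HB Require Import structures.
From mathcomp Require Import all_boot all_order all_algebra complex.
From mathcomp Require Import all_classical all_reals all_analysis.
From mathcomp Require Import ring.

Set Implicit Arguments.
Unset Strict Implicit.
Unset Printing Implicit Defensive.

Import Order.TTheory GRing.Theory Num.Theory Num.Def.
Import numFieldNormedType.Exports.

Local Open Scope classical_set_scope.
Local Open Scope ring_scope.
Local Open Scope quotient_scope.

(* Typed as a numClosedFieldType, and not as the bare R[i], so that it gets the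
   norm and the topology that MathComp-Analysis puts on numeric fields. *)
Definition Cplx (R : realType) : numClosedFieldType := R[i].

(* The inner product is linear in its first argument and conjugate-linear in
   the second one; its positive definiteness is part of {dot _ for _}. *)
Record hilbertType (R : realType) := Hilbert {
  hilbert_sort :> completeNormedModType (Cplx R);
  hdot : {dot hilbert_sort for @conjC (Cplx R)};
  hilbert_normE : forall v, `|v| ^+ 2 = hdot v v }.

Section VonNeumannAlgebras.
Variables (R : realType) (H : hilbertType R).
Local Notation C := (Cplx R).
Implicit Types (S M : set (H -> H)) (f g a b : H -> H) (tau : (H -> H) -> C).

Definition bounded_operators : set (H -> H) :=
  [set f | linear f /\ continuous f].

Definition commutant S : set (H -> H) :=
  [set f | bounded_operators f /\ forall g, S g -> f \o g = g \o f].

Definition is_adjoint f g := forall u v : H, hdot H (f u) v = hdot H u (g v).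

(* Only meaningful when f has an adjoint; the value is then unique. *)
Definition adj f : H -> H := xget 0 [set g | is_adjoint f g].

Record is_vNa M : Prop := IsVNA {
  vNa_bounded : M `<=` bounded_operators;
  vNa_star : forall f, M f -> exists2 g, M g & is_adjoint f g;
  vNa_bicommutant : commutant (commutant M) = M }.

Definition vNa_generated S : set (H -> H) :=
  commutant (commutant (S `|` [set g | exists2 f, S f & is_adjoint f g])).

Definition square_summable (xi : nat -> H) :=
  cvgn (series (fun n => `|xi n| ^+ 2)).

Definition vector_functional (xi eta : nat -> H) f : C :=
  limn (series (fun n => hdot H (f (xi n)) (eta n))).

(* Continuity at 0 (hence everywhere, tau being linear on M) for the
   ultraweak, i.e. sigma-weak, topology. *)
Definition normal_on M tau :=
  forall e : C, 0 < e -> exists m (xi eta : 'I_m -> nat -> H),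
    (forall k, square_summable (xi k) /\ square_summable (eta k)) /\
    exists2 d : C, 0 < d & forall f, M f ->
      (forall k, `|vector_functional (xi k) (eta k) f| < d) -> `|tau f| < e.

(* tau is a total function, of which only the values on M matter. *)
Record is_tracial M tau : Prop := IsTracial {
  trace_linear : forall (c : C) f g, M f -> M g ->
    tau (c *: f + g) = c * tau f + tau g;
  trace_unit : tau idfun = 1;
  trace_ge0 : forall f, M f -> 0 <= tau (adj f \o f);
  trace_faithful : forall f, M f -> tau (adj f \o f) = 0 -> f = 0;
  trace_comm : forall f g, M f -> M g -> tau (f \o g) = tau (g \o f);
  trace_normal : normal_on M tau }.

Record tracial_vNa := TracialVNA {
  vna : set (H -> H);
  trace : (H -> H) -> C;
  vnaP : is_vNa vna;
  traceP : is_tracial vna trace }.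


Definition norm2 (M : tracial_vNa) f : C := sqrtC (trace M (adj f \o f)).

Definition separable (M : tracial_vNa) :=
  exists D : set (H -> H), [/\ countable D, D `<=` vna M &
    forall f (e : C), vna M f -> 0 < e ->
      exists2 g, D g & norm2 M (f - g) < e].

Lemma hdot_inj a b : (forall u v, hdot H u (a v) = hdot H u (b v)) -> a = b.
Proof.
move=> h; apply/funext => v; apply/eqP; rewrite -subr_eq0 -normr_eq0.
rewrite -sqrf_eq0 hilbert_normE linearBr subr_eq0; apply/eqP; exact: h.
Qed.

Lemma adjE f g : is_adjoint f g -> adj f = g.
Proof.
move=> fg; rewrite /adj; case: xgetP => [h _ fh|/(_ g)//].
by apply: hdot_inj => u v; rewrite -fh -fg.
Qed.

Lemma bounded_id : bounded_operators idfun.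
Proof. by split=> // x; exact: cvg_id. Qed.

Lemma boundedB f g : bounded_operators f -> bounded_operators g ->
  bounded_operators (f - g).
Proof.
move=> [lf cf] [lg cg]; split=> [c u v|x]; last exact: cvgB (cf x) (cg x).
by rewrite !fctE lf lg scalerBr addrACA opprD.
Qed.

Lemma bounded_comp f g : bounded_operators f -> bounded_operators g ->
  bounded_operators (f \o g).
Proof.
move=> [lf cf] [lg cg]; split=> [c u v /=|x]; first by rewrite lg lf.
exact: continuous_comp (cg x) (cf _).
Qed.

Lemma bounded_opB f u v : bounded_operators f -> f (u - v) = f u - f v.
Proof. by move=> [lf _]; rewrite addrC -scaleN1r lf scaleN1r addrC. Qed.

Section Closure.
Variable M : tracial_vNa.
Local Notation vM := (vna M).

Lemma vna_id : vM idfun.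
Proof. by rewrite -(vNa_bicommutant (vnaP M)); split=> //; exact: bounded_id. Qed.

Lemma vnaB f g : vM f -> vM g -> vM (f - g).
Proof.
rewrite -(vNa_bicommutant (vnaP M)) => -[bf cf] [bg cg].
split=> [|h hM]; first exact: boundedB.
apply/funext => v /=; rewrite !fctE (bounded_opB _ _ hM.1).
by have /(congr1 (@^~ v)) /= -> := cf _ hM; have /(congr1 (@^~ v)) /= -> := cg _ hM.
Qed.

Lemma vna_comp f g : vM f -> vM g -> vM (f \o g).
Proof.
rewrite -(vNa_bicommutant (vnaP M)) => -[bf cf] [bg cg].
split=> [|h hM]; first exact: bounded_comp.
by rewrite -compA cg// compA cf.
Qed.

Lemma vna0 : vM 0.
Proof. by rewrite -(subrr idfun); apply: vnaB; exact: vna_id. Qed.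

Lemma vnaD f g : vM f -> vM g -> vM (f + g).
Proof.
move=> Mf Mg; rewrite -[g]opprK; apply: vnaB => //.
by rewrite -sub0r; apply: vnaB => //; exact: vna0.
Qed.

Lemma vna_adj f : vM f -> vM (adj f) /\ is_adjoint f (adj f).
Proof. by move=> /(vNa_star (vnaP M))[g Mg fg]; rewrite (adjE fg). Qed.

Lemma adjB f g : vM f -> vM g -> adj (f - g) = adj f - adj g.
Proof.
move=> /vna_adj[_ hf] /vna_adj[_ hg]; apply: adjE => u v.
by rewrite !fctE linearBl linearBr; congr (_ - _); [exact: hf|exact: hg].
Qed.

Lemma traceB f g : vM f -> vM g -> trace M (f - g) = trace M f - trace M g.
Proof.
move=> Mf Mg; rewrite addrC -[- g]scaleN1r (trace_linear (traceP M))//.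
by rewrite mulN1r addrC.
Qed.

Lemma traceD f g : vM f -> vM g -> trace M (f + g) = trace M f + trace M g.
Proof.
by move=> Mf Mg; rewrite -[f in LHS]scale1r (trace_linear (traceP M))// mul1r.
Qed.

Lemma norm2_ge0 f : vM f -> 0 <= norm2 M f.
Proof. by move=> Mf; rewrite sqrtC_ge0; exact: (trace_ge0 (traceP M)). Qed.

Lemma norm2_0 : norm2 M 0 = 0.
Proof.
have adj0 : adj (0 : H -> H) = 0.
  by rewrite -(subrr (idfun : H -> H)) adjB ?subrr//; exact: vna_id.
have trace0 : trace M 0 = 0.
  by rewrite -(subrr (idfun : H -> H)) traceB ?subrr//; exact: vna_id.
by rewrite /norm2 adj0 -[_ \o _]/(0 : H -> H) trace0 sqrtC0.
Qed.

Lemma norm2_subC f g : vM f -> vM g -> norm2 M (f - g) = norm2 M (g - f).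
Proof.
move=> Mf Mg; rewrite /norm2; congr (sqrtC (trace M _)).
apply/funext => v; rewrite !adjB//= !fctE.
have [bf bg] : bounded_operators (adj f) /\ bounded_operators (adj g).
  by split; apply: (vNa_bounded (vnaP M)); exact: (vna_adj _).1.
rewrite !(bounded_opB _ _ bf) !(bounded_opB _ _ bg) ![- (_ - _)]opprB.
by rewrite addrC.
Qed.

(* The constant 2 is not optimal, but it suffices for null sequences. *)
Lemma norm2_quasi_triangle f g : vM f -> vM g ->
  norm2 M (f + g) <= 2 * (norm2 M f + norm2 M g).
Proof.
move=> Mf Mg; have [Mf' ff'] := vna_adj Mf; have [Mg' gg'] := vna_adj Mg.
have lf' := vNa_bounded (vnaP M) Mf'; have lg' := vNa_bounded (vnaP M) Mg'.
have bD h u v : bounded_operators h -> h (u + v) = h u + h v.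
  by move=> [lh _]; rewrite -[u in LHS]scale1r lh scale1r.
have adjD : adj (f + g) = adj f + adj g.
  apply: adjE => u v; rewrite !fctE linearDl linearDr.
  by congr (_ + _); [exact: ff'|exact: gg'].
set sq := (adj f \o f) + (adj g \o g); set cr := (adj f \o g) + (adj g \o f).
have Mff : vM (adj f \o f) := vna_comp Mf' Mf.
have Mgg : vM (adj g \o g) := vna_comp Mg' Mg.
have Msq : vM sq by exact: vnaD.
have Mcr : vM cr by apply: vnaD; [exact: vna_comp Mf' Mg|exact: vna_comp Mg' Mf].
have ED : adj (f + g) \o (f + g) = sq + cr.
  apply/funext => v; rewrite adjD /sq /cr /= !fctE /=.
  rewrite !(bD _ _ _ lf') !(bD _ _ _ lg').
  by rewrite addrACA; congr (_ + _); exact: addrC.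
have EB : adj (f - g) \o (f - g) = sq - cr.
  apply/funext => v; rewrite adjB// /sq /cr /= !fctE /=.
  rewrite !(bounded_opB _ _ lf') !(bounded_opB _ _ lg').
  by rewrite !opprD !opprK [RHS]addrACA; congr (_ + _); exact: addrC.
have := trace_ge0 (traceP M) (vnaB Mf Mg); rewrite EB traceB// subr_ge0 => crsq.
have p0 := norm2_ge0 Mf; have q0 := norm2_ge0 Mg.
have sqE : trace M sq = norm2 M f ^+ 2 + norm2 M g ^+ 2.
  by rewrite !sqrtCK traceD.
have Mfg := vnaD Mf Mg.
rewrite -(@ler_pXn2r _ 2%N)// ?nnegrE ?norm2_ge0 ?mulr_ge0 ?addr_ge0//.
rewrite sqrtCK ED traceD// (le_trans (lerD (lexx _) crsq))// sqE.
rewrite -subr_ge0; set p := norm2 M f in p0 *; set q := norm2 M g in q0 *.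
have -> : (2 * (p + q)) ^+ 2 - (p ^+ 2 + q ^+ 2 + (p ^+ 2 + q ^+ 2)) =
   2 * p ^+ 2 + 2 * q ^+ 2 + 8 * (p * q) by ring.
by rewrite !addr_ge0// !mulr_ge0// exprn_ge0.
Qed.

End Closure.
End VonNeumannAlgebras.

Record free_ultrafilter := FreeUltrafilter {
  fu_sets : set_system nat;
  fu_ultra : UltraFilter fu_sets;
  fu_free : forall n, ~ fu_sets [set n] }.

#[global] Existing Instance fu_ultra.

Section Ultraproduct.
Variables (R : realType) (H : hilbertType R) (omega : free_ultrafilter).
Variable M : tracial_vNa H.
Local Notation C := (Cplx R).

Record bounded_seq := BoundedSeq {
  bseq :> nat -> H -> H;
  bseq_in : forall n, vna M (bseq n);
  bseq_bounded : exists2 c : C, 0 <= c &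
    forall n v, `|bseq n v| <= c * `|v| }.

HB.instance Definition _ := gen_eqMixin bounded_seq.
HB.instance Definition _ := gen_choiceMixin bounded_seq.

Definition null_difference (x y : bounded_seq) :=
  norm2 M (x n - y n) @[n --> fu_sets omega] --> (0 : C).

Definition ultra_eq (x y : bounded_seq) : bool := `[< null_difference x y >].

Lemma ultra_eq_refl : reflexive ultra_eq.
Proof.
move=> x; apply/asboolP; rewrite /null_difference.
by under eq_fun do rewrite subrr norm2_0; exact: cvg_cst.
Qed.

Lemma ultra_eq_sym : symmetric ultra_eq.
Proof.
move=> x y; rewrite /ultra_eq /null_difference.
suff -> : (fun n => norm2 M (x n - y n)) = (fun n => norm2 M (y n - x n)) by [].
by apply/funext => n; apply: norm2_subC; exact: bseq_in.
Qed.

Lemma ultra_eq_trans : transitive ultra_eq.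
Proof.
move=> y x z /asboolP xy /asboolP yz; apply/asboolP.
apply/cvgr0Pnorm_lt => e e0.
have e4 : 0 < e / 4 by rewrite divr_gt0.
have /cvgr0Pnorm_lt/(_ _ e4) nxy := xy; have /cvgr0Pnorm_lt/(_ _ e4) nyz := yz.
near=> n; have Mx := bseq_in x n; have My := bseq_in y n; have Mz := bseq_in z n.
have h1 : `|norm2 M (x n - y n)| < e / 4 by near: n.
have h2 : `|norm2 M (y n - z n)| < e / 4 by near: n.
rewrite ger0_norm ?norm2_ge0 in h1; last exact: vnaB.
rewrite ger0_norm ?norm2_ge0 in h2; last exact: vnaB.
rewrite ger0_norm ?norm2_ge0; last exact: vnaB.
rewrite -(subrK (y n) (x n)) -addrA.
apply: (le_lt_trans (norm2_quasi_triangle (vnaB Mx My) (vnaB My Mz))).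
have -> : e = 2 * (e / 4 + e / 4) by field.
by rewrite ltr_pM2l// ltrD.
Unshelve. all: by end_near. Qed.

Definition ultra_equiv :=
  EquivRel ultra_eq ultra_eq_refl ultra_eq_sym ultra_eq_trans.

Definition ultraproduct := {eq_quot ultra_equiv}.
HB.instance Definition _ := EqQuotient.on ultraproduct.

Lemma bseq_comp_subproof (x y : bounded_seq) : exists2 c : C, 0 <= c &
  forall n v, `|(x n \o y n) v| <= c * `|v|.
Proof.
have [c c0 xc] := bseq_bounded x; have [d d0 yd] := bseq_bounded y.
exists (c * d); first exact: mulr_ge0.
by move=> n v; rewrite (le_trans (xc _ _))// -mulrA ler_wpM2l.
Qed.

Definition bseq_comp (x y : bounded_seq) : bounded_seq :=
  BoundedSeq (fun n => vna_comp (bseq_in x n) (bseq_in y n))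
             (bseq_comp_subproof x y).

(* Pointwise product of representatives. The class of the result does not
   depend on them, as both |a b|_2 and |b a|_2 are at most |a| |b|_2. *)
Definition ultra_mul (x y : ultraproduct) : ultraproduct :=
  \pi_ultraproduct (bseq_comp (repr x) (repr y)).

Lemma bseq_cst_subproof f : vna M f -> exists2 c : C, 0 <= c &
  forall (n : nat) v, `|f v| <= c * `|v|.
Proof.
move=> /(vNa_bounded (vnaP M)) [lf cf].
pose F : {linear H -> H} := HB.pack f (GRing.isLinear.Build _ _ _ _ f lf).
have /linear_boundedP/pinfty_ex_gt0[c c0 fc] : bounded_near F (nbhs 0).
  exact/linear_bounded_continuous.
by exists c; [exact: ltW|move=> _ v; exact: fc].
Qed.

Definition bseq_cst f (Mf : vna M f) : bounded_seq :=
  @BoundedSeq (fun=> f) (fun=> Mf) (bseq_cst_subproof Mf).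

Definition ultra_cst f (Mf : vna M f) : ultraproduct := \pi_ultraproduct (bseq_cst Mf).

(* Q^omega, as a subset of M^omega, for Q contained in M *)
Definition sub_ultraproduct (Q : set (H -> H)) : set ultraproduct :=
  [set x | exists2 y : bounded_seq, (forall n, Q (y n)) & x = \pi_ultraproduct y].

(* Q' \cap M^omega, for Q contained in M *)
Definition relative_commutant (Q : set (H -> H)) : set ultraproduct :=
  [set x | forall f (Mf : vna M f), Q f ->
    ultra_mul (ultra_cst Mf) x = ultra_mul x (ultra_cst Mf)].

End Ultraproduct.

Section TensorProduct.
Variables (R : realType) (H0 H1 H2 K : hilbertType R).
Variable t : H0 -> H1 -> H2 -> K.

(* K, together with the elementary tensors t u v w, is a Hilbert space tensor
   product of H0, H1 and H2; this determines K up to a unique unitary. *)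
Record is_hilbert_tensor : Prop := IsHilbertTensor {
  tensor_linear0 : forall v w, linear (fun u => t u v w);
  tensor_linear1 : forall u w, linear (fun v => t u v w);
  tensor_linear2 : forall u v, linear (fun w => t u v w);
  tensor_dot : forall u v w u' v' w', hdot K (t u v w) (t u' v' w') =
    hdot H0 u u' * hdot H1 v v' * hdot H2 w w';
  tensor_dense : closure [set z | exists n (u : 'I_n -> H0) (v : 'I_n -> H1)
    (w : 'I_n -> H2), z = \sum_(i < n) t (u i) (v i) (w i)] = setT }.

(* T is the operator x0 (x) x1 (x) x2 *)
Definition is_tensor_op (x0 : H0 -> H0) (x1 : H1 -> H1) (x2 : H2 -> H2)
    (T : K -> K) :=
  bounded_operators T /\
  forall u v w, T (t u v w) = t (x0 u) (x1 v) (x2 w).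

Definition elementary_tensors (A0 : set (H0 -> H0)) (A1 : set (H1 -> H1))
    (A2 : set (H2 -> H2)) : set (K -> K) :=
  [set T | exists x0 x1 x2,
    [/\ A0 x0, A1 x1, A2 x2 & is_tensor_op x0 x1 x2 T]].

Definition vNa_tensor A0 A1 A2 : set (K -> K) :=
  vNa_generated (elementary_tensors A0 A1 A2).

(* Being normal, the product trace is determined by its values on elementary
   tensors. *)
Definition is_tracial_tensor (M0 : tracial_vNa H0) (M1 : tracial_vNa H1)
    (M2 : tracial_vNa H2) (P : tracial_vNa K) :=
  vna P = vNa_tensor (vna M0) (vna M1) (vna M2) /\
  forall x0 x1 x2 T, vna M0 x0 -> vna M1 x1 -> vna M2 x2 ->
    is_tensor_op x0 x1 x2 T ->
    trace P T = trace M0 x0 * trace M1 x1 * trace M2 x2.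

End TensorProduct.

Definition scalar_operators (R : realType) (H : hilbertType R) :
    set (H -> H) :=
  [set f | exists c : Cplx R, f = c *: (idfun : H -> H)].

(* Main.v *)
(** It suffices to show that if x in (M (x) N1)^omega commutes with every central
    sequence of M, then it commutes with every y in M' /\ (M (x) N2)^omega: with N1
    and N2 exchanged, this shows that a central sequence of M commutes with x, as
    M' /\ M^omega is abelian; then it applies to x and y themselves.

    Approximate y_n in 2-norm by z = sum_j m_j (x) e_j, bounded in operator norm
    uniformly in n, with (e_j) orthonormal for the trace of N2. Since x_n commutes with
    N2 and the trace is multiplicative, |[x_n, z]|_2^2 = sum_j |[x_n, m_j]|_2^2, which
    is the average over signs of |[x_n, b]|_2^2 for b = sum_j +-m_j in M; likewise
    |[z, f]|_2^2 is the average of |[b, f]|_2^2 for f in M. The average of |b|_4^4 is at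
    most 3 |z|^4, so that replacing b by b (1 + r^2 b^* b)^-1, which has norm at most
    1/r, changes b little in 2-norm, and it preserves small commutators. So if [x, y]
    were not 0, some choice of signs would give b_n in M, bounded, asymptotically
    central, and asymptotically not commuting with x.

    The approximation by algebraic tensors comes from von Neumann's bicommutant
    argument, applied in l2(K) to the vectors that define a normal trace, followed by
    the same truncation to keep the norm bounded (in place of Kaplansky's theorem). *)

From HB Require Import structures.
Require Import Defs.
From mathcomp Require Import all_boot all_order all_algebra complex.
From mathcomp Require Import all_classical all_reals all_analysis.
From mathcomp Require Import ring lra.

Set Implicit Arguments.
Unset Strict Implicit.
Unset Printing Implicit Defensive.

Import Order.TTheory GRing.Theory Num.Theory Num.Def.
Import numFieldNormedType.Exports.

Local Open Scope classical_set_scope.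
Local Open Scope ring_scope.
Local Open Scope quotient_scope.

(** The obstacle is that no operator-norm bound on sum_j +-m_j is available: the number of terms
    depends on n. What stays bounded uniformly in n is the fourth moment, and this is what a
    truncation costs. The truncation must also keep commutators small, which speaks against cutting
    off by spectral projections. With a resolvent, the commutators of b and b^* with f enter
    linearly, between factors of norm at most 1.

    One choice of signs has to serve several demands at once: a large commutator with x, small ones
    with finitely many elements of M, and a small fourth moment. They are therefore put into one
    functional before averaging, the small commutators with a weight that grows with their number. A
    diagonal argument along omega, over a 2-norm dense sequence of M, then makes the selected
    sequence asymptotically central.

    Norms enter through their squares, [q] for the 2-norm and [obound] for the operator norm, and
    the only functional calculus is the resolvent of 1 + a^* a. *)

Section ComplexReal.
Variable R : realType.
Local Notation C := (Cplx R).

Definition cre (z : C) : R := complex.Re z.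
Definition cim (z : C) : R := complex.Im z.
Definition rc (r : R) : C := real_complex R r.
Definition ci : C := 'i%C.

Lemma creD z w : cre (z + w) = cre z + cre w.
Proof. by case: z w => [a b] [c d]. Qed.
Lemma creN z : cre (- z) = - cre z.
Proof. by case: z => [a b]. Qed.
Lemma cre_rc r : cre (rc r) = r. Proof. by []. Qed.
Lemma cim_rc r : cim (rc r) = 0. Proof. by []. Qed.
Lemma cre0 : cre 0 = 0. Proof. by []. Qed.
Lemma cre_conj z : cre z^* = cre z.
Proof. by case: z => [a b]. Qed.
Lemma cim_conj z : cim z^* = - cim z.
Proof. by case: z => [a b]. Qed.
Lemma cimD z w : cim (z + w) = cim z + cim w.
Proof. by case: z w => [a b] [c d]. Qed.
Lemma creM z w : cre (z * w) = cre z * cre w - cim z * cim w.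
Proof. by case: z w => [a b] [c d]. Qed.
Lemma cimM z w : cim (z * w) = cre z * cim w + cim z * cre w.
Proof. by case: z w => [a b] [c d]. Qed.
Lemma creMl r z : cre (rc r * z) = r * cre z.
Proof. by rewrite creM cim_rc mul0r subr0. Qed.
Lemma cre_ci z : cre (ci * z) = - cim z.
Proof. by case: z => [a b]; rewrite creM /= mul0r mul1r sub0r. Qed.
Lemma cim_ci z : cim (ci * z) = cre z.
Proof. by case: z => [a b]; rewrite cimM /= mul0r mul1r add0r. Qed.
Lemma cplx_eq z w : cre z = cre w -> cim z = cim w -> z = w.
Proof. by case: z w => [a b] [c d] /= -> ->. Qed.
Lemma rcD r s : rc (r + s) = rc r + rc s.
Proof. by apply: cplx_eq; rewrite ?creD ?cimD //= addr0. Qed.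
Lemma rcM r s : rc (r * s) = rc r * rc s.
Proof. by apply: cplx_eq; rewrite ?creM ?cimM /=; ring. Qed.
Lemma rcX r n : rc (r ^+ n) = rc r ^+ n.
Proof. by elim: n => [|n IH]; rewrite ?expr0 // !exprS rcM IH. Qed.
Lemma rc0 : rc 0 = 0. Proof. by []. Qed.
Lemma rc1 : rc 1 = 1. Proof. by []. Qed.
Lemma conj_rc r : (rc r)^* = rc r.
Proof. by apply: cplx_eq; rewrite ?cre_conj ?cim_conj //= oppr0. Qed.
Lemma conj_ci : ci^* = - ci.
Proof. by apply: cplx_eq; rewrite ?cre_conj ?cim_conj //= ?oppr0. Qed.
Lemma ge0_cplx z : 0 <= z -> 0 <= cre z /\ cim z = 0.
Proof. by case: z => a b; rewrite lecE /= => /andP[/eqP-> ->]. Qed.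
Lemma ler_rc r s : (rc r <= rc s) = (r <= s).
Proof. exact: lecR. Qed.
Lemma ltr_rc r s : (rc r < rc s) = (r < s).
Proof. exact: ltcR. Qed.
Lemma rc_cre z : 0 <= z -> rc (cre z) = z.
Proof. by move=> /ge0_cplx[_ h]; apply: cplx_eq => //=; rewrite h. Qed.
Lemma sqr_norm_cplx z : `|z| ^+ 2 = rc (cre z ^+ 2 + cim z ^+ 2).
Proof. by rewrite -(add_Re2_Im2 z). Qed.

End ComplexReal.

(** * The real inner product of a complex Hilbert space *)

Section RealInner.
Variables (R : realType) (H : hilbertType R).
Implicit Types (u v w : H) (r : R) (c : Cplx R).

(** The real part determines the whole inner product, by [cim_hdot]; working with it keeps the
    estimates in R, within reach of [lra] and [nra]. *)
Definition rdot u v : R := cre (hdot H u v).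
Definition nsq v : R := rdot v v.

Lemma hdotC u v : hdot H u v = (hdot H v u)^*.
Proof.
have := @hermC _ _ _ _ (hdot H) u v.
by rewrite expr0 mul1r.
Qed.

Lemma rdotC u v : rdot u v = rdot v u.
Proof. by rewrite /rdot hdotC cre_conj. Qed.
Lemma rdotDl u v w : rdot (u + v) w = rdot u w + rdot v w.
Proof. by rewrite /rdot linearDl creD. Qed.
Lemma rdotDr u v w : rdot u (v + w) = rdot u v + rdot u w.
Proof. by rewrite !(rdotC u) rdotDl. Qed.
Lemma rdotNl u v : rdot (- u) v = - rdot u v.
Proof. by rewrite /rdot linearNl creN. Qed.
Lemma rdotNr u v : rdot u (- v) = - rdot u v.
Proof. by rewrite !(rdotC u) rdotNl. Qed.
Lemma rdot0l v : rdot 0 v = 0.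
Proof. by rewrite /rdot linear0l cre0. Qed.
Lemma rdot0r v : rdot v 0 = 0.
Proof. by rewrite rdotC rdot0l. Qed.
Lemma rdotZl r u v : rdot (rc r *: u) v = r * rdot u v.
Proof. by rewrite /rdot linearZl_LR creMl. Qed.
Lemma rdotZr r u v : rdot u (rc r *: v) = r * rdot u v.
Proof. by rewrite !(rdotC u) rdotZl. Qed.
Lemma cim_hdot u v : cim (hdot H u v) = - rdot (ci R *: u) v.
Proof. by rewrite /rdot linearZl_LR cre_ci opprK. Qed.

Lemma hdot_nsq v : hdot H v v = rc (nsq v).
Proof. by rewrite /nsq /rdot rc_cre //; apply: dnorm_ge0. Qed.
Lemma nsq_norm v : `|v| ^+ 2 = rc (nsq v).
Proof. by rewrite hilbert_normE hdot_nsq. Qed.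
Lemma nsq_ge0 v : 0 <= nsq v.
Proof. by rewrite -ler_rc -nsq_norm rc0 exprn_ge0. Qed.
Lemma nsq0 : nsq 0 = 0. Proof. exact: rdot0l. Qed.
Lemma nsq_eq0 v : nsq v = 0 -> v = 0.
Proof.
move=> h; apply/eqP; rewrite -normr_eq0 -sqrf_eq0; apply/eqP.
by rewrite nsq_norm h.
Qed.
Lemma nsqD u v : nsq (u + v) = nsq u + 2 * rdot u v + nsq v.
Proof. by rewrite /nsq rdotDl !rdotDr (rdotC v u); ring. Qed.
Lemma nsqB u v : nsq (u - v) = nsq u - 2 * rdot u v + nsq v.
Proof. by rewrite nsqD rdotNr /nsq rdotNl rdotNr; ring. Qed.
Lemma nsqN v : nsq (- v) = nsq v.
Proof. by rewrite /nsq rdotNl rdotNr opprK. Qed.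
Lemma nsqZ c v : nsq (c *: v) = (cre c ^+ 2 + cim c ^+ 2) * nsq v.
Proof.
have /(congr1 (@cre R)) : rc (nsq (c *: v)) =
    rc ((cre c ^+ 2 + cim c ^+ 2) * nsq v).
  by rewrite -nsq_norm normrZ exprMn nsq_norm rcM sqr_norm_cplx.
by rewrite !cre_rc.
Qed.
Lemma nsqZr r v : nsq (rc r *: v) = r ^+ 2 * nsq v.
Proof. by rewrite nsqZ cre_rc cim_rc expr0n addr0. Qed.
Lemma nsqDle u v : nsq (u + v) <= 2 * nsq u + 2 * nsq v.
Proof. have := nsq_ge0 (u - v); rewrite nsqB nsqD; lra. Qed.
Lemma nsqBle u v : nsq (u - v) <= 2 * nsq u + 2 * nsq v.
Proof. by rewrite -(nsqN v) nsqDle. Qed.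
Lemma rdot_amgm u v : 2 * rdot u v <= nsq u + nsq v.
Proof. have := nsq_ge0 (u - v); rewrite nsqB; lra. Qed.

Lemma rdot_CS u v : rdot u v ^+ 2 <= nsq u * nsq v.
Proof.
have [h|nv] := eqVneq (nsq v) 0.
  by rewrite (nsq_eq0 h) rdot0r nsq0 mulr0 expr0n.
have v0 : 0 < nsq v by rewrite lt_def nv nsq_ge0.
have := nsq_ge0 (rc (nsq v) *: u - rc (rdot u v) *: v).
rewrite nsqB !nsqZr rdotZl rdotZr.
have -> : (nsq v) ^+ 2 * nsq u - 2 * (nsq v * (rdot u v * rdot u v)) +
   rdot u v ^+ 2 * nsq v = nsq v * (nsq u * nsq v - rdot u v ^+ 2) by ring.
by rewrite pmulr_rge0// subr_ge0.
Qed.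

(** Cauchy-Schwarz for the real and for the imaginary part gives |<u, v>|^2 <= 2 |u|^2 |v|^2. The
    weaker sum of squares is what can be summed over a square-summable family. *)
Lemma hdot_bound u v : `|hdot H u v| <= rc (nsq u + nsq v).
Proof.
rewrite -(@ler_pXn2r _ 2) ?nnegrE //; last first.
  by rewrite -rc0 ler_rc addr_ge0 ?nsq_ge0.
rewrite sqr_norm_cplx (expr2 (rc _)) -rcM ler_rc cim_hdot -/(rdot u v) sqrrN.
have := rdot_CS u v; have := rdot_CS (ci R *: u) v.
rewrite nsqZ /= expr0n expr1n add0r mul1r.
have := nsq_ge0 u; have := nsq_ge0 v; nra.
Qed.

Lemma rdot_ext u v : (forall w, rdot u w = rdot v w) -> u = v.
Proof.
move=> h; apply/eqP; rewrite -subr_eq0; apply/eqP; apply: nsq_eq0.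
by rewrite /nsq rdotDl rdotNl h subrr.
Qed.

Lemma nsq_le_norm (r : R) u v : nsq u <= r ^+ 2 * nsq v -> 0 <= r ->
  `|u| <= rc r * `|v|.
Proof.
move=> h r0; rewrite -(@ler_pXn2r _ 2) ?nnegrE //; last first.
  by rewrite mulr_ge0 // -rc0 ler_rc.
by rewrite exprMn !nsq_norm -[rc r ^+ 2]/(rc r * rc r) -!rcM ler_rc.
Qed.

Lemma norm_le_nsq (r : R) u v : `|u| <= rc r * `|v| -> nsq u <= r ^+ 2 * nsq v.
Proof.
move=> h; rewrite -ler_rc rcM rcX -!nsq_norm -exprMn.
by rewrite ler_pXn2r // nnegrE //; apply: le_trans h.
Qed.

End RealInner.

(** * The algebra of a tracial von Neumann algebra *)

Section Vop.
Variables (R : realType) (H : hilbertType R) (P : tracial_vNa H).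
Local Notation C := (Cplx R).

(** Bundling membership turns the set [vna P] into a type, which can carry the ring and algebra
    structures below. *)
Record vop := Vop { vfun :> H -> H; vfunP : vna P vfun }.

Lemma vop_ext (a b : vop) : (forall v, a v = b v) -> a = b.
Proof.
case: a b => [f hf] [g hg] /= /funext fg; case: _ / fg hg => hg.
by rewrite (Prop_irrelevance hf hg).
Qed.

Lemma vop_linear (a : vop) : linear a.
Proof. by case: (vNa_bounded (vnaP P) (vfunP a)). Qed.
Lemma vopD (a : vop) u v : a (u + v) = a u + a v.
Proof. by rewrite -[u in LHS]scale1r vop_linear scale1r. Qed.
Lemma vop0 (a : vop) : a 0 = 0.
Proof. by apply: (addrI (a 0)); rewrite -vopD !addr0. Qed.
Lemma vopZ (a : vop) c v : a (c *: v) = c *: a v.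
Proof. by rewrite -[c *: v]addr0 vop_linear vop0 addr0. Qed.
Lemma vopN (a : vop) v : a (- v) = - a v.
Proof. by rewrite -scaleN1r vopZ scaleN1r. Qed.
Lemma vopB (a : vop) u v : a (u - v) = a u - a v.
Proof. by rewrite vopD vopN. Qed.

Lemma vnaZ (c : C) f : vna P f -> vna P (c *: f).
Proof.
rewrite -(vNa_bicommutant (vnaP P)) => -[[lf cf] h]; split.
  split=> [d u v|x]; last exact: cvgZr (cf x).
  by rewrite ?fctE lf scalerDr scalerA mulrC -scalerA.
move=> g hg; apply/funext => v /=; rewrite ?fctE.
have /(congr1 (@^~ v)) /= -> := h _ hg.
have [[lg _] _] := hg.
have g0 : g 0 = 0 by apply: (addrI (g 0)); rewrite addr0 -{1}[g 0]scale1r -lg scale1r add0r.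
by rewrite -[c *: f v in RHS]addr0 lg g0 addr0.
Qed.

Definition vop_zero := Vop (vna0 P).
Definition vop_one := Vop (vna_id P).
Definition vop_add (a b : vop) := Vop (vnaD (vfunP a) (vfunP b)).
Definition vop_scale (c : C) (a : vop) := Vop (vnaZ c (vfunP a)).
Definition vop_opp (a : vop) := vop_scale (-1) a.
Definition vop_mul (a b : vop) := Vop (vna_comp (vfunP a) (vfunP b)).

HB.instance Definition _ := gen_eqMixin vop.
HB.instance Definition _ := gen_choiceMixin vop.

Fact vop_addA : associative vop_add.
Proof. by move=> a b c; apply: vop_ext => v; rewrite /= ?fctE /= ?fctE addrA. Qed.
Fact vop_addC : commutative vop_add.
Proof. by move=> a b; apply: vop_ext => v; rewrite /= ?fctE addrC. Qed.
Fact vop_add0 : left_id vop_zero vop_add.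
Proof. by move=> a; apply: vop_ext => v; rewrite /= ?fctE add0r. Qed.
Fact vop_addN : left_inverse vop_zero vop_opp vop_add.
Proof.
by move=> a; apply: vop_ext => v; rewrite /= ?fctE /= ?fctE scaleN1r addNr.
Qed.
HB.instance Definition _ :=
  GRing.isZmodule.Build vop vop_addA vop_addC vop_add0 vop_addN.

Lemma vaddE (a b : vop) v : (a + b) v = a v + b v. Proof. by []. Qed.
Lemma voppE (a : vop) v : (- a) v = - a v.
Proof. by rewrite -[- a]/(vop_opp a) /= fctE scaleN1r. Qed.
Lemma vzeroE v : (0 : vop) v = 0. Proof. by []. Qed.
Lemma vsubE (a b : vop) v : (a - b) v = a v - b v.
Proof. by rewrite vaddE voppE. Qed.

Fact vop_mulA : associative vop_mul.
Proof. by move=> a b c; apply: vop_ext. Qed.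
Fact vop_mul1r : left_id vop_one vop_mul.
Proof. by move=> a; apply: vop_ext. Qed.
Fact vop_mulr1 : right_id vop_one vop_mul.
Proof. by move=> a; apply: vop_ext. Qed.
Fact vop_mulDl : left_distributive vop_mul +%R.
Proof. by move=> a b c; apply: vop_ext. Qed.
Fact vop_mulDr : right_distributive vop_mul +%R.
Proof. by move=> a b c; apply: vop_ext => v /=; rewrite ?fctE /= vopD. Qed.
Fact vop_oner_neq0 : vop_one != 0.
Proof.
apply/eqP => /(congr1 vfun) /= e10.
have := trace_linear (traceP P) 1 (vna0 P) (vna0 P).
rewrite scale1r addr0 mul1r => /(congr1 (fun x => x - trace P 0)).
rewrite addrK subrr => h; have := trace_unit (traceP P); rewrite e10 -h.
by move/eqP; rewrite eq_sym oner_eq0.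
Qed.
HB.instance Definition _ := GRing.Zmodule_isNzRing.Build vop
  vop_mulA vop_mul1r vop_mulr1 vop_mulDl vop_mulDr vop_oner_neq0.

Fact vop_scaleA c d (a : vop) : vop_scale c (vop_scale d a) = vop_scale (c * d) a.
Proof. by apply: vop_ext => v; rewrite /= ?fctE /= ?fctE scalerA. Qed.
Fact vop_scale1 : left_id 1 vop_scale.
Proof. by move=> a; apply: vop_ext => v; rewrite /= ?fctE scale1r. Qed.
Fact vop_scaleDr : right_distributive vop_scale +%R.
Proof. by move=> c a b; apply: vop_ext => v; rewrite /= ?fctE /= ?fctE scalerDr. Qed.
Fact vop_scaleDl (a : vop) : {morph vop_scale^~ a : c d / c + d}.
Proof. by move=> c d; apply: vop_ext => v; rewrite /= ?fctE /= ?fctE scalerDl. Qed.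
HB.instance Definition _ := GRing.Zmodule_isLmodule.Build C vop
  vop_scaleA vop_scale1 vop_scaleDr vop_scaleDl.
Fact vop_scaleAl (c : C) (a b : vop) : c *: (a * b) = (c *: a) * b.
Proof. by apply: vop_ext. Qed.
HB.instance Definition _ := GRing.Lmodule_isLalgebra.Build C vop vop_scaleAl.
Fact vop_scaleAr (c : C) (a b : vop) : c *: (a * b) = a * (c *: b).
Proof. by apply: vop_ext => v /=; rewrite ?fctE /= vopZ. Qed.
HB.instance Definition _ := GRing.Lalgebra_isAlgebra.Build C vop vop_scaleAr.

Lemma vmulE (a b : vop) v : (a * b) v = a (b v). Proof. by []. Qed.
Lemma voneE v : (1 : vop) v = v. Proof. by []. Qed.
Lemma vscaleE c (a : vop) v : (c *: a) v = c *: a v. Proof. by []. Qed.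

Definition star (a : vop) : vop := Vop (vna_adj (vfunP a)).1.

Implicit Types a b x y : vop.

Lemma hdot_star a u v : hdot H (a u) v = hdot H u (star a v).
Proof. exact: (vna_adj (vfunP a)).2. Qed.
Lemma rdot_star a u v : rdot (a u) v = rdot u (star a v).
Proof. by rewrite /rdot hdot_star. Qed.
Lemma rdot_starr a u v : rdot u (a v) = rdot (star a u) v.
Proof. by rewrite rdotC rdot_star rdotC. Qed.
Lemma star_uniq a b : (forall u v, rdot (a u) v = rdot u (b v)) -> star a = b.
Proof.
move=> h; apply: vop_ext => v; apply: rdot_ext => u.
by rewrite rdotC -rdot_star h rdotC.
Qed.
Lemma starK : involutive star.
Proof. by move=> a; apply: star_uniq => u v; rewrite rdot_starr. Qed.
Lemma starD a b : star (a + b) = star a + star b.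
Proof. by apply: star_uniq => u v; rewrite !vaddE rdotDl rdotDr !rdot_star. Qed.
Lemma starN a : star (- a) = - star a.
Proof. by apply: star_uniq => u v; rewrite !voppE rdotNl rdotNr rdot_star. Qed.
Lemma starB a b : star (a - b) = star a - star b.
Proof. by rewrite starD starN. Qed.
Lemma star0 : star 0 = 0.
Proof. by apply: (addrI (star 0)); rewrite -starD !addr0. Qed.
Lemma starM a b : star (a * b) = star b * star a.
Proof. by apply: star_uniq => u v; rewrite !vmulE !rdot_star. Qed.
Lemma star1 : star 1 = 1.
Proof. by apply: star_uniq. Qed.
Lemma starZ c a : star (c *: a) = c^* *: star a.
Proof.
apply: star_uniq => u v; rewrite !vscaleE /rdot linearZl_LR linearZr_LR /=.
by rewrite hdot_star conjCK.
Qed.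
Lemma star_sum I (s : seq I) (F : I -> vop) :
  star (\sum_(i <- s) F i) = \sum_(i <- s) star (F i).
Proof. exact: (big_morph star starD star0). Qed.

(* Squares are compared, so the constant is the square of a norm bound. *)
Definition obound (c : R) a := forall v, nsq (a v) <= c * nsq v.

Lemma oboundM c d a b : 0 <= c -> obound c a -> obound d b -> obound (c * d) (a * b).
Proof.
move=> c0 ha hb v; rewrite vmulE (le_trans (ha _))// -mulrA.
exact: ler_wpM2l.
Qed.
Lemma oboundW c d a : c <= d -> obound c a -> obound d a.
Proof. by move=> cd h v; rewrite (le_trans (h v))// ler_wpM2r// nsq_ge0. Qed.
Lemma oboundD c d a b : obound c a -> obound d b -> obound (2 * (c + d)) (a + b).
Proof.
move=> ha hb v; rewrite vaddE (le_trans (nsqDle _ _))//.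
have := ha v; have := hb v; lra.
Qed.
Lemma obound1 : obound 1 1.
Proof. by move=> v; rewrite mul1r. Qed.
Lemma oboundN c a : obound c a -> obound c (- a).
Proof. by move=> h v; rewrite voppE nsqN. Qed.
Lemma oboundZ r c a : obound c a -> obound (r ^+ 2 * c) (rc r *: a).
Proof. by move=> h v; rewrite vscaleE nsqZr -mulrA ler_wpM2l// sqr_ge0. Qed.

(** Cauchy-Schwarz: |a^* v|^4 = <a a^* v, v>^2 <= c |a^* v|^2 |v|^2, and |a^* v|^2 cancels. *)
Lemma obound_star c a : 0 <= c -> obound c a -> obound c (star a).
Proof.
move=> c0 h v; have [h0|n0] := eqVneq (nsq (star a v)) 0.
  by rewrite h0 mulr_ge0// nsq_ge0.
have p0 : 0 < nsq (star a v) by rewrite lt_def n0 nsq_ge0.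
have := rdot_CS (a (star a v)) v; rewrite rdot_star -/(nsq _) expr2 => cs.
have : nsq (star a v) * nsq (star a v) <= c * nsq (star a v) * nsq v.
  by rewrite (le_trans cs)// ler_wpM2r// nsq_ge0.
by rewrite mulrAC -mulrA (mulrC (nsq v)) mulrA (mulrC c) -mulrA ler_pM2l.
Qed.

Lemma obound_ex a : exists2 c, 0 < c & obound c a.
Proof.
have [c c0 h] := bseq_cst_subproof (vfunP a).
have cE : c = rc (cre c) by rewrite rc_cre.
have rc0' : 0 <= cre c by have [] := ge0_cplx c0.
exists (cre c ^+ 2 + 1); first by rewrite ltr_wpDl// sqr_ge0.
move=> v; have := h 0 v; rewrite {1}cE => /norm_le_nsq.
have := nsq_ge0 v; nra.
Qed.

Definition trv a : C := trace P a.
Definition rt a : R := cre (trv a).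
(* The square of the 2-norm. *)
Definition q a : R := rt (star a * a).

Lemma trvD a b : trv (a + b) = trv a + trv b.
Proof. exact: (traceD (vfunP a) (vfunP b)). Qed.
Lemma trvZ c a : trv (c *: a) = c * trv a.
Proof.
have := trace_linear (traceP P) c (vfunP a) (vna0 P); rewrite addr0 => e.
rewrite -[LHS]/(trace P (c *: (a : H -> H))) e.
have -> : trace P 0 = 0; last by rewrite addr0.
by apply: (addrI (trace P 0)); rewrite -(traceD (vna0 P) (vna0 P)) !addr0.
Qed.
Lemma trvN a : trv (- a) = - trv a.
Proof. by rewrite -scaleN1r trvZ mulN1r. Qed.
Lemma trv0 : trv 0 = 0.
Proof. by apply: (addrI (trv 0)); rewrite -trvD !addr0. Qed.
Lemma trvB a b : trv (a - b) = trv a - trv b.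
Proof. by rewrite trvD trvN. Qed.
Lemma trvC a b : trv (a * b) = trv (b * a).
Proof. exact: (trace_comm (traceP P) (vfunP a) (vfunP b)). Qed.
Lemma trv1 : trv 1 = 1. Proof. exact: (trace_unit (traceP P)). Qed.
Lemma trv_sum I (s : seq I) (F : I -> vop) :
  trv (\sum_(i <- s) F i) = \sum_(i <- s) trv (F i).
Proof. exact: (big_morph trv trvD trv0). Qed.

Lemma rtD a b : rt (a + b) = rt a + rt b.
Proof. by rewrite /rt trvD creD. Qed.
Lemma rtN a : rt (- a) = - rt a.
Proof. by rewrite /rt trvN creN. Qed.
Lemma rtB a b : rt (a - b) = rt a - rt b.
Proof. by rewrite rtD rtN. Qed.
Lemma rt0 : rt 0 = 0. Proof. by rewrite /rt trv0. Qed.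
Lemma rtZ r a : rt (rc r *: a) = r * rt a.
Proof. by rewrite /rt trvZ creMl. Qed.
Lemma rtC a b : rt (a * b) = rt (b * a).
Proof. by rewrite /rt trvC. Qed.
Lemma rt_sum I (s : seq I) (F : I -> vop) :
  rt (\sum_(i <- s) F i) = \sum_(i <- s) rt (F i).
Proof. exact: (big_morph rt rtD rt0). Qed.

Lemma trv_ge0 a : 0 <= trv (star a * a).
Proof. exact: (trace_ge0 (traceP P) (vfunP a)). Qed.
Lemma trv_q a : trv (star a * a) = rc (q a).
Proof. by rewrite /q /rt rc_cre// trv_ge0. Qed.
Lemma q_ge0 a : 0 <= q a.
Proof. by have [] := ge0_cplx (trv_ge0 a). Qed.
Lemma q0 : q 0 = 0. Proof. by rewrite /q mulr0 rt0. Qed.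
Lemma q_eq0 a : q a = 0 -> a = 0.
Proof.
move=> h; have := trv_q a; rewrite h => h0.
have := trace_faithful (traceP P) (vfunP a) h0.
by case: a {h h0} => f hf /= h; apply: vop_ext => v /=; rewrite h.
Qed.
Lemma qN a : q (- a) = q a.
Proof. by rewrite /q starN mulrNN. Qed.
Lemma qC a b : q (a - b) = q (b - a).
Proof. by rewrite -qN opprB. Qed.
Lemma q_star a : q (star a) = q a.
Proof. by rewrite /q starK rtC. Qed.

(** Positivity on (1 + b)^* (1 + b) forces trv b + trv (star b) to be real; the same for i b
    compares the real parts. *)
Lemma trv_star a : trv (star a) = (trv a)^*.
Proof.
have key (b : vop) : cim (trv (star b)) = - cim (trv b).
  have [_] := ge0_cplx (trv_ge0 (1 + b)); rewrite starD star1.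
  rewrite mulrDl mul1r mulrDr mulr1 !trvD trv1 !cimD.
  have [_ ->] := ge0_cplx (trv_ge0 b).
  rewrite (_ : cim 1 = 0) // add0r addr0 => /eqP.
  by rewrite addr_eq0 => /eqP ->; rewrite opprK.
apply: cplx_eq; last by rewrite cim_conj key.
have := key (ci R *: a); rewrite starZ conj_ci !trvZ mulNr cim_ci.
rewrite -[X in _ = - X]cim_ci cre_conj.
have cimN z : cim (- z) = - cim z :> R by case: z.
by rewrite cimN !cim_ci => /oppr_inj.
Qed.
Lemma rt_star a : rt (star a) = rt a.
Proof. by rewrite /rt trv_star cre_conj. Qed.
Lemma rt_sym a b : rt (star a * b) = rt (star b * a).
Proof. by rewrite -rt_star starM starK. Qed.

Lemma qD a b : q (a + b) = q a + 2 * rt (star a * b) + q b.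
Proof.
rewrite /q starD mulrDl !mulrDr !rtD (rt_sym b a); lra.
Qed.
Lemma qB a b : q (a - b) = q a - 2 * rt (star a * b) + q b.
Proof. by rewrite qD qN mulrN rtN; lra. Qed.
Lemma qDle a b : q (a + b) <= 2 * q a + 2 * q b.
Proof. have := q_ge0 (a - b); rewrite qB qD; lra. Qed.
Lemma qBle a b : q (a - b) <= 2 * q a + 2 * q b.
Proof. by rewrite -(qN b) qDle. Qed.
Lemma qZ c a : q (c *: a) = (cre c ^+ 2 + cim c ^+ 2) * q a.
Proof.
rewrite /q starZ -scalerAl -scalerAr scalerA /rt trvZ [X in X * _]mulrC -normCK.
by rewrite sqr_norm_cplx creMl.
Qed.
Lemma qZr r a : q (rc r *: a) = r ^+ 2 * q a.
Proof. by rewrite qZ cre_rc cim_rc expr0n addr0. Qed.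
Lemma rt_amgm a b : 2 * rt (star a * b) <= q a + q b.
Proof. have := q_ge0 (a - b); rewrite qB; lra. Qed.

End Vop.

(** * Normality and boundedness of the trace *)

(* The second hypothesis is log-convexity, [N k.+1 ^+ 2 <= N k * N k.+2], freed of
   square roots. *)
Lemma power_growth (R : realType) (N : nat -> R) (C r : R) :
  (forall k, 0 <= N k) ->
  (forall k s, 0 <= s -> 2 * s * N k.+1 <= N k.+2 + s ^+ 2 * N k) ->
  (forall k, N k <= C * r ^+ k) -> 0 <= r -> N 1%N <= r * N 0%N.
Proof.
move=> N0 NN NC r0; rewrite leNgt; apply/negP => lt1.
have N00 : 0 < N 0%N.
  rewrite lt_def N0 andbT; apply/eqP => N00.
  rewrite N00 mulr0 in lt1.
  (* If N 0 = 0, convexity bounds 2 s N 1 by N 2 for all s >= 0; this s is large enough to refute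
     it. *)
  have := NN 0%N (N 2%N / N 1%N + 1).
  rewrite N00 mulr0 addr0 addr_ge0 ?divr_ge0// => /(_ isT).
  rewrite -mulrA (mulrDl _ _ (N 1%N)) divfK ?gt_eqF//.
  by have := N0 2%N; lra.
(* By convexity every step multiplies N by at least the first ratio s. If s > r, Bernoulli's
   inequality makes (s / r)^k exceed the constant C / N 0. *)
set s := N 1%N / N 0%N.
have rs : r < s by rewrite /s ltr_pdivlMr.
have s0 : 0 <= s by rewrite /s divr_ge0.
have step k : s * N k <= N k.+1.
  elim: k => [|k IH]; first by rewrite /s divfK ?gt_eqF.
  have := NN k s s0; have := ler_wpM2l s0 IH; rewrite mulrA -expr2; lra.
have geo k : s ^+ k * N 0%N <= N k.
  elim: k => [|k IH]; first by rewrite expr0 mul1r.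
  by rewrite exprS -mulrA (le_trans _ (step k))// ler_wpM2l.
have r_gt0 : 0 < r.
  rewrite lt_def r0 andbT; apply/eqP => r00.
  by have := NC 1%N; rewrite r00 expr1 mulr0 leNgt; move: lt1; rewrite r00 mul0r => ->.
set u := s / r - 1.
have u0 : 0 < u by rewrite /u subr_gt0 ltr_pdivlMr// mul1r.
have bern k : 1 + k%:R * u <= (s / r) ^+ k.
  elim: k => [|k IH]; first by rewrite expr0 mul0r addr0.
  rewrite exprS (_ : s / r = 1 + u); last by rewrite /u; ring.
  rewrite (_ : s / r = 1 + u) in IH; last by rewrite /u; ring.
  have := ler_wpM2l (ltW (addr_gt0 (@ltr01 R) u0)) IH; rewrite -natr1.
  have : 0 <= k%:R * u * u by rewrite !mulr_ge0// ltW.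
  lra.
have bnd k : k%:R * u <= C / N 0%N.
  rewrite ler_pdivlMr//.
  have := le_trans (geo k) (NC k).
  rewrite -ler_pdivrMr ?exprn_gt0// mulrAC -expr_div_n => h.
  by have := ler_wpM2r (ltW N00) (bern k); lra.
have k0 : 0 <= `|C / N 0%N / u| := normr_ge0 _.
have := archi_boundP k0; move: (Num.bound _) => k lt.
have := bnd k; rewrite -ler_pdivlMr// leNgt => /negP; apply.
by rewrite (le_lt_trans (ler_norm _)).
Qed.

Section Limits.
Variable R : realType.
Local Notation C := (Cplx R).

Lemma limn_norm_le (u : nat -> C) (M : R) :
  0 <= M -> (forall n, `|u n| <= rc M) -> `|limn u| <= rc M.
Proof.
move=> M0 uM; have [cu|ncu] := pselect (cvgn u); last first.
  (* [limn] of a divergent sequence is the default point 0. *)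
  have -> : limn u = 0 by apply: dvgP.
  by rewrite normr0 -rc0 ler_rc.
have Mr : rc M \is Num.real by rewrite ger0_real// -rc0 ler_rc.
rewrite real_leNgt ?normr_real//; apply/negP => lt.
move/cvgrPdist_lt : cu => /(_ (`|limn u| - rc M)); rewrite subr_gt0 lt => /(_ isT).
case=> n _ /(_ n (leqnn n)) /= h.
have := le_lt_trans (lerB_dist _ _) h.
rewrite ltrD2l ltrN2 => h2; have := lt_le_trans h2 (uM n).
by rewrite ltxx.
Qed.
End Limits.

(** * Completeness and boundedness in terms of squared norms *)

Section HilbertFacts.
Variables (R : realType) (H : hilbertType R).
Local Notation C := (Cplx R).

Lemma gt0_cplx (e : C) : 0 < e -> 0 < cre e /\ e = rc (cre e).
Proof.
move=> e0; have ee : e = rc (cre e) by rewrite rc_cre// ltW.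
by split=> //; rewrite -ltr_rc -ee.
Qed.

Lemma nsq_complete (z : nat -> H) :
  (forall e : R, 0 < e -> exists N, forall m n, (N <= m)%N -> (N <= n)%N ->
     nsq (z m - z n) <= e) ->
  exists p, forall e : R, 0 < e -> exists N, forall n, (N <= n)%N ->
    nsq (z n - p) <= e.
Proof.
move=> hz; have /cauchy_cvgP cz : cauchy (z n @[n --> \oo]).
  apply: cauchy_exP => e /gt0_cplx[e0 ->].
  have [N hN] := hz ((cre e / 2) ^+ 2) (exprn_gt0 2 (divr_gt0 e0 (ltr0Sn _ 1))).
  exists (z N); exists N => // n /= Nn; rewrite -ball_normE /=.
  rewrite -(@ltr_pXn2r _ 2) ?nnegrE //; last by rewrite -rc0 ler_rc ltW.
  rewrite nsq_norm -rcX ltr_rc (le_lt_trans (hN N n _ _))//.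
  by rewrite ltr_pXn2r ?nnegrE//; lra.
exists (lim (z n @[n --> \oo])) => e e0.
have rce : 0 < rc (Num.sqrt e) by rewrite -rc0 ltr_rc sqrtr_gt0.
have /cvgrPdist_lt/(_ _ rce)[N _ hN] := cz.
exists N => n Nn; have := hN n Nn; rewrite distrC => /ltW h.
have := @norm_le_nsq _ _ (Num.sqrt e) _ _; rewrite -ler_rc -nsq_norm.
move: h; rewrite -(@ler_pXn2r _ 2) ?nnegrE// ?(ltW rce)// => h.
by move=> _; rewrite (le_trans h)// -rcX sqr_sqrtr// ltW.
Qed.

Lemma bounded_operators_nsq (f : H -> H) (c : R) :
  linear f -> (forall v, nsq (f v) <= c * nsq v) -> bounded_operators f.
Proof.
move=> lf hf; split=> // x; apply/cvgrPdist_lt => e /gt0_cplx[e0 ee].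
set s := Num.sqrt (`|c| + 1).
have s0 : 0 < s by rewrite sqrtr_gt0 ltr_wpDl.
have fB u v : f (u - v) = f u - f v.
  by rewrite addrC -scaleN1r lf scaleN1r addrC.
have es : 0 < rc (cre e / s) by rewrite -rc0 ltr_rc divr_gt0.
have : \forall y \near x, `|x - y| < rc (cre e / s).
  by have /cvgrPdist_lt/(_ _ es) := @cvg_id _ (nbhs x).
apply: filterS => y hy; rewrite -fB.
have h : nsq (f (x - y)) <= s ^+ 2 * nsq (x - y).
  rewrite (le_trans (hf _))// ler_wpM2r ?nsq_ge0// sqr_sqrtr ?addr_ge0//.
  by have := ler_norm c; lra.
apply: (le_lt_trans (nsq_le_norm h (ltW s0))).
rewrite -(@ltr_pM2l _ (rc s)) in hy; last by rewrite -rc0 ltr_rc.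
by rewrite (lt_le_trans hy)// -rcM mulrC divfK ?gt_eqF// -ee.
Qed.

Lemma bounded_operators_ex (f : H -> H) : bounded_operators f ->
  exists2 c : R, 0 <= c & forall v, nsq (f v) <= c * nsq v.
Proof.
move=> [lf cf].
pose F : {linear H -> H} := HB.pack f (GRing.isLinear.Build _ _ _ _ f lf).
have /linear_boundedP/pinfty_ex_gt0[c /gt0_cplx[c0 ->] fc] :
    bounded_near F (nbhs 0) by exact/linear_bounded_continuous.
exists (cre c ^+ 2); first exact: sqr_ge0.
by move=> v; apply: norm_le_nsq; exact: fc.
Qed.

Lemma square_summable_bounded (xi : nat -> H) : square_summable xi ->
  exists B : R, forall n, \sum_(0 <= i < n) nsq (xi i) <= B.
Proof.
move=> /cvg_seq_bounded/pinfty_ex_gt0[M /gt0_cplx[M0 ->] hM].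
exists (cre M) => n; rewrite -ler_rc; apply: le_trans (hM n I).
rewrite /series /= ger0_norm; last by rewrite sumr_ge0.
rewrite (big_morph (@rc R) (@rcD R) (@rc0 R)).
by under [leRHS]eq_bigr do rewrite nsq_norm.
Qed.

End HilbertFacts.

Section TraceNormal.
Variables (R : realType) (H : hilbertType R) (P : tracial_vNa H).
Local Notation C := (Cplx R).
Local Notation vop := (vop P).

(** The functionals that control the trace at a^* b have terms <a^* b xi, eta> = <b xi, a eta>,
    bounded by |b xi|^2 + |a eta|^2. The boolean index merges xi and eta into one square-summable
    family, on which a and b only have to be small. *)
Lemma trace_normal_sq (e : R) : 0 < e ->
  exists m (z : nat -> 'I_m * bool -> H) (B d : R), 0 < d /\
    (forall n, \sum_(0 <= i < n) \sum_k nsq (z i k) <= B) /\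
    forall a b : vop,
      (forall n, \sum_(0 <= i < n) \sum_k (nsq (a (z i k)) + nsq (b (z i k))) <= d)
      -> rt (star a * b) <= e.
Proof.
move=> e0; have rce : 0 < rc e by rewrite -rc0 ltr_rc.
have [m [xi [eta [ss [d0 /gt0_cplx[d0p ->] hd]]]]] := trace_normal (traceP P) rce.
have /choice[Bx hBx] k : exists B : R, forall n, \sum_(0 <= i < n) nsq (xi k i) <= B.
  by have [/square_summable_bounded] := ss k.
have /choice[Be hBe] k : exists B : R, forall n, \sum_(0 <= i < n) nsq (eta k i) <= B.
  by have [_ /square_summable_bounded] := ss k.
pose z (i : nat) (k : 'I_m * bool) : H := if k.2 then xi k.1 i else eta k.1 i.
exists m, z, (\sum_k (Bx k + Be k)), (cre d0 / 2); split; first by rewrite divr_gt0.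
split=> [n|a b hab].
  rewrite exchange_big /= -(pair_bigA _ (fun k (b : bool) =>
    \sum_(0 <= i < n) nsq (z i (k, b)))) /=.
  by apply: ler_sum => k _; rewrite big_bool lerD ?hBx ?hBe.
have lt_e : `|trv (star a * b)| < rc e.
  apply: hd => [|k]; first exact: vfunP.
  apply: (@le_lt_trans _ _ (rc (cre d0 / 2))); last by rewrite ltr_rc; lra.
  apply: limn_norm_le => [|n]; first by lra.
  rewrite /series /= (le_trans (ler_norm_sum _ _ _))//.
  apply: (@le_trans _ _ (rc (\sum_(0 <= i < n) (nsq (b (xi k i)) + nsq (a (eta k i)))))).
    rewrite (big_morph (@rc R) (@rcD R) (@rc0 R)) ler_sum// => i _.
    by rewrite -[X in hdot _ X _]/(star a (b (xi k i))) hdot_star starK hdot_bound.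
  rewrite ler_rc (le_trans _ (hab n))// ler_sum// => i _.
  rewrite -(pair_bigA _ (fun k (c : bool) => nsq (a (z i (k, c))) + nsq (b (z i (k, c))))) /=.
  rewrite (bigD1 k)//= big_bool /= /z /=.
  rewrite -[leLHS]addr0 lerD//.
    by have := nsq_ge0 (a (xi k i)); have := nsq_ge0 (b (eta k i)); lra.
  by rewrite sumr_ge0// => j _; rewrite sumr_ge0// => c _; rewrite addr_ge0 ?nsq_ge0.
rewrite -ler_rc (le_trans _ (ltW lt_e))// (le_trans _ (normc_ge_Re _))//.
by rewrite ler_rc ler_norm.
Qed.

(** A normal functional is bounded, by scaling: [trace_normal_sq] with e = 1 applies to s 1 and s a
    for small s, whence s^2 rt a <= 1. The value of L is irrelevant, as [power_growth] is
    insensitive to constants. *)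
Lemma rt_bounded : exists2 L : R, 0 <= L &
  forall c (a : vop), 0 <= c -> obound (c ^+ 2) a -> rt a <= L * c.
Proof.
have [m [z [B [d [d0 [zB hd]]]]]] := trace_normal_sq (@ltr01 R).
have B0 : 0 <= B by have := zB 0%N; rewrite big_geq.
have bnd1 (a : vop) : obound 1 a -> d * rt a <= 2 * B + 1.
  move=> ha.
  (* On a family of total mass at most B, s 1 and s a together have mass at most 2 B s^2 <= d; the +
     1 keeps the denominator positive. *)
  set s := Num.sqrt (d / (2 * B + 1)).
  have s2 : s ^+ 2 = d / (2 * B + 1).
    by rewrite sqr_sqrtr// divr_ge0//; lra.
  have := hd (rc s *: 1) (rc s *: a).
  rewrite starZ conj_rc star1 -scalerAl -scalerAr mul1r scalerA -rcM rtZ.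
  rewrite -expr2 s2 => h.
  rewrite -[leRHS]mul1r -ler_pdivrMr; last by lra.
  rewrite mulrAC h// => n.
  apply: (@le_trans _ _ (s ^+ 2 * (2 * B))).
    apply: (@le_trans _ _ (\sum_(0 <= i < n) \sum_k (s ^+ 2 * (2 * nsq (z i k))))).
      apply: ler_sum => i _; apply: ler_sum => k _.
      rewrite !vscaleE !nsqZr voneE -mulrDr ler_wpM2l ?sqr_ge0//.
      by have := ha (z i k); lra.
    under eq_bigr do rewrite -2!mulr_sumr.
    rewrite -2!mulr_sumr; have := zB n; have : 0 <= s ^+ 2 := sqr_ge0 s.
    by nra.
  rewrite s2 mulrAC ler_pdivrMr; last by lra.
  by rewrite ler_wpM2l; lra.
exists ((2 * B + 1) / d); first by rewrite divr_ge0//; lra.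
move=> c a; rewrite le_eqVlt => /orP[/eqP<-|c0] ha.
  have -> : a = 0; last by rewrite rt0 mulr0.
  apply: vop_ext => v; apply: nsq_eq0; apply/eqP.
  by rewrite eq_le nsq_ge0 andbT (le_trans (ha v))// expr0n mul0r.
have := bnd1 (rc c^-1 *: a); rewrite rtZ => h.
rewrite mulrAC ler_pdivlMr// mulrC -ler_pdivrMr// mulrAC -mulrA.
apply: h => v; have := oboundZ c^-1 ha v.
by rewrite -exprMn mulVf ?gt_eqF// expr1n.
Qed.

End TraceNormal.

(** * Resolvents and truncation *)

Lemma expr_small (R : realType) (t e : R) : 0 <= t -> t < 1 -> 0 < e ->
  exists N, forall n, (N <= n)%N -> t ^+ n <= e.
Proof.
move=> t0 t1 e0; have := @cvg_expr R t; rewrite ger0_norm// => /(_ t1).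
move=> /cvgrPdist_le/(_ e e0)[N _ hN]; exists N => n /hN /=.
by rewrite sub0r normrN ger0_norm// exprn_ge0.
Qed.

Lemma harmonic_small (R : realType) (e : R) : 0 < e ->
  exists N, forall k, (N <= k)%N -> k.+1%:R^-1 <= e.
Proof.
move=> e0; exists (Num.bound e^-1) => k Nk; rewrite invf_ple ?posrE//.
have ei : 0 <= e^-1 by rewrite invr_ge0 ltW.
by rewrite (le_trans (ltW (archi_boundP ei)))// ler_nat leqW.
Qed.

Section Resolvent.
Variables (R : realType) (H : hilbertType R) (P : tracial_vNa H).
Local Notation C := (Cplx R).
Local Notation vop := (vop P).
Implicit Types a b f h x : vop.

Lemma oboundX c a n : 0 <= c -> obound c a -> obound (c ^+ n) (a ^+ n).
Proof.
move=> c0 ha; elim: n => [|n IH]; first exact: obound1.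
by rewrite !exprS; apply: oboundM.
Qed.

(* A square root of c - a^* a is avoided by the log-convexity in k of
   |(a^* a)^k b|_2^2, which grows at most like c^(2k) by [rt_bounded]. *)
Lemma q_mull c a b : 0 <= c -> obound c a -> q (a * b) <= c * q b.
Proof.
move=> c0 ha; have ha' := obound_star c0 ha.
have [c00|cn0] := eqVneq c 0.
  have -> : a = 0; last by rewrite mul0r q0 mulr_ge0// q_ge0.
  apply: vop_ext => v; apply: nsq_eq0; apply/eqP.
  by rewrite eq_le nsq_ge0 andbT (le_trans (ha v))// c00 mul0r.
have cp : 0 < c by rewrite lt_def cn0.
set S := star a * a.
have Ss : star S = S by rewrite starM starK.
have hS : obound (c * c) S by apply: oboundM.
have [be be0 hb] := obound_ex b.
have [L L0 hL] := rt_bounded P.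
have cc0 : 0 <= c * c by rewrite mulr_ge0.
have Sb n : obound ((c * c) ^+ n * be) (S ^+ n * b).
  by apply: oboundM => //; [exact: exprn_ge0|exact: oboundX].
have starX n : star (S ^+ n) = S ^+ n.
  by elim: n => [|n IH]; [exact: star1|rewrite [in LHS]exprS starM IH Ss -exprSr].
have starXb m n : star (S ^+ m * b) * (S ^+ n * b) = star b * (S ^+ (m + n) * b).
  by rewrite starM starX -mulrA (mulrA (S ^+ m)) -exprD.
pose N n := q (S ^+ n * b).
have N1 : N 1%N <= c * c * N 0%N.
  apply: (@power_growth R N (L * be)) => // [k|k s s0|k].
  - exact: q_ge0.
  (* As S is self-adjoint, <S^(k+2) b, S^k b> = |S^(k+1) b|_2^2, so log-convexity is the positivity
     of this square. *)
  - have := q_ge0 (S ^+ k.+2 * b - rc s *: (S ^+ k * b)).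
    rewrite qB qZr -scalerAr rtZ.
    have -> : rt (star (S ^+ k.+2 * b) * (S ^+ k * b)) = N k.+1.
      by rewrite /N /q !starXb addSnnS.
    by rewrite -/(N _) -/(N _); lra.
  - rewrite /N /q; have h : obound (((c * c) ^+ k * be) ^+ 2)
        (star (S ^+ k * b) * (S ^+ k * b)).
      have p0 : 0 <= (c * c) ^+ k * be by rewrite mulr_ge0 ?exprn_ge0// ltW.
      by rewrite expr2; apply: oboundM => //; apply: obound_star.
    rewrite (le_trans (hL _ _ _ h)) ?mulr_ge0 ?exprn_ge0// ?(ltW be0)//.
    by rewrite [leRHS]mulrAC mulrA.
(* Since <b, S b> = |a b|_2^2, this reads 2 c |a b|_2^2 <= c^2 |b|_2^2 + |S b|_2^2, and the last
   term is at most c^2 |b|_2^2 by [N1]. *)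
have := rt_amgm (rc c *: b) (S * b).
rewrite qZr starZ conj_rc -scalerAl rtZ.
rewrite /N expr1 expr0 mul1r in N1.
have -> : rt (star b * (S * b)) = q (a * b) by rewrite /q starM !mulrA.
by move=> h; rewrite -(ler_pM2l cp); nra.
Qed.

Lemma q_mulr c a b : 0 <= c -> obound c a -> q (b * a) <= c * q b.
Proof.
by move=> c0 ha; rewrite -q_star starM -(q_star b) q_mull//; apply: obound_star.
Qed.

Definition one_add_sq a : vop := 1 + star a * a.

Lemma one_add_sq_rdot a v : rdot (one_add_sq a v) v = nsq v + nsq (a v).
Proof. by rewrite vaddE rdotDl voneE vmulE rdot_star starK. Qed.

Lemma one_add_sq_expand a v : nsq v <= nsq (one_add_sq a v).
Proof.
rewrite /one_add_sq vaddE voneE nsqD vmulE rdot_starr starK -/(nsq _).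
have := nsq_ge0 (a v); have := nsq_ge0 (star a (a v)); lra.
Qed.

(** Bounds the squared norm of [geo_op c a]: for 0 <= a^* a <= c, the spectrum of (c - a^* a) / (1 +
    c) lies in [0, c / (1 + c)]. *)
Definition geo_ratio (c : R) : R := (c / (1 + c)) ^+ 2.

Lemma geo_ratio_ge0 c : 0 <= geo_ratio c. Proof. exact: sqr_ge0. Qed.
Lemma geo_ratio_lt1 c : 0 <= c -> geo_ratio c < 1.
Proof.
move=> c0; rewrite /geo_ratio -[ltRHS](expr1n _ 2) ltr_pXn2r ?nnegrE//.
  by rewrite ltr_pdivrMr; lra.
by rewrite divr_ge0//; lra.
Qed.

(** Chosen so that 1 + a^* a = (1 + c) (1 - [geo_op c a]): subtracting from c makes the geometric
    series converge however large a is. *)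
Definition geo_op (c : R) a : vop := rc (1 + c)^-1 *: (rc c *: 1 - star a * a).

Lemma geo_op_obound c a : 0 <= c -> obound c a -> obound (geo_ratio c) (geo_op c a).
Proof.
move=> c0 ha v; rewrite vscaleE nsqZr vsubE vscaleE voneE vmulE.
rewrite nsqB nsqZr rdotZl rdot_starr starK -/(nsq _).
(* |a^* a v|^2 <= c |a v|^2 is absorbed by the cross term - 2 c |a v|^2. *)
have := obound_star c0 ha (a v); have := ha v.
have := nsq_ge0 (a v) => p0 p1 p2.
have -> : geo_ratio c * nsq v = (1 + c)^-1 ^+ 2 * (c ^+ 2 * nsq v).
  by rewrite /geo_ratio exprMn; ring.
rewrite ler_wpM2l ?sqr_ge0//; have := mulr_ge0 c0 p0; lra.
Qed.

(* Partial sums of (1 + h)^-1 = (1 + c)^-1 sum_n ((c - h) / (1 + c))^n, h = a^* a. *)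
Fixpoint neumann (c : R) a n : vop :=
  if n is n'.+1 then rc (1 + c)^-1 *: 1 + geo_op c a * neumann c a n' else 0.

Lemma neumannP c a n : 0 <= c -> one_add_sq a * neumann c a n = 1 - geo_op c a ^+ n.
Proof.
move=> c0; have c1 : 1 + c != 0 by rewrite gt_eqF//; lra.
have comm : one_add_sq a * geo_op c a = geo_op c a * one_add_sq a.
  rewrite /one_add_sq /geo_op -scalerAl -scalerAr; congr (_ *: _).
  rewrite [LHS]mulrDl [RHS]mulrDr mul1r mulr1; congr (_ + _).
  by rewrite mulrBr mulrBl -scalerAl -scalerAr mul1r mulr1.
elim: n => [|n IH]; first by rewrite mulr0 expr0 subrr.
rewrite /= mulrDr mulrA comm -mulrA IH mulrBr mulr1 -exprS.
rewrite addrA; congr (_ - _).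
rewrite -scalerAr mulr1 /geo_op -scalerDr /one_add_sq.
rewrite (addrC (rc c *: 1)) addrA addrK.
by rewrite -[X in _ *: (X + _)]scale1r -scalerDl scalerA -rc1 -rcD -rcM mulVf// scale1r.
Qed.

(** 1 + a^* a is expanding and sends the n-th Neumann sum at v to v - [geo_op]^n v, so these sums
    are Cauchy. The inverse is built pointwise, and lies in the algebra because it commutes with the
    commutant. *)
Lemma resolvent_ex a : exists S : vop, one_add_sq a * S = 1 /\ S * one_add_sq a = 1.
Proof.
have [c /ltW c0 ha] := obound_ex a.
have r0 := geo_ratio_ge0 c; have r1 := geo_ratio_lt1 c0.
have gX n v : nsq ((geo_op c a ^+ n) v) <= geo_ratio c ^+ n * nsq v.
  by apply: oboundX => //; apply: geo_op_obound.
have small (e : R) v : 0 < e -> exists N, forall n, (N <= n)%N ->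
    nsq ((geo_op c a ^+ n) v) <= e.
  move=> e0; have p0 : 0 < e / (nsq v + 1).
    by rewrite divr_gt0// ltr_wpDl// nsq_ge0.
  have [N hN] := expr_small r0 r1 p0; exists N => n /hN h.
  have v0 := nsq_ge0 v; rewrite (le_trans (gX _ _))//.
  rewrite (le_trans (ler_wpM2r v0 h))// mulrAC ler_pdivrMr//; last by lra.
  by rewrite ler_wpM2l; lra.
have inv v : exists u, one_add_sq a u = v.
  have [|u hu] := @nsq_complete _ _ (fun n => neumann c a n v).
    move=> e e0; have [N hN] := small (e / 4) v (divr_gt0 e0 (ltr0Sn _ 3)).
    exists N => m n Nm Nn; rewrite (le_trans (one_add_sq_expand a _))// vopB -!vmulE.
    rewrite !neumannP// !vsubE opprB addrC addrA subrK (le_trans (nsqBle _ _))//.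
    by have := hN m Nm; have := hN n Nn; lra.
  exists u; apply/eqP; rewrite -subr_eq0; apply/eqP; apply: nsq_eq0; apply/eqP.
  rewrite eq_le nsq_ge0 andbT; apply/ler_addgt0Pr => e e0; rewrite add0r.
  have [d d0 hd] := obound_ex (one_add_sq a).
  have [N hN] := small (e / 4) v (divr_gt0 e0 (ltr0Sn _ 3)).
  have [N' hN'] := hu (e / 4 / d) (divr_gt0 (divr_gt0 e0 (ltr0Sn _ 3)) d0).
  have := hN' (maxn N N') (leq_maxr _ _); have := hN (maxn N N') (leq_maxl _ _).
  set n := maxn N N' => h h'.
  have -> : one_add_sq a u - v = - (one_add_sq a (neumann c a n v - u) + (geo_op c a ^+ n) v).
    by rewrite vopB -vmulE neumannP// vsubE voneE [_ - _ + _ in RHS]addrAC subrK opprB.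
  rewrite nsqN (le_trans (nsqDle _ _))//.
  have := hd (neumann c a n v - u).
  have : d * nsq (neumann c a n v - u) <= e / 4.
    by rewrite mulrC -ler_pdivlMr.
  by lra.
have inj u v : one_add_sq a u = one_add_sq a v -> u = v.
  move=> e; apply/eqP; rewrite -subr_eq0; apply/eqP; apply: nsq_eq0; apply/eqP.
  by rewrite eq_le nsq_ge0 andbT (le_trans (one_add_sq_expand a _))// vopB e subrr nsq0.
have [S hS] := choice inv.
have Sb : bounded_operators S.
  apply: (@bounded_operators_nsq _ _ _ 1) => [d u v|v].
    by apply: inj; rewrite vopD vopZ !hS.
  by rewrite mul1r -{2}(hS v) one_add_sq_expand.
have MS : vna P S.
  rewrite -(vNa_bicommutant (vnaP P)); split=> // g [_ hg].
  apply/funext => v; apply: inj; rewrite -[(S \o g) v]/(S (g v)) -[(g \o S) v]/(g (S v)) hS.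
  have e : g (one_add_sq a (S v)) = one_add_sq a (g (S v)) :=
    congr1 (@^~ (S v)) (hg _ (vfunP (one_add_sq a))).
  by rewrite -e hS.
exists (Vop MS); split; apply: vop_ext => v; first exact: hS.
by apply: inj; rewrite vmulE voneE; exact: hS.
Qed.

Definition resol a : vop := projT1 (cid (resolvent_ex a)).
Lemma one_add_sq_resol a : one_add_sq a * resol a = 1.
Proof. by rewrite /resol; case: cid => S []. Qed.
Lemma resol_one_add_sq a : resol a * one_add_sq a = 1.
Proof. by rewrite /resol; case: cid => S []. Qed.
Lemma one_add_sq_resolE a v : one_add_sq a (resol a v) = v.
Proof. by rewrite -vmulE one_add_sq_resol. Qed.

Lemma resol_obound a : obound 1 (resol a).
Proof. by move=> v; rewrite mul1r -{2}(one_add_sq_resolE a v) one_add_sq_expand. Qed.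

Lemma resol_neumann c a n : 0 <= c -> obound c a ->
  obound (geo_ratio c ^+ n) (resol a - neumann c a n).
Proof.
move=> c0 ha v; rewrite (le_trans (one_add_sq_expand a _))// -vmulE mulrBr one_add_sq_resol.
rewrite neumannP// opprB addrC subrK.
by apply: oboundX (geo_op_obound c0 ha) v; exact: geo_ratio_ge0.
Qed.

Definition vtrunc a : vop := a * resol a.

(** For w = [resol a] v, one has |w|^2 + |a w|^2 = <v, w> <= (|v|^2 + |w|^2) / 2. The same identity,
    with star a u in place of v, yields [trunc_star_obound]. *)
Lemma trunc_obound a : obound 1 (vtrunc a).
Proof.
move=> v; rewrite mul1r vmulE; have := one_add_sq_rdot a (resol a v).
rewrite one_add_sq_resolE; have := rdot_amgm v (resol a v).
have := resol_obound a v; rewrite mul1r; have := nsq_ge0 (resol a v); lra.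
Qed.

Lemma trunc_star_obound a : obound 1 (vtrunc a * star a).
Proof.
move=> u; rewrite mul1r !vmulE; have := one_add_sq_rdot a (resol a (star a u)).
rewrite one_add_sq_resolE -rdot_starr; set w := a _.
have := rdot_amgm u w; have := nsq_ge0 (resol a (star a u)); lra.
Qed.

(** Since a - [vtrunc a] = a a^* [vtrunc a], and the last factor is a contraction, the cost of
    truncating is the fourth moment of a. *)
Lemma sub_trunc_q a : q (a - vtrunc a) <= q (a * star a).
Proof.
have -> : a - vtrunc a = a * star a * vtrunc a.
  rewrite /vtrunc -{1}[a]mulr1 -(one_add_sq_resol a) mulrA -mulrBl.
  by rewrite /one_add_sq mulrDr mulr1 addrAC subrr add0r !mulrA.
by rewrite -[leRHS]mul1r q_mulr//; apply: trunc_obound.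
Qed.

(** The left side is a sum of three terms, each containing x or y between contractions, whence the
    constant 3. Two elements a and h are allowed: a = h gives commutators, f = 1 gives continuity of
    [vtrunc] in the 2-norm. *)
Lemma trunc_comm_q a f h :
  q (vtrunc a * f - f * vtrunc h) <=
    3 * (2 * q (a * f - f * h) + q (star a * f - f * star h)).
Proof.
set x := a * f - f * h; set y := star a * f - f * star h.
have E : vtrunc a * f - f * vtrunc h =
    x * resol h - vtrunc a * star a * x * resol h - vtrunc a * y * vtrunc h.
  have e1 : resol a * f - f * resol h =
      - (resol a * (star a * x + y * h) * resol h).
    have -> : star a * x + y * h = one_add_sq a * f - f * one_add_sq h.
      rewrite /one_add_sq [(1 + _) * f]mulrDl [f * (1 + _)]mulrDr mul1r mulr1 opprD.
      by rewrite addrACA subrr add0r /x /y mulrBr mulrBl !mulrA addrA subrK.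
    rewrite mulrBr mulrBl (mulrA _ (one_add_sq a)) resol_one_add_sq mul1r (mulrA _ f).
    by rewrite -[X in - (_ - X)]mulrA one_add_sq_resol mulr1 opprB.
  have -> : vtrunc a * f - f * vtrunc h =
      x * resol h + a * (resol a * f - f * resol h).
    by rewrite /vtrunc /x mulrBl mulrBr !mulrA [RHS]addrC addrA subrK.
  rewrite e1 mulrN -addrA -opprD; congr (_ - _).
  by rewrite /vtrunc mulrDr mulrDl mulrDr !mulrA.
rewrite E.
have q1 : q (x * resol h) <= q x.
  by rewrite -[leRHS]mul1r q_mulr//; apply: resol_obound.
have q2 : q (vtrunc a * star a * x * resol h) <= q x.
  rewrite -mulrA (le_trans _ q1)// -[leRHS]mul1r q_mull//.
  exact: trunc_star_obound.
have q3 : q (vtrunc a * y * vtrunc h) <= q y.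
  apply: (@le_trans _ _ (q (vtrunc a * y))).
    by rewrite -[leRHS]mul1r q_mulr//; apply: trunc_obound.
  by rewrite -[leRHS]mul1r q_mull//; apply: trunc_obound.
move: (x * resol h) (vtrunc a * star a * _ * _) (vtrunc a * y * _) q1 q2 q3 => u v w.
(* |u - v - w|^2 <= 3 (|u|^2 + |v|^2 + |w|^2): the difference of the two sides is the sum of these
   three squares. *)
have := q_ge0 (u + v); have := q_ge0 (u + w); have := q_ge0 (v - w).
rewrite !qB !qD starB mulrBl rtB; lra.
Qed.

End Resolvent.

(** * Density in the bicommutant for the 2-norm *)

Section Ell2.
Variables (R : realType) (H : hilbertType R) (F : finType).
Local Notation ell := (nat -> F -> H).
Implicit Types (z w p : ell) (c : Cplx R).

Definition dots z w n : R := \sum_(0 <= i < n) \sum_k rdot (z i k) (w i k).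

Definition ell2 z := exists B, forall n, dots z z n <= B.

(** The real inner product of l2 with values in H^F. It is meaningful on [ell2], where polarization
    makes the partial sums converge. *)
Definition rip z w : R := limn (dots z w).

Lemma dots_nd z : {homo dots z z : n m / (n <= m)%N >-> n <= m}.
Proof.
move=> n m nm; rewrite {2}/dots (big_cat_nat (leq0n n) nm) /= lerDl.
by rewrite sumr_ge0// => i _; rewrite sumr_ge0// => k _; exact: nsq_ge0.
Qed.

Lemma dotsDl z z' w n : dots (z + z') w n = dots z w n + dots z' w n.
Proof.
rewrite /dots -big_split; apply: eq_bigr => i _; rewrite -big_split.
by apply: eq_bigr => k _; exact: rdotDl.
Qed.
Lemma dotsC z w n : dots z w n = dots w z n.
Proof. by apply: eq_bigr => i _; apply: eq_bigr => k _; rewrite rdotC. Qed.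
Lemma dotsNl z w n : dots (- z) w n = - dots z w n.
Proof.
rewrite /dots -sumrN; apply: eq_bigr => i _; rewrite -sumrN.
by apply: eq_bigr => k _; exact: rdotNl.
Qed.
Lemma dots_sq_ge0 z n : 0 <= dots z z n.
Proof. by rewrite (le_trans _ (dots_nd z (leq0n n)))// /dots big_geq. Qed.
Lemma dotsZZ c z n : dots (c *: z) (c *: z) n = (cre c ^+ 2 + cim c ^+ 2) * dots z z n.
Proof.
rewrite /dots mulr_sumr; apply: eq_bigr => i _; rewrite mulr_sumr.
by apply: eq_bigr => k _; rewrite -/(nsq _) -/(nsq (z i k)) -nsqZ.
Qed.

Lemma dots_sqD z w n : dots (z + w) (z + w) n =
  dots z z n + 2 * dots z w n + dots w w n.
Proof.
by rewrite dotsDl ![dots _ (z + w) n]dotsC !dotsDl (dotsC w z); ring.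
Qed.
Lemma dots_sqDle z w n : dots (z + w) (z + w) n <= 2 * dots z z n + 2 * dots w w n.
Proof.
have := dots_sq_ge0 (z + - w) n; rewrite !dots_sqD !(dotsC _ (- w)) !dotsNl.
by rewrite (dotsC w (- w)) dotsNl (dotsC w z); lra.
Qed.

Lemma ell2D z w : ell2 z -> ell2 w -> ell2 (z + w).
Proof.
move=> [B hB] [D hD]; exists (2 * B + 2 * D) => n.
by have := dots_sqDle z w n; have := hB n; have := hD n; lra.
Qed.
Lemma ell2Z c z : ell2 z -> ell2 (c *: z).
Proof.
move=> [B hB]; exists ((cre c ^+ 2 + cim c ^+ 2) * B) => n.
by rewrite dotsZZ ler_wpM2l// addr_ge0// sqr_ge0.
Qed.
Lemma ell2N z : ell2 z -> ell2 (- z).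
Proof. by rewrite -scaleN1r; apply: ell2Z. Qed.
Lemma ell2B z w : ell2 z -> ell2 w -> ell2 (z - w).
Proof. by move=> hz hw; apply: ell2D => //; apply: ell2N. Qed.

Lemma cvg_dots z w : ell2 z -> ell2 w -> dots z w n @[n --> \oo] --> rip z w.
Proof.
move=> hz hw.
have c1 z' : ell2 z' -> cvgn (dots z' z').
  move=> [B hB]; apply: nondecreasing_is_cvgn; first exact: dots_nd.
  by exists B => _ [n _ <-].
suff : cvgn (dots z w) by [].
have -> : dots z w = (fun n => 2^-1 *
    (dots (z + w) (z + w) n - dots z z n - dots w w n)).
  by apply/funext => n; rewrite dots_sqD; field.
apply: (@is_cvgMl_tmp _ _ _ _ _ 2^-1); apply: is_cvgB; last exact: c1.
by apply: is_cvgB; apply: c1 => //; apply: ell2D.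
Qed.

Lemma rip_uniq z w l : dots z w n @[n --> \oo] --> l -> rip z w = l.
Proof. exact: cvg_lim. Qed.

Lemma ripDl z z' w : ell2 z -> ell2 z' -> ell2 w ->
  rip (z + z') w = rip z w + rip z' w.
Proof.
move=> hz hz' hw; apply: rip_uniq; under eq_cvg do rewrite dotsDl.
by apply: cvgD; apply: cvg_dots.
Qed.
Lemma ripC z w : rip z w = rip w z.
Proof. by rewrite /rip; congr (lim (_ @ \oo)); apply/funext => n; rewrite dotsC. Qed.
Lemma ripNl z w : ell2 z -> ell2 w -> rip (- z) w = - rip z w.
Proof.
move=> hz hw; apply: rip_uniq; under eq_cvg do rewrite dotsNl.
by apply: cvgN; apply: cvg_dots.
Qed.

Definition n2 z := rip z z.

Lemma dots_n2 z n : ell2 z -> dots z z n <= n2 z.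
Proof.
move=> hz; apply: nondecreasing_cvgn_le; first exact: dots_nd.
by apply: cvgP; apply: cvg_dots.
Qed.
Lemma n2_le z B : (forall n, dots z z n <= B) -> ell2 z /\ n2 z <= B.
Proof.
move=> h; have hz : ell2 z by exists B.
split=> //; apply: limr_le; first by apply: cvgP; apply: cvg_dots.
by apply: nearW.
Qed.
Lemma n2_ge0 z : ell2 z -> 0 <= n2 z.
Proof. by move=> hz; rewrite (le_trans (dots_sq_ge0 z 0%N))// dots_n2. Qed.
Lemma n2D z w : ell2 z -> ell2 w -> n2 (z + w) = n2 z + 2 * rip z w + n2 w.
Proof.
move=> hz hw; have hzw := ell2D hz hw.
rewrite /n2 ripDl// ![rip _ (z + w)]ripC !ripDl// (ripC w z); ring.
Qed.
Lemma n2N z : n2 (- z) = n2 z.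
Proof.
rewrite /n2 /rip; congr (lim (_ @ \oo)); apply/funext => n.
by rewrite dotsNl dotsC dotsNl opprK.
Qed.
Lemma ripNr z w : ell2 z -> ell2 w -> rip z (- w) = - rip z w.
Proof. by move=> hz hw; rewrite ripC ripNl// ripC. Qed.
Lemma n2B z w : ell2 z -> ell2 w -> n2 (z - w) = n2 z - 2 * rip z w + n2 w.
Proof. by move=> hz hw; rewrite n2D ?n2N ?ripNr//; [ring|apply: ell2N]. Qed.
Lemma n2Dle z w : ell2 z -> ell2 w -> n2 (z + w) <= 2 * n2 z + 2 * n2 w.
Proof.
by move=> hz hw; have := n2_ge0 (ell2B hz hw); rewrite n2B// n2D//; lra.
Qed.
Lemma nsq_n2 z i k : ell2 z -> nsq (z i k) <= n2 z.
Proof.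
move=> hz; rewrite (le_trans _ (dots_n2 i.+1 hz))// /dots.
rewrite big_nat_recr//= (bigD1 k)//= -/(nsq (z i k)).
rewrite addrC -addrA lerDl addr_ge0 ?dots_sq_ge0//.
by rewrite sumr_ge0// => j _; exact: nsq_ge0.
Qed.
Lemma n2_eq0 z : ell2 z -> n2 z = 0 -> z = 0.
Proof.
move=> hz h; apply/funext => i; apply/funext => k; apply: nsq_eq0; apply/eqP.
by rewrite eq_le nsq_ge0 andbT -h nsq_n2.
Qed.

(** Fatou's lemma for entrywise limits. On the first n entries p is close to some z N, with N
    depending on n; the factor 2 comes from splitting w - p at z N. *)
Lemma ell2_lim (z : nat -> ell) (p : ell) (B : R) :
  (forall l, ell2 (z l)) ->
  (forall i k (e : R), 0 < e -> exists N, forall l, (N <= l)%N ->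
     nsq (z l i k - p i k) <= e) ->
  forall w, ell2 w -> (forall l, n2 (w - z l) <= B) ->
  ell2 (w - p) /\ n2 (w - p) <= 2 * B.
Proof.
move=> hz cz w hw hB; apply: n2_le => n.
apply/ler_addgt0Pr => e e0.
have [N hN] : exists N, dots (z N - p) (z N - p) n <= e / 2.
  suff [N hN] : exists N, forall l, (N <= l)%N -> dots (z l - p) (z l - p) n <= e / 2.
    by exists N; apply: hN.
  have e2 : 0 < e / 2 by rewrite divr_gt0.
  rewrite /dots; elim: n (e / 2) e2 => [|n IH] d d0.
    by exists 0%N => l _; rewrite big_geq// ltW.
  have [N hN] := IH (d / 2) (divr_gt0 d0 (ltr0Sn _ 1)).
  have c0 : 0 < d / 2 / (#|F|%:R + 1) by rewrite !divr_gt0// ltr_wpDl.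
  have /choice[M hM] := fun k => cz n k _ c0.
  exists (maxn N (\max_k M k)) => l; rewrite geq_max => /andP[/hN h1 h2].
  rewrite big_nat_recr//= [leRHS](_ : d = d / 2 + d / 2); last by field.
  rewrite lerD//; apply: (@le_trans _ _ (\sum_(k : F) (d / 2 / (#|F|%:R + 1)))).
    apply: ler_sum => k _; apply: hM; apply: leq_trans h2.
    exact: (leq_bigmax k).
  rewrite sumr_const -[_ *+ #|_|]mulr_natr.
  have key (x y : R) : 0 <= x -> 0 <= y -> x / (y + 1) * y <= x.
    move=> x0 y0; rewrite mulrAC ler_pdivrMr ?ltr_wpDl//.
    by rewrite ler_wpM2l// lerDl.
  by apply: key => //; rewrite ltW// divr_gt0.
have -> : w - p = (w - z N) + (z N - p) by rewrite addrA subrK.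
have := dots_sqDle (w - z N) (z N - p) n.
have := dots_n2 n (ell2B hw (hz N)); have := hB N; lra.
Qed.

End Ell2.

Record star_subalgebra (R : realType) (H : hilbertType R) (P : tracial_vNa H)
    (A : set (vop P)) : Prop := StarSubalgebra {
  ssa1 : A 1;
  ssa_lin : forall c a b, A a -> A b -> A (c *: a + b);
  ssaM : forall a b, A a -> A b -> A (a * b);
  ssa_star : forall a, A a -> A (star a) }.

(** * The projection onto the closure of A xi *)

Section Bicommutant.
Variables (R : realType) (H : hilbertType R) (P : tracial_vNa H).
Variables (F : finType) (A : set (vop P)).
Hypothesis algA : star_subalgebra A.
Local Notation C := (Cplx R).
Local Notation vop := (vop P).
Local Notation ell := (nat -> F -> H).

Lemma ssaD a b : A a -> A b -> A (a + b).
Proof. by move=> ha hb; rewrite -[a]scale1r; apply: ssa_lin algA _ _ _ ha hb. Qed.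
Lemma ssa0 : A 0.
Proof. by rewrite -(addNr 1) -scaleN1r; apply: (ssa_lin algA); apply: ssa1 algA. Qed.
Lemma ssaZ c a : A a -> A (c *: a).
Proof. by move=> ha; rewrite -[_ *: _]addr0; apply: (ssa_lin algA) => //; exact: ssa0. Qed.
Lemma ssaB a b : A a -> A b -> A (a - b).
Proof. by move=> ha hb; apply: ssaD => //; rewrite -scaleN1r; apply: ssaZ. Qed.

Definition act (a : vop) (z : ell) : ell := fun i k => a (z i k).

Lemma dots_act a z w n : dots (act a z) w n = dots z (act (star a) w) n.
Proof. by apply: eq_bigr => i _; apply: eq_bigr => k _; exact: rdot_star. Qed.
Lemma act_bound c a z : 0 <= c -> obound c a -> ell2 z ->
  ell2 (act a z) /\ n2 (act a z) <= c * n2 z.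
Proof.
move=> c0 ha hz; apply: n2_le => n.
rewrite (le_trans _ (ler_wpM2l c0 (dots_n2 n hz)))// /dots mulr_sumr.
by apply: ler_sum => i _; rewrite mulr_sumr; apply: ler_sum => k _; exact: ha.
Qed.
Lemma ell2_act a z : ell2 z -> ell2 (act a z).
Proof. by have [c /ltW c0 ha] := obound_ex a => /(act_bound c0 ha)[]. Qed.
Lemma actB a z w : act a (z - w) = act a z - act a w.
Proof. by apply/funext => i; apply/funext => k; rewrite /act vopB. Qed.
Lemma actD a z w : act a (z + w) = act a z + act a w.
Proof. by apply/funext => i; apply/funext => k; rewrite /act vopD. Qed.
Lemma actBl a b z : act (a - b) z = act a z - act b z.
Proof. by apply/funext => i; apply/funext => k; rewrite /act vsubE. Qed.
Lemma rip_act a z w : ell2 z -> ell2 w -> rip (act a z) w = rip z (act (star a) w).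
Proof.
move=> hz hw; apply: rip_uniq; under eq_cvg do rewrite dots_act.
by apply: cvg_dots => //; apply: ell2_act.
Qed.

Variable xi : ell.
Hypothesis hxi : ell2 xi.

(** p is the projection of z onto the closure of A xi. Real orthogonality suffices, as A is stable
    under complex scalars. *)
Record is_proj (z p : ell) : Prop := IsProj {
  proj_ell2 : ell2 p;
  proj_approx : forall e : R, 0 < e -> exists2 a, A a & n2 (p - act a xi) <= e;
  proj_orth : forall a, A a -> rip (z - p) (act a xi) = 0 }.

(** A minimizing sequence in A xi is Cauchy by the parallelogram law. Its limit is taken entry by
    entry, and [ell2_lim] turns this into convergence in l2. *)
Lemma proj_ex z : ell2 z -> exists p, is_proj z p.
Proof.
move=> hz.
have [dl [dl0 [dl_nd inv_small]]] : exists dl : nat -> R, (forall k, 0 < dl k) /\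
    (forall k l, (k <= l)%N -> dl l <= dl k) /\
    forall e : R, 0 < e -> exists N, forall k, (N <= k)%N -> dl k <= e.
  exists (fun k => k.+1%:R^-1); split=> [k|]; first by rewrite invr_gt0.
  split=> [k l kl|e]; first by rewrite lef_pV2 ?posrE// ler_nat.
  exact: harmonic_small.
pose E := [set x | exists2 a, A a & x = n2 (z - act a xi)].
have hza a : ell2 (z - act a xi) by apply: ell2B => //; apply: ell2_act.
have hE : has_inf E.
  split; first by exists (n2 (z - act 0 xi)); exists 0 => //; exact: ssa0.
  by exists 0 => _ [a _ ->]; apply: n2_ge0.
set d := inf E.
have d_le a : A a -> d <= n2 (z - act a xi).
  by move=> ha; apply: ge_inf; [case: hE|exists a].
have /choice[a_ ha_] k : exists a, A a /\ n2 (z - act a xi) <= d + dl k.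
  have [_ [a ha ->] /ltW h] := inf_adherent (dl0 k) hE.
  by exists a.
have Aa k : A (a_ k) by case: (ha_ k).
have close k l : n2 (act (a_ k) xi - act (a_ l) xi) <=
    2 * dl k + 2 * dl l.
  (* The midpoint is again in A xi, hence at squared distance at least d from z. *)
  have half : A (rc 2^-1 *: (a_ k + a_ l)) by apply: ssaZ; apply: ssaD.
  have := d_le _ half; have [_ h1] := ha_ k; have [_ h2] := ha_ l.
  have -> : z - act (rc 2^-1 *: (a_ k + a_ l)) xi =
    rc 2^-1 *: ((z - act (a_ k) xi) + (z - act (a_ l) xi)).
    apply/funext => i; apply/funext => j.
    rewrite !fctE /act vscaleE vaddE addrACA -opprD scalerBr; congr (_ - _).
    rewrite -[X in X + X]scale1r -scalerDl scalerA -rc1 -rcD -rcM.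
    by rewrite (_ : 2^-1 * (1 + 1) = 1) ?rc1 ?scale1r//; field.
  have n2half (w : ell) : ell2 w -> n2 (rc 2^-1 *: w) = 4^-1 * n2 w.
    move=> hw; apply: rip_uniq; under eq_cvg do rewrite dotsZZ.
    rewrite cre_rc cim_rc expr0n addr0 (_ : 2^-1 ^+ 2 = 4^-1); last by field.
    by apply: cvgMr; apply: cvg_dots.
  rewrite n2half; last exact: ell2D.
  have -> : act (a_ k) xi - act (a_ l) xi = (z - act (a_ l) xi) - (z - act (a_ k) xi).
    by rewrite opprB [RHS]addrC addrA subrK.
  rewrite (n2D (hza _) (hza _)) (n2B (hza _) (hza _)).
  rewrite (ripC (z - act (a_ l) xi)); lra.
have hcl k l : ell2 (act (a_ k) xi - act (a_ l) xi).
  by apply: ell2B; apply: ell2_act.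
have /choice[p1 hp1] i : exists p : F -> H, forall k (e : R), 0 < e -> exists N,
    forall n, (N <= n)%N -> nsq (act (a_ n) xi i k - p k) <= e.
  suff /choice[p hp] k : exists p : H, forall e : R, 0 < e -> exists N,
    forall n, (N <= n)%N -> nsq (act (a_ n) xi i k - p) <= e by exists p.
  apply: nsq_complete => e e0.
  have [N hN] := inv_small (e / 4) (divr_gt0 e0 (ltr0Sn _ 3)).
  exists N => m n Nm Nn; have := nsq_n2 i k (hcl m n).
  have := close m n; have := hN m Nm; have := hN n Nn.
  rewrite -[(act (a_ m) xi - _) i k]/(act (a_ m) xi i k - act (a_ n) xi i k); lra.
pose p : ell := p1; have hp i := hp1 i.
have [M0 hM0] := inv_small 1 ltr01.
have plim w B : ell2 w ->
    (exists N, forall l, (N <= l)%N -> n2 (w - act (a_ l) xi) <= B) ->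
    ell2 (w - p) /\ n2 (w - p) <= 2 * B.
  move=> hw [N hN]; apply: (@ell2_lim _ _ _ (fun l => act (a_ (N + l)%N) xi)) => //.
  - by move=> l; apply: ell2_act.
  - move=> i k e e0; have [M hM] := hp i k e e0; exists M => l Ml.
    by apply: hM; rewrite (leq_trans Ml)// leq_addl.
  - by move=> l; apply: hN; rewrite leq_addr.
have pk k : ell2 (act (a_ k) xi - p) /\ n2 (act (a_ k) xi - p) <= 8 * dl k.
  have [//||h1 h2] := plim (act (a_ k) xi) (4 * dl k).
  - exact: ell2_act.
  - exists k => l kl; rewrite (le_trans (close k l))//.
    by have := dl_nd _ _ kl; lra.
  - by split=> //; rewrite (le_trans h2)//; lra.
have ep : ell2 p.
  rewrite -[p]opprK -[- p](addrK (act (a_ 0%N) xi)) [- p + _]addrC.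
  by apply/ell2N/ell2B; [case: (pk 0%N)|exact: ell2_act].
have pz : ell2 (z - p) by exact: ell2B.
exists p; split=> //.
- move=> e e0; have [N hN] := inv_small (e / 8) (divr_gt0 e0 (ltr0Sn _ 7)).
  exists (a_ N) => //; rewrite -n2N opprB (le_trans (pk N).2)//.
  by have := hN N (leqnn _); lra.
(* Minimality of a_N up to [dl N], and the squared distance at most 8 [dl N] from a_N xi to p, each
   contribute one t^2 |b xi|^2: hence the factor 2 and e / 9. *)
have half b t : A b -> 0 < t ->
    2 * t * rip (z - p) (act b xi) <= 2 * t ^+ 2 * n2 (act b xi).
  move=> Ab t0; apply/ler_addgt0Pr => e e0.
  have [N hN] := inv_small (e / 9) (divr_gt0 e0 (ltr0Sn _ 8)).
  have := hN N (leqnn N) => hNN.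
  have hb := ell2_act b hxi; have [hk hk2] := pk N.
  have htb : ell2 (rc t *: act b xi) by apply: ell2Z.
  have rt_ w : ell2 w -> rip w (rc t *: act b xi) = t * rip w (act b xi).
    move=> hw; apply: rip_uniq.
    under eq_cvg => n. 
      rewrite (_ : dots _ _ n = t * dots w (act b xi) n); last first.
        rewrite /dots mulr_sumr; apply: eq_bigr => i _; rewrite mulr_sumr.
        by apply: eq_bigr => k _; rewrite -rdotZr.
    over.
    by apply: cvgMr; apply: cvg_dots.
  have n2t : n2 (rc t *: act b xi) = t ^+ 2 * n2 (act b xi).
    by rewrite /n2 rt_// ripC rt_// mulrA expr2.
  have e1 : rip (z - p) (act b xi) = rip (z - act (a_ N) xi) (act b xi) +
      rip (act (a_ N) xi - p) (act b xi).
    by rewrite -ripDl// addrA subrK.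
  have := d_le (a_ N + rc t *: b); rewrite (_ : z - _ =
      (z - act (a_ N) xi) - rc t *: act b xi); last first.
    by apply/funext => i; apply/funext => k; rewrite !fctE /act vaddE vscaleE opprD addrA.
  move=> /(_ (ssaD (Aa N) (ssaZ _ Ab))); rewrite n2B// rt_// n2t => i1.
  have [_ i2] := ha_ N.
  have := n2_ge0 (ell2B hk htb); rewrite n2B// rt_// n2t => i3.
  rewrite e1; nra.
have le0 b : A b -> rip (z - p) (act b xi) <= 0.
  move=> Ab; apply/ler_addgt0Pr => e e0; rewrite add0r.
  have nb := n2_ge0 (ell2_act b hxi).
  have t0 : 0 < e / (n2 (act b xi) + 1) by rewrite divr_gt0// ltr_wpDl.
  have := half b _ Ab t0; set t := e / _ in t0 *.
  have te : t * n2 (act b xi) <= e.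
    have n1 : 0 < n2 (act b xi) + 1 by rewrite ltr_wpDl.
    rewrite /t mulrAC ler_pdivrMr//; have := ltW e0; nra.
  rewrite (_ : 2 * t ^+ 2 * _ = 2 * t * (t * n2 (act b xi))); last by ring.
  have t2 : 0 < 2 * t by lra.
  by rewrite (ler_pM2l t2) => h; apply: le_trans te.
move=> a Aa'; apply/eqP; rewrite eq_le le0//=.
have := le0 (- a); rewrite -sub0r => /(_ (ssaB ssa0 Aa')).
rewrite sub0r (_ : act (- a) xi = - act a xi); last first.
  by apply/funext => i; apply/funext => k; rewrite /act voppE.
by rewrite ripNr// ?oppr_le0//; apply: ell2_act.
Qed.

Lemma n2_0 : n2 (0 : ell) = 0.
Proof.
apply: rip_uniq; under eq_cvg => n.
  rewrite (_ : dots _ _ n = 0); last first.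
    by apply: big1 => i _; apply: big1 => k _; exact: rdot0l.
over.
exact: cvg_cst.
Qed.
Lemma ell2_0 : ell2 (0 : ell).
Proof. by rewrite -(subrr xi); apply: ell2B. Qed.

Lemma ripZl c (z w : ell) : ell2 z -> ell2 w -> rip (c *: z) w = rip z (c^* *: w).
Proof.
move=> hz hw; apply: rip_uniq; under eq_cvg => n.
  rewrite (_ : dots _ _ n = dots z (c^* *: w) n); last first.
    apply: eq_bigr => i _; apply: eq_bigr => k _.
    by rewrite /rdot linearZl_LR linearZr_LR /= conjCK.
over.
by apply: cvg_dots => //; apply: ell2Z.
Qed.

Lemma n2Z c (z : ell) : ell2 z -> n2 (c *: z) = (cre c ^+ 2 + cim c ^+ 2) * n2 z.
Proof.
move=> hz; apply: rip_uniq; under eq_cvg do rewrite dotsZZ.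
by apply: cvgMr; apply: cvg_dots.
Qed.

(** p - p' is orthogonal to A xi and is also a limit of elements of A xi. *)
Lemma proj_uniq z p p' : ell2 z -> is_proj z p -> is_proj z p' -> p = p'.
Proof.
move=> hz [hp ap op] [hp' ap' op'].
have hw : ell2 (p - p') by apply: ell2B.
apply/eqP; rewrite -subr_eq0; apply/eqP; apply: n2_eq0 => //.
apply/eqP; rewrite eq_le n2_ge0// andbT; apply/ler_addgt0Pr => e e0; rewrite add0r.
have [a Aa ha] := ap (e / 4) (divr_gt0 e0 (ltr0Sn _ 3)).
have [a' Aa' ha'] := ap' (e / 4) (divr_gt0 e0 (ltr0Sn _ 3)).
have Ab := ssaB Aa Aa'; set b := a - a' in Ab.
have hb := ell2_act b hxi.
have w0 : rip (p - p') (act b xi) = 0.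
  have -> : p - p' = (z - p') - (z - p) by rewrite opprB [RHS]addrC addrA subrK.
  have h1 := ell2B hz hp; have h2 := ell2B hz hp'.
  by rewrite ripDl// ?ripNl// ?op// ?op'// ?oppr0 ?addr0//; apply: ell2N.
have close : n2 (p - p' - act b xi) <= e.
  have -> : p - p' - act b xi = (p - act a xi) - (p' - act a' xi).
    by rewrite actBl !opprB addrACA [RHS]addrACA [- p' - _]addrC.
  have h1 := ell2B hp (ell2_act a hxi); have h2 := ell2B hp' (ell2_act a' hxi).
  have := n2Dle h1 (ell2N h2); rewrite n2N; lra.
have := n2B hw hb; rewrite w0 => h; have := n2_ge0 hb; lra.
Qed.

Lemma proj_lin c z p z' p' : ell2 z -> ell2 z' -> is_proj z p -> is_proj z' p' ->
  is_proj (c *: z + z') (c *: p + p').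
Proof.
move=> hz hz' [hp ap op] [hp' ap' op'].
have E (w w' v v' : ell) : c *: w + w' - (c *: v + v') = c *: (w - v) + (w' - v').
  by rewrite scalerBr opprD addrACA.
split; first by apply: ell2D => //; apply: ell2Z.
- move=> e e0; set s := cre c ^+ 2 + cim c ^+ 2.
  have s0 : 0 <= s by rewrite addr_ge0// sqr_ge0.
  have p0 : 0 < e / 4 / (s + 1) by rewrite !divr_gt0// ltr_wpDl.
  have [a Aa ha] := ap _ p0.
  have [a' Aa' ha'] := ap' (e / 4) (divr_gt0 e0 (ltr0Sn _ 3)).
  exists (c *: a + a'); first exact: (ssa_lin algA).
  have -> : act (c *: a + a') xi = c *: act a xi + act a' xi.
    by apply/funext => i; apply/funext => k; rewrite /act vaddE vscaleE.
  rewrite E.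
  have h1 := ell2B hp (ell2_act a hxi); have h2 := ell2B hp' (ell2_act a' hxi).
  have := n2Dle (ell2Z c h1) h2; rewrite n2Z// -/s.
  have : s * n2 (p - act a xi) <= e / 4.
    have s1 : 0 < s + 1 by lra.
    rewrite ler_pdivlMr// in ha; have := n2_ge0 h1; lra.
  lra.
- move=> a Aa; rewrite E.
  have h1 := ell2B hz hp; have h2 := ell2B hz' hp'; have h3 := ell2_act a hxi.
  rewrite ripDl//; last exact: ell2Z.
  rewrite op'// addr0 ripZl//.
  have -> : c^* *: act a xi = act (c^* *: a) xi.
    by apply/funext => i; apply/funext => k; rewrite /act vscaleE.
  by apply: op; apply: ssaZ.
Qed.

(** The closure of A xi is invariant under A, and so is its orthogonal complement, because A is
    closed under adjoints. *)
Lemma proj_act b z p : A b -> ell2 z -> is_proj z p -> is_proj (act b z) (act b p).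
Proof.
move=> Ab hz [hp ap op]; split; first exact: ell2_act.
- move=> e e0; have [c c0 hb] := obound_ex b.
  have [a Aa ha] := ap (e / c) (divr_gt0 e0 c0).
  exists (b * a); first exact: (ssaM algA).
  have -> : act b p - act (b * a) xi = act b (p - act a xi) by rewrite actB.
  have h := ell2B hp (ell2_act a hxi).
  have [_] := act_bound (ltW c0) hb h; rewrite ler_pdivlMr// in ha; lra.
- move=> a Aa; rewrite -actB rip_act; [|exact: ell2B|exact: ell2_act].
  rewrite -[act (star b) _]/(act (star b * a) xi); apply: op.
  by apply: (ssaM algA) => //; apply: (ssa_star algA).
Qed.

Lemma proj_contr z p : ell2 z -> is_proj z p -> n2 p <= n2 z.
Proof.
move=> hz [hp ap op]; apply/ler_addgt0Pr => e e0.
have [a Aa] := ap e e0; have ha := ell2_act a hxi.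
have := n2_ge0 (ell2B hz ha); rewrite !n2B//.
have := op a Aa; rewrite ripDl ?ripNl//; last exact: ell2N.
lra.
Qed.

Lemma proj_self : is_proj xi xi.
Proof.
split=> // [e e0|a Aa].
  exists 1; first exact: (ssa1 algA).
  have -> : xi - act 1 xi = 0 by apply: subrr.
  by rewrite n2_0 ltW.
rewrite subrr; have := @ripDl _ _ _ 0 0 (act a xi) ell2_0 ell2_0 (ell2_act a hxi).
by rewrite addr0 => /eqP; rewrite -subr_eq0 opprD addrA subrr sub0r oppr_eq0 => /eqP.
Qed.

Definition delta j l (v : H) : ell := fun i k => if (i == j) && (k == l) then v else 0.

Lemma delta_bound j l v : ell2 (delta j l v) /\ n2 (delta j l v) <= nsq v.
Proof.
apply: n2_le => n; rewrite /dots.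
rewrite (eq_bigr (fun i => if i == j then nsq v else 0)) => [|i _].
  rewrite -big_mkcond big_nat1_eq; case: ifP => // _; exact: nsq_ge0.
rewrite /delta; case: eqVneq => [_|_] /=; last first.
  by apply: big1 => k _; rewrite rdot0l.
rewrite (bigD1 l)//= eqxx big1 ?addr0// => k /negbTE ->.
by rewrite rdot0l.
Qed.

Variable y : vop.
Hypothesis hy : forall g : H -> H, bounded_operators g ->
  (forall a, A a -> forall v, g (a v) = a (g v)) -> forall v, g (y v) = y (g v).

(* The matrix entries of the projection onto the closure of A xi in l2 commute with
   A, hence with y; so the projection commutes with y acting diagonally. *)
Lemma bicommutant_ell2 (e : R) : 0 < e -> exists2 a, A a & n2 (act y xi - act a xi) <= e.
Proof.
move=> e0.
have /choice[pr hpr] (z : ell) : exists p, ell2 z -> is_proj z p.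
  by have [/proj_ex[p hp]|nz] := pselect (ell2 z); [exists p|exists 0].
have prE z p : ell2 z -> is_proj z p -> pr z = p.
  by move=> hz; apply: proj_uniq => //; apply: hpr.
have hd j l v : ell2 (delta j l v) by case: (delta_bound j l v).
have pi_delta j l v : pr (delta j l (y v)) = act y (pr (delta j l v)).
  apply/funext => i; apply/funext => k.
  apply: (hy (g := fun u => pr (delta j l u) i k)).
    apply: (@bounded_operators_nsq _ _ _ 1) => [c u w|u].
      have -> : delta j l (c *: u + w) = c *: delta j l u + delta j l w.
        apply/funext => i'; apply/funext => k'; rewrite /delta !fctE.
        by case: ifP => // _; rewrite scaler0 addr0.
      rewrite (prE _ (c *: pr (delta j l u) + pr (delta j l w)))//.
        by apply: ell2D => //; apply: ell2Z.
      by apply: proj_lin => //; apply: hpr.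
    have [h1 h2] := delta_bound j l u; have hp := hpr _ h1.
    rewrite mul1r (le_trans (nsq_n2 _ _ (proj_ell2 hp)))//.
    by rewrite (le_trans (proj_contr h1 hp)).
  move=> a Aa u.
  have -> : delta j l (a u) = act a (delta j l u).
    apply/funext => i'; apply/funext => k'; rewrite /act /delta.
    by case: ifP => // _; rewrite vop0.
  rewrite (prE _ (act a (pr (delta j l u))))//; first exact: ell2_act.
  by apply: proj_act => //; apply: hpr.
(* Finitely supported families are sums of deltas, hence good; xi is then reached through its
   truncations [tr n]. *)
pose good z := ell2 z /\ pr (act y z) = act y (pr z).
have good0 : good 0.
  have p0 : pr 0 = 0.
    apply: prE; first exact: ell2_0.
    have e1 : -1 *: xi + xi = 0 by rewrite scaleN1r addNr.
    have := proj_lin (-1) hxi hxi proj_self proj_self.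
    by rewrite e1.
  have a0 : act y 0 = 0 by apply/funext => i; apply/funext => k; exact: vop0.
  by split; rewrite ?a0 ?p0 ?a0//; exact: ell2_0.
have goodD z w : good z -> good w -> good (z + w).
  have prD (u v : ell) : ell2 u -> ell2 v -> pr (u + v) = pr u + pr v.
    move=> hu hv; apply: prE; first exact: ell2D.
    by rewrite -[u]scale1r -[pr _]scale1r; apply: proj_lin => //; rewrite ?scale1r//; apply: hpr.
  move=> [hz gz] [hw gw]; split; first exact: ell2D.
  by rewrite actD !prD ?gz ?gw ?actD//; apply: ell2_act.
pose tr n : ell := fun i k => if (i < n)%N then xi i k else 0.
have good_tr n : good (tr n).
  elim: n => [|n IH]; first by have -> : tr 0%N = 0 by [].
  have -> : tr n.+1 = tr n + \sum_k delta n k (xi n k).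
    apply/funext => i; apply/funext => k; rewrite /tr !fctE.
    have -> : (\sum_k' delta n k' (xi n k')) i k = if i == n then xi i k else 0.
      transitivity (\sum_k' delta n k' (xi n k') i k).
        by elim/big_rec2 : _ => // k' u v _ <-.
      rewrite /delta; case: eqVneq => [->|_] /=; last by rewrite big1.
      rewrite (bigD1 k)//= eqxx big1 ?addr0// => k' /negbTE.
      by rewrite eq_sym => ->.
    by rewrite ltnS leq_eqVlt; case: eqVneq => [->|_] /=; rewrite ?ltnn ?add0r ?addr0.
  apply: (goodD _ _) => //; elim/big_rec : _ => // k u _ gu; apply: goodD => //.
  split=> //; rewrite -pi_delta; congr pr.
  apply/funext => i; apply/funext => k'; rewrite /act /delta.
  by case: ifP => // _; rewrite vop0.
have [c c0 hc] := obound_ex y.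
have htr n : ell2 (tr n) by case: (good_tr n).
have n2tr n : n2 (xi - tr n) <= n2 xi - dots xi xi n.
  suff h m : dots (xi - tr n) (xi - tr n) m + dots xi xi n <= n2 xi.
    by have [] := @n2_le _ _ _ (xi - tr n) (n2 xi - dots xi xi n) _ => // m; rewrite lerBrDr.
  apply: (@le_trans _ _ (dots xi xi (n + m))); last exact: dots_n2.
  have m1 : dots (xi - tr n) (xi - tr n) m <= dots (xi - tr n) (xi - tr n) (n + m).
    by apply: dots_nd; rewrite leq_addl.
  apply: (le_trans (lerD m1 (lexx _))).
  have m2 : dots (xi - tr n) (xi - tr n) (n + m) =
      \sum_(n <= i < n + m) \sum_k nsq (xi i k).
    rewrite /dots (big_cat_nat (leq0n n) (leq_addr m n)) /= big_nat_cond.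
    rewrite big1 => [|i /andP[/andP[_ ni] _]]; last first.
      by apply: big1 => k _; rewrite !fctE /tr ni subrr rdot0l.
    rewrite add0r big_nat_cond [RHS]big_nat_cond.
    apply: eq_bigr => i /andP[/andP[ni _] _]; apply: eq_bigr => k _.
    by rewrite !fctE /tr ltnNge ni subr0.
  have m3 : dots xi xi (n + m) = dots xi xi n +
      \sum_(n <= i < n + m) \sum_k nsq (xi i k).
    by rewrite {1}/dots (big_cat_nat (leq0n n) (leq_addr m n)).
  by rewrite m2 m3 addrC; exact: lexx.
have cv : dots xi xi n @[n --> \oo] --> n2 xi by apply: cvg_dots.
have ec : 0 < e / 4 / c by rewrite !divr_gt0.
have /cvgrPdist_le/(_ _ ec)[N _ /(_ N (leqnn N)) /= hN] := cv.
have small : n2 (xi - tr N) <= e / 4 / c.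
  by rewrite (le_trans (n2tr N))// (le_trans (ler_norm _)).
have [_ gN] := good_tr N.
have hpN := hpr _ (ell2_act y (htr N)); have [hp1 ap _] := hpN.
have [a Aa ha] := ap (e / 4) (divr_gt0 e0 (ltr0Sn _ 3)).
exists a => //; have hdiff := ell2B hxi (htr N).
(* Since xi is its own projection, xi - pr (tr N) is the projection of xi - tr N, and hence no
   larger. *)
have diff : is_proj (xi - tr N) (xi - pr (tr N)).
  have e1 w : xi - w = -1 *: w + xi by rewrite scaleN1r addrC.
  rewrite !e1; apply: proj_lin => //; last exact: proj_self.
  exact: hpr.
have hq := proj_ell2 diff.
have [h1 h2] := act_bound (ltW c0) hc hq.
have h3 := proj_contr hdiff diff.
rewrite actB -gN in h1 h2.
have -> : act y xi - act a xi =
    (act y xi - pr (act y (tr N))) + (pr (act y (tr N)) - act a xi).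
  by rewrite addrA subrK.
have := n2Dle h1 (ell2B hp1 (ell2_act a hxi)).
have : c * n2 (xi - pr (tr N)) <= e / 4.
  by rewrite mulrC -ler_pdivlMr// (le_trans h3).
lra.
Qed.

End Bicommutant.

(** With the vectors of [trace_normal_sq] as xi, closeness of a to y on xi bounds the trace of (y -
    a)^* (y - a). Nothing is obtained on the operator norm of a; [qclos_bounded] takes care of
    that. *)
Lemma bicommutant_dense (R : realType) (H : hilbertType R) (P : tracial_vNa H)
    (A : set (vop P)) (y : vop P) (e : R) :
  star_subalgebra A ->
  (forall g : H -> H, bounded_operators g ->
    (forall a, A a -> forall v, g (a v) = a (g v)) -> forall v, g (y v) = y (g v)) ->
  0 < e -> exists2 a, A a & q (y - a) <= e.
Proof.
move=> algA hy e0.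
have [m [z [B [d [d0 [zB hd]]]]]] := trace_normal_sq P e0.
have hz : ell2 z by exists B.
have [a Aa ha] := bicommutant_ell2 algA hz hy (divr_gt0 d0 (ltr0Sn _ 1)).
exists a => //; apply: hd => n.
apply: (@le_trans _ _ (d / 2 + d / 2)); last by lra.
under eq_bigr do rewrite big_split.
rewrite -actBl in ha; have hya : ell2 (act (y - a) z) by apply: ell2_act.
have h : \sum_(0 <= i < n) \sum_k nsq ((y - a) (z i k)) <= d / 2.
  by apply: le_trans ha; exact: (dots_n2 n hya).
by rewrite big_split; exact: lerD.
Qed.

(** * Bounded approximation *)

Section Closure.
Variables (R : realType) (H : hilbertType R) (P : tracial_vNa H).
Variables (A : set (vop P)).
Hypothesis algA : star_subalgebra A.
Local Notation vop := (vop P).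
Implicit Types a b y z : vop.

Definition qclos : set vop := [set y | forall e : R, 0 < e -> exists2 a, A a & q (y - a) <= e].

Lemma qclosW a : A a -> qclos a.
Proof. by move=> Aa e e0; exists a => //; rewrite subrr q0 ltW. Qed.
Lemma qclosD a b : qclos a -> qclos b -> qclos (a + b).
Proof.
move=> ha hb e e0; have [a' Aa' h] := ha (e / 4) (divr_gt0 e0 (ltr0Sn _ 3)).
have [b' Ab' h'] := hb (e / 4) (divr_gt0 e0 (ltr0Sn _ 3)).
exists (a' + b'); first exact: (ssaD algA).
rewrite opprD addrACA; have := qDle (a - a') (b - b'); lra.
Qed.
Lemma qclos_star a : qclos a -> qclos (star a).
Proof.
move=> ha e e0; have [a' Aa' h] := ha e e0.
by exists (star a'); [exact: (ssa_star algA)|rewrite -starB q_star].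
Qed.
(** Approximants carry no uniform norm bound, so the order matters: b' is chosen after a', with a
    precision that depends on the norm of a'. *)
Lemma qclosM a b : qclos a -> qclos b -> qclos (a * b).
Proof.
move=> ha hb e e0; have [d d0 hd] := obound_ex b.
have [a' Aa' h] := ha (e / 4 / d) (divr_gt0 (divr_gt0 e0 (ltr0Sn _ 3)) d0).
have [c c0 hc] := obound_ex a'.
have [b' Ab' h'] := hb (e / 4 / c) (divr_gt0 (divr_gt0 e0 (ltr0Sn _ 3)) c0).
exists (a' * b'); first exact: (ssaM algA).
have -> : a * b - a' * b' = (a - a') * b + a' * (b - b').
  by rewrite mulrBl mulrBr addrA subrK.
rewrite ler_pdivlMr// in h; rewrite ler_pdivlMr// in h'.
have := qDle ((a - a') * b) (a' * (b - b')).
have := q_mulr (a - a') (ltW d0) hd; have := q_mull (b - b') (ltW c0) hc; lra.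
Qed.

Lemma neumann_in c a n : A a -> A (neumann c a n).
Proof.
move=> Aa; elim: n => [|n IH] /=; first exact: (ssa0 algA).
have A1 := ssa1 algA.
apply: (ssaD algA); first exact: (ssaZ algA).
apply: (ssaM algA) => //; apply: (ssaZ algA); apply: (ssaB algA).
  exact: (ssaZ algA).
by apply: (ssaM algA) => //; apply: (ssa_star algA).
Qed.

(* Fixed-point iteration for [vtrunc h = y], that is h = y (1 + h^* h). *)
Fixpoint trunc_inv y k : vop := if k is k'.+1 then y * one_add_sq (trunc_inv y k') else 0.

(** In norms: |y| <= 1/4 and |h| <= 1/2 give |y (1 + h^* h)| <= 5/16 <= 1/2. *)
Lemma trunc_inv_obound y k : obound (16^-1) y -> obound (4^-1) (trunc_inv y k).
Proof.
move=> hy; elim: k => [|k IH] /=.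
  by move=> v; rewrite vzeroE nsq0 mulr_ge0// nsq_ge0.
have h2 : obound (4^-1 * 4^-1) (star (trunc_inv y k) * trunc_inv y k).
  by apply: oboundM => //; apply: obound_star.
apply: (@oboundW _ _ _ (16^-1 * (2 * (1 + 4^-1 * 4^-1)))); first by lra.
apply: oboundM => //.
by apply: oboundD => //; exact: obound1.
Qed.

(** The map h -> y (1 + h^* h) contracts the 2-norm by 1/4: the difference of two values of h^* h
    has two terms, each with a factor of norm at most 1/2, and |y| <= 1/4. *)
Lemma trunc_inv_close y k : obound (16^-1) y ->
  q (trunc_inv y k.+1 - trunc_inv y k) <= 16^-1 ^+ k * q y.
Proof.
move=> hy; elim: k => [|k IH].
  by rewrite /= subr0 /one_add_sq mulr0 addr0 mulr1 expr0 mul1r.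
have p4 : 0 <= 4^-1 :> R by lra.
have p16 : 0 <= 16^-1 :> R by lra.
have b1 := trunc_inv_obound k.+1 hy; have b2 := trunc_inv_obound k hy.
have -> : trunc_inv y k.+2 - trunc_inv y k.+1 =
    y * (one_add_sq (trunc_inv y k.+1) - one_add_sq (trunc_inv y k)) by rewrite mulrBr.
move: (trunc_inv y k.+1) (trunc_inv y k) b1 b2 IH => x' x b1 b2 IH.
have -> : one_add_sq x' - one_add_sq x = star x' * (x' - x) + star (x' - x) * x.
  by rewrite /one_add_sq opprD addrACA subrr add0r starB mulrBr mulrBl addrA subrK.
have h := qDle (star x' * (x' - x)) (star (x' - x) * x).
have h2 := q_mull (x' - x) p4 (obound_star p4 b1).
have h3 := q_mulr (star (x' - x)) p4 b2; rewrite q_star in h3.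
have := q_mull (star x' * (x' - x) + star (x' - x) * x) p16 hy.
rewrite exprS -mulrA; lra.
Qed.

Lemma sub_trunc_inv y k : obound (16^-1) y ->
  q (y - vtrunc (trunc_inv y k)) <= 16^-1 ^+ k * q y.
Proof.
move=> hy; rewrite (le_trans _ (trunc_inv_close k hy))//.
have -> : y - vtrunc (trunc_inv y k) =
    (trunc_inv y k.+1 - trunc_inv y k) * resol (trunc_inv y k).
  by rewrite mulrBl /= -mulrA one_add_sq_resol mulr1.
by rewrite -[leRHS]mul1r q_mulr//; exact: resol_obound.
Qed.

Lemma q1 : q (1 : vop) = 1.
Proof. by rewrite /q star1 mulr1 /rt trv1. Qed.

(** Up to a small error y is [vtrunc h] with h in the closure of A. An approximant a of h in A may
    have any norm, but [vtrunc a] is a contraction close to [vtrunc h]. A Neumann sum replaces the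
    resolvent by an element of A, moving [vtrunc a] by at most 1 in operator norm: the total norm is
    at most 2, so 4 for its square. *)
Lemma qclos_ball y (e : R) : qclos y -> obound (16^-1) y -> 0 < e ->
  exists z, [/\ A z, obound 4 z & q (z - y) <= e].
Proof.
move=> hy by_ e0.
have [k hk] : exists k, 16^-1 ^+ k * q y <= e / 16.
  have p : 0 < e / 16 / (q y + 1) by rewrite !divr_gt0// ltr_wpDl// q_ge0.
  have [|//|N hN] := @expr_small R 16^-1 _ _ _ p; [lra|lra|].
  exists N; have := hN N (leqnn N); have q0 := q_ge0 y.
  by rewrite ler_pdivlMr; [have : 0 <= 16^-1 ^+ N :> R by rewrite exprn_ge0 | ]; lra.
set h := trunc_inv y k.
have hh : qclos h.
  rewrite /h; elim: (k) => [|k' IH] /=; first by apply: qclosW; exact: (ssa0 algA).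
  apply: qclosM => //; apply: qclosD; first by apply: qclosW; exact: (ssa1 algA).
  by apply: qclosM => //; apply: qclos_star.
(* [trunc_comm_q] with f = 1 loses a factor 9, which leaves e / 16. *)
have [a Aa ha] := hh (e / 144) (divr_gt0 e0 (ltr0Sn _ 143)).
have ta : q (vtrunc a - vtrunc h) <= e / 16.
  have := trunc_comm_q a 1 h; rewrite !mulr1 !mul1r -starB q_star.
  by rewrite (qC a) ; lra.
have [c c0 hc] := obound_ex a.
have [N hN] : exists N, c * geo_ratio c ^+ N <= Num.min 1 (e / 8).
  have m0 : 0 < Num.min 1 (e / 8) by rewrite lt_min ltr01 divr_gt0.
  have [N hN] := expr_small (geo_ratio_ge0 c) (geo_ratio_lt1 (ltW c0)) (divr_gt0 m0 c0).
  by exists N; have := hN N (leqnn N); rewrite ler_pdivlMr// mulrC.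
rewrite le_min in hN; case/andP: hN => hN1 hN2.
pose d := a * (resol a - neumann c a N).
have hd : obound (c * geo_ratio c ^+ N) d.
  by apply: oboundM => //; [exact: ltW|apply: resol_neumann => //; exact: ltW].
have zE : a * neumann c a N = vtrunc a - d.
  by rewrite /d mulrBr opprB addrC subrK.
exists (a * neumann c a N); split.
- by apply: (ssaM algA) => //; apply: neumann_in.
- rewrite zE; apply: (@oboundW _ _ _ (2 * (1 + 1))); first by lra.
  apply: oboundD; first exact: trunc_obound.
  by apply: oboundN; apply: oboundW hd.
- have qd : q d <= e / 8.
    have p0 : 0 <= c * geo_ratio c ^+ N.
      by apply: mulr_ge0; [exact: ltW|apply: exprn_ge0; exact: geo_ratio_ge0].
    by have := q_mull 1 p0 hd; rewrite mulr1 q1 mulr1 => h'; apply: le_trans h' hN2.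
  have -> : a * neumann c a N - y = - d + ((vtrunc a - vtrunc h) - (y - vtrunc h)).
    by rewrite opprB (addrA (vtrunc a - _)) subrK zE -addrA [RHS]addrCA.
  have := sub_trunc_inv k by_; rewrite -/h => ht.
  have := qDle (- d) ((vtrunc a - vtrunc h) - (y - vtrunc h)); rewrite qN.
  have := qBle (vtrunc a - vtrunc h) (y - vtrunc h); lra.
Qed.

(** Scaling by r with r^2 = 1 / (16 c) puts y into the ball of [qclos_ball]; scaling back multiplies
    the bound 4 by 16 c. *)
Lemma qclos_bounded y (c e : R) : qclos y -> 0 < c -> obound c y -> 0 < e ->
  exists z, [/\ A z, obound (64 * c) z & q (z - y) <= e].
Proof.
move=> hy c0 hc e0; set r := Num.sqrt (16 * c)^-1.
have r2 : r ^+ 2 = (16 * c)^-1 by rewrite sqr_sqrtr// invr_ge0 mulr_ge0// ltW.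
have c16 : 0 < 16 * c by rewrite mulr_gt0.
have r0 : 0 < r by rewrite sqrtr_gt0 invr_gt0.
have [|||z [Az hz qz]] := @qclos_ball (rc r *: y) (r ^+ 2 * e).
- move=> d d0; have [a Aa ha] := hy (d / r ^+ 2) (divr_gt0 d0 (exprn_gt0 2 r0)).
  exists (rc r *: a); first exact: (ssaZ algA).
  by rewrite -scalerBr qZr mulrC -ler_pdivlMr// exprn_gt0.
- have := oboundZ r hc; rewrite r2; apply: oboundW.
  by rewrite invfM -mulrA mulVf ?mulr1// gt_eqF.
- by rewrite mulr_gt0// exprn_gt0.
exists (rc r^-1 *: z); split; first exact: (ssaZ algA).
- have := oboundZ r^-1 hz; rewrite exprVn r2 invrK; apply: oboundW; lra.
- have -> : rc r^-1 *: z - y = rc r^-1 *: (z - rc r *: y).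
    by rewrite scalerBr scalerA -rcM mulVf ?gt_eqF// scale1r.
  by rewrite qZr exprVn mulrC ler_pdivrMr ?exprn_gt0// mulrC.
Qed.

End Closure.

(** * Averaging over signs *)

Section StarHom.
Variables (R : realType) (H K : hilbertType R).
Variables (M : tracial_vNa H) (P : tracial_vNa K).

Record star_hom (f : vop M -> vop P) : Prop := StarHom {
  sh_lin : forall c a b, f (c *: a + b) = c *: f a + f b;
  shM : forall a b, f (a * b) = f a * f b;
  sh1 : f 1 = 1;
  sh_star : forall a, f (star a) = star (f a);
  sh_bound : forall c a, 0 <= c -> obound c a -> obound c (f a) }.

Variables (f : vop M -> vop P) (hf : star_hom f).

Lemma shD a b : f (a + b) = f a + f b.
Proof. by rewrite -[a]scale1r (sh_lin hf) !scale1r. Qed.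
Lemma sh0 : f 0 = 0.
Proof. by apply: (addrI (f 0)); rewrite -shD !addr0. Qed.
Lemma shZ c a : f (c *: a) = c *: f a.
Proof. by rewrite -[c *: a]addr0 (sh_lin hf) sh0 addr0. Qed.
Lemma shB a b : f (a - b) = f a - f b.
Proof. by rewrite -scaleN1r addrC (sh_lin hf) scaleN1r addrC. Qed.

End StarHom.

Section TraceMore.
Variables (R : realType) (H : hilbertType R) (P : tracial_vNa H).
Local Notation vop := (vop P).
Implicit Types a b x y : vop.

Lemma rt_CS a b : rt (star a * b) ^+ 2 <= q a * q b.
Proof.
have [h|nb] := eqVneq (q b) 0.
  by rewrite (q_eq0 h) mulr0 rt0 q0 mulr0 expr0n.
have b0 : 0 < q b by rewrite lt_def nb q_ge0.
have := q_ge0 (rc (q b) *: a - rc (rt (star a * b)) *: b).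
rewrite qB !qZr starZ conj_rc -scalerAr rtZ -[_ *: star a * b]scalerAl rtZ => h.
rewrite -subr_ge0 -(pmulr_rge0 _ b0); lra.
Qed.

Definition comm a b := a * b - b * a.

Lemma commB a b x : comm (a - b) x = comm a x - comm b x.
Proof.
rewrite /comm mulrBl mulrBr !opprB [LHS]addrACA [RHS]addrACA.
by rewrite [- (b * x) - _]addrC.
Qed.
Lemma commD a b x : comm (a + b) x = comm a x + comm b x.
Proof. by rewrite /comm mulrDl mulrDr opprD addrACA. Qed.
Lemma comm_antisym a b : comm a b = - comm b a.
Proof. by rewrite /comm opprB. Qed.
Lemma commDr a b x : comm x (a + b) = comm x a + comm x b.
Proof. by rewrite comm_antisym commD opprD -!comm_antisym. Qed.
Lemma commBr a b x : comm x (a - b) = comm x a - comm x b.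
Proof. by rewrite ![comm x _]comm_antisym commB opprD. Qed.
Lemma q_comm_sym a b : q (comm a b) = q (comm b a).
Proof. by rewrite comm_antisym qN. Qed.
Lemma q_comm_star a b : q (comm (star a) b) = q (comm a (star b)).
Proof.
rewrite -q_star /comm starB !starM starK -qN opprB; congr q.
Qed.
Lemma q_comm_le c a b : 0 <= c -> obound c a -> q (comm a b) <= 4 * c * q b.
Proof.
move=> c0 ha; have := qBle (a * b) (b * a).
have := q_mull b c0 ha; have := q_mulr b c0 ha; rewrite /comm; lra.
Qed.

(* The expectation of Phi (b + sum_j e_j m_j), for independent random signs e_j. *)
Fixpoint sgn_avg (l : seq vop) b (Phi : vop -> R) : R :=
  if l is m :: l' then (sgn_avg l' (b + m) Phi + sgn_avg l' (b - m) Phi) / 2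
  else Phi b.

(** The probabilistic method: this extracts one choice of signs from an estimate on averages. *)
Lemma sgn_avg_ge0 l b Phi : 0 <= sgn_avg l b Phi -> exists b', 0 <= Phi b'.
Proof.
elim: l b => [|m l IH] b /=; first by exists b.
have [h _|h] := leP 0 (sgn_avg l (b + m) Phi); first exact: IH h.
by move=> h2; apply: (IH (b - m)); lra.
Qed.

Lemma sgn_avg_lin l b c Phi Psi :
  sgn_avg l b (fun x => c * Phi x + Psi x) = c * sgn_avg l b Phi + sgn_avg l b Psi.
Proof. by elim: l b => [|m l IH] b //=; rewrite !IH; field. Qed.

(** The parallelogram law, satisfied by squared 2-norms of additive maps. It is what cancels the
    cross terms in an average over signs. *)
Definition quadratic (Phi : vop -> R) :=
  forall x m, Phi (x + m) + Phi (x - m) = 2 * Phi x + 2 * Phi m.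

Lemma sgn_avg_quad l b Phi : quadratic Phi ->
  sgn_avg l b Phi = Phi b + \sum_(m <- l) Phi m.
Proof.
move=> h; elim: l b => [|m l IH] b /=; first by rewrite big_nil addr0.
by rewrite !IH big_cons; have := h b m; lra.
Qed.

Lemma quadratic_q : quadratic (@q _ _ P).
Proof. by move=> x m; rewrite qB qD; ring. Qed.

(** Column and row square of the family: without commutativity, the fourth moment of a signed sum
    involves both. *)
Definition qsum (l : seq vop) := \sum_(m <- l) star m * m.
Definition qsum' (l : seq vop) := \sum_(m <- l) m * star m.

Lemma mulDD (p r x m : vop) : (p + r) * (x + m) = (p * x + r * m) + (p * m + r * x).
Proof. by rewrite mulrDl !mulrDr [r * x + _]addrC addrACA. Qed.
Lemma mulBB (p r x m : vop) : (p - r) * (x - m) = (p * x + r * m) - (p * m + r * x).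
Proof. by rewrite mulrBl !mulrBr opprB addrACA -opprD. Qed.

(** The two products are s + d and s - d, with s even and d odd in m, so that only |s|_2^2 and
    |d|_2^2 remain. The mixed term in |d|_2^2 has no sign; the arithmetic-geometric mean bounds it
    by the mass of star b * m. *)
Lemma fourth_moment_step b m :
  q ((b + m) * star (b + m)) + q ((b - m) * star (b - m)) <=
  2 * q (b * star b) + 2 * q (m * star m) +
  4 * rt (star b * b * (star m * m)) + 8 * rt (b * star b * (m * star m)).
Proof.
pose s := b * star b + m * star m; pose d := b * star m + m * star b.
have -> : (b + m) * star (b + m) = s + d.
  by rewrite starD mulDD.
have -> : (b - m) * star (b - m) = s - d.
  by rewrite starB mulBB.
rewrite qB qD; have -> : star s = s by rewrite /s starD !starM !starK.
set X := rt (s * d).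
have qs : q s = q (b * star b) + 2 * rt (b * star b * (m * star m)) + q (m * star m).
  by rewrite /s qD starM starK.
have qd : q d <= 2 * rt (star b * b * (star m * m)) + 2 * rt (b * star b * (m * star m)).
  rewrite /d; set u := b * star m; set v := m * star b.
  have uv : v = star u by rewrite /u /v starM starK.
  have e1 : q u = rt (star b * b * (star m * m)).
    by rewrite /q /u starM starK -mulrA rtC -!mulrA.
  have e2 : rt (b * star b * (m * star m)) = q (star b * m).
    by rewrite /q starM starK -[X in _ = rt X]mulrA [RHS]rtC -!mulrA.
  have e3 : rt (star u * v) = rt (star (star m * b) * (star b * m)).
    by rewrite /u /v !starM !starK -[X in rt X = _]mulrA rtC -!mulrA.
  rewrite qD e3 uv q_star e1 e2.
  have := rt_amgm (star m * b) (star b * m).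
  have -> : q (star m * b) = q (star b * m) by rewrite -q_star starM starK.
  lra.
lra.
Qed.

(* Chosen so that splitting off one more sign does not increase it. *)
Definition fourth_bound (l : seq vop) b :=
  q (b * star b) + 2 * rt (star b * b * qsum l) + 4 * rt (b * star b * qsum' l)
  + rt (qsum l * qsum l) + 2 * rt (qsum' l * qsum' l).

Lemma quadratic_rt (u : vop) : quadratic (fun b => rt (star b * b * u)).
Proof.
move=> x m; rewrite starD starB mulDD mulBB -rtD -mulrDl addrACA subrr addr0.
by rewrite !mulrDl !rtD; ring.
Qed.
Lemma quadratic_rt' (u : vop) : quadratic (fun b => rt (b * star b * u)).
Proof.
move=> x m; rewrite starD starB mulDD mulBB -rtD -mulrDl addrACA subrr addr0.
by rewrite !mulrDl !rtD; ring.
Qed.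

(** Induction on the signs: averaging over the sign of m moves star m * m into [qsum] and m * star m
    into [qsum']. For b = 0 the bound is |[qsum]|_2^2 + 2 |[qsum']|_2^2, the source of the constant
    3 in [fourth_bound_tsum]. *)
Lemma sgn_avg_fourth l b :
  sgn_avg l b (fun x => q (x * star x)) <= fourth_bound l b.
Proof.
elim: l b => [|m l IH] b /=.
  by rewrite /fourth_bound /qsum /qsum' !big_nil !mulr0 rt0 !mulr0 !addr0.
have := IH (b + m); have := IH (b - m).
have h2 := quadratic_rt (qsum l) b m; have h3 := quadratic_rt' (qsum' l) b m.
have h4 := fourth_moment_step b m; have h5 := q_ge0 (m * star m).
rewrite /fourth_bound.
have -> : qsum (m :: l) = star m * m + qsum l by rewrite /qsum big_cons.
have -> : qsum' (m :: l) = m * star m + qsum' l by rewrite /qsum' big_cons.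
rewrite ![_ * (_ + qsum l)]mulrDr ![_ * (_ + qsum' l)]mulrDr.
rewrite ![(_ + qsum l) * _]mulrDl ![(_ + qsum' l) * _]mulrDl !rtD.
have -> : rt (qsum l * (star m * m)) = rt (star m * m * qsum l) by rewrite rtC.
have -> : rt (qsum' l * (m * star m)) = rt (m * star m * qsum' l) by rewrite rtC.
have -> : rt (star m * m * (star m * m)) = q (m * star m).
  by rewrite /q starM starK -[X in rt X = _]mulrA rtC -!mulrA.
have -> : rt (m * star m * (m * star m)) = q (m * star m).
  by rewrite /q starM starK.
lra.
Qed.

End TraceMore.

(** * Commuting tensor factors *)

Section TensorFactors.
Variables (R : realType) (H0 H1 H2 K : hilbertType R).
Variables (M : tracial_vNa H0) (N1 : tracial_vNa H1) (N2 : tracial_vNa H2).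
Variable P : tracial_vNa K.

(** What the averaging argument uses of the tensor product: three commuting copies and a trace that
    factorizes. In this form the exchange of N1 and N2 is immediate. *)
Record tensor_factors (f0 : vop M -> vop P) (f1 : vop N1 -> vop P)
    (f2 : vop N2 -> vop P) : Prop := TensorFactors {
  tf_hom0 : star_hom f0; tf_hom1 : star_hom f1; tf_hom2 : star_hom f2;
  tf_comm01 : forall a b, f0 a * f1 b = f1 b * f0 a;
  tf_comm02 : forall a b, f0 a * f2 b = f2 b * f0 a;
  tf_comm12 : forall a b, f1 a * f2 b = f2 b * f1 a;
  tf_trace : forall a b c, trv (f0 a * f1 b * f2 c) = trv a * trv b * trv c }.

End TensorFactors.

Section Swap.
Variables (R : realType) (H0 H1 H2 K : hilbertType R).
Variables (M : tracial_vNa H0) (N1 : tracial_vNa H1) (N2 : tracial_vNa H2).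
Variable P : tracial_vNa K.

Lemma tensor_factors_swap (f0 : vop M -> vop P) (f1 : vop N1 -> vop P)
    (f2 : vop N2 -> vop P) : tensor_factors f0 f1 f2 -> tensor_factors f0 f2 f1.
Proof.
move=> [h0 h1 h2 c01 c02 c12 tr]; split=> // a b c.
by rewrite -mulrA -c12 mulrA tr mulrAC.
Qed.

End Swap.

(** * Algebraic tensors with orthonormal second components *)

Section Span.
Variables (R : realType) (H0 H1 K : hilbertType R).
Variables (M : tracial_vNa H0) (N : tracial_vNa H1) (P : tracial_vNa K).
Variables (f : vop M -> vop P) (g : vop N -> vop P).

Definition tsum (s : seq (vop M * vop N)) : vop P := \sum_(p <- s) f p.1 * g p.2.
Definition alg2 : set (vop P) := [set z | exists s, z = tsum s].

Hypotheses (hf : star_hom f) (hg : star_hom g) (fg : forall a b, f a * g b = g b * f a).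

Lemma tsum_cat s s' : tsum (s ++ s') = tsum s + tsum s'.
Proof. exact: big_cat. Qed.
Lemma tsum_cons p s : tsum (p :: s) = f p.1 * g p.2 + tsum s.
Proof. exact: big_cons. Qed.

Lemma tsumZ c s : c *: tsum s = tsum [seq (c *: p.1, p.2) | p <- s].
Proof.
rewrite /tsum big_map scaler_sumr; apply: eq_bigr => p _.
by rewrite (shZ hf) scalerAl.
Qed.

Lemma alg2_star : star_subalgebra alg2.
Proof.
split.
- by exists [:: (1, 1)]; rewrite /tsum big_seq1 (sh1 hf) (sh1 hg) mulr1.
- move=> c _ _ [s ->] [s' ->]; rewrite tsumZ -tsum_cat.
  by exists ([seq (c *: p.1, p.2) | p <- s] ++ s').
- move=> _ _ [s ->] [s' ->].
  exists [seq (p.1 * p'.1, p.2 * p'.2) | p <- s, p' <- s'].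
  rewrite /tsum big_allpairs_dep mulr_suml; apply: eq_bigr => p _.
  rewrite mulr_sumr; apply: eq_bigr => p' _.
  by rewrite (shM hf) (shM hg) -!mulrA; congr (_ * _); rewrite !mulrA fg.
- move=> _ [s ->]; exists [seq (star p.1, star p.2) | p <- s].
  rewrite /tsum big_map star_sum; apply: eq_bigr => p _.
  by rewrite starM (sh_star hf) (sh_star hg) -(sh_star hf) -(sh_star hg) fg.
Qed.

Lemma alg2_l a : alg2 (f a).
Proof. by exists [:: (a, 1)]; rewrite /tsum big_seq1 (sh1 hg) mulr1. Qed.

End Span.

Section Orthonormal.
Variables (R : realType) (H : hilbertType R) (N : tracial_vNa H).
Local Notation C := (Cplx R).
Implicit Types (n : vop N) (s : seq (vop N)).

Fixpoint orthonormal_seq s : Prop :=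
  if s is n :: s' then
    [/\ q n = 1, forall n', n' \in s' -> trv (star n * n') = 0 & orthonormal_seq s']
  else True.

Lemma trv_star_sym n n' : trv (star n * n') = (trv (star n' * n))^*.
Proof. by rewrite -trv_star starM starK. Qed.

Lemma orthonormal_coord s (c : vop N -> C) e : orthonormal_seq s -> e \in s ->
  \sum_(i <- s) c i * trv (star e * i) = c e.
Proof.
elim: s => [|n s IH] //= [qn on hs]; rewrite in_cons big_cons => /orP[/eqP->|es].
  rewrite trv_q qn rc1 mulr1 big_seq big1 ?addr0// => i is_.
  by rewrite on// mulr0.
by rewrite IH// trv_star_sym on// conjC0 mulr0 add0r.
Qed.

Lemma orthonormal_star s : orthonormal_seq s -> orthonormal_seq [seq star n | n <- s].
Proof.
elim: s => [|n s IH] //= [qn on hs]; split; last exact: IH.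
  by rewrite q_star.
by move=> _ /mapP[n' n's ->]; rewrite starK trvC trv_star_sym on// conjC0.
Qed.

End Orthonormal.

Section GramSchmidt.
Variables (R : realType) (H0 H1 K : hilbertType R).
Variables (M : tracial_vNa H0) (N : tracial_vNa H1) (P : tracial_vNa K).
Variables (f : vop M -> vop P) (g : vop N -> vop P).
Hypotheses (hf : star_hom f) (hg : star_hom g).

(** The coefficients of n along the earlier vectors are moved into the M-components, which leaves
    the sum unchanged. A remainder r with q r = 0 is 0 by faithfulness and is dropped. *)
Lemma gram_schmidt (s : seq (vop M * vop N)) : exists s',
  orthonormal_seq (map snd s') /\ tsum f g s = tsum f g s'.
Proof.
elim: s => [|[m n] s [s0 [on0 e0]]]; first by exists [::].
pose c (e : vop N) := trv (star e * n).
pose r := n - \sum_(e <- map snd s0) c e *: e.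
pose s1 := [seq (p.1 + c p.2 *: m, p.2) | p <- s0].
have s1E : map snd s1 = map snd s0 by rewrite -map_comp; apply: eq_map.
have e1 : tsum f g ((m, n) :: s) = f m * g r + tsum f g s1.
  have -> : tsum f g s1 = tsum f g s0 + \sum_(p <- s0) f m * (c p.2 *: g p.2).
    rewrite {1}/tsum big_map -big_split; apply: eq_bigr => p _ /=.
    by rewrite (shD hf) (shZ hf) mulrDl -scalerAl scalerAr.
  rewrite tsum_cons e0 /= /r (shB hg) mulrBr big_map.
  rewrite (big_morph g (shD hg) (sh0 hg)) mulr_sumr.
  under [X in - X]eq_bigr do rewrite (shZ hg).
  by rewrite [tsum f g s0 + _]addrC addrA subrK.
have ro e : e \in map snd s0 -> trv (star r * e) = 0.
  move=> es; rewrite trv_star_sym /r mulrBr trvB mulr_sumr trv_sum.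
  under eq_bigr do rewrite -scalerAr trvZ.
  by rewrite (orthonormal_coord c on0 es) subrr conjC0.
have [r0|r0] := eqVneq (q r) 0.
  exists s1; rewrite s1E; split=> //.
  by rewrite e1 (q_eq0 r0) (sh0 hg) mulr0 add0r.
have rp : 0 < Num.sqrt (q r) by rewrite sqrtr_gt0 lt_def r0 q_ge0.
exists ((rc (Num.sqrt (q r)) *: m, rc (Num.sqrt (q r))^-1 *: r) :: s1).
rewrite /= s1E; split; last first.
  rewrite e1 tsum_cons /= (shZ hf) (shZ hg) -scalerAl -scalerAr scalerA -rcM.
  by rewrite divff ?gt_eqF// scale1r.
split=> // [|e es]; last by rewrite starZ -scalerAl trvZ ro// mulr0.
by rewrite qZr exprVn sqr_sqrtr ?q_ge0// mulVf.
Qed.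

End GramSchmidt.

Section Expansion.
Variables (R : realType) (H0 H1 H2 K : hilbertType R).
Variables (M : tracial_vNa H0) (N1 : tracial_vNa H1) (N2 : tracial_vNa H2).
Variable P : tracial_vNa K.
Variables (f0 : vop M -> vop P) (f1 : vop N1 -> vop P) (f2 : vop N2 -> vop P).
Hypothesis tf : tensor_factors f0 f1 f2.

Let h0 := tf_hom0 tf.
Let h1 := tf_hom1 tf.
Let h2 := tf_hom2 tf.
Let alg := alg2_star h0 h1 (tf_comm01 tf).
Local Notation Q1 := (qclos (alg2 f0 f1)).

Lemma trv_f0 a : trv (f0 a) = trv a.
Proof.
by have := tf_trace tf a 1 1; rewrite (sh1 h1) (sh1 h2) !mulr1 !trv1 !mulr1.
Qed.
Lemma q_f0 a : q (f0 a) = q a.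
Proof. by rewrite /q -(sh_star h0) -(shM h0) /rt trv_f0. Qed.

Lemma qclos_comm w n : Q1 w -> w * f2 n = f2 n * w.
Proof.
move=> hw; apply/eqP; rewrite -subr_eq0; apply/eqP; apply: q_eq0; apply/eqP.
rewrite eq_le q_ge0 andbT; apply/ler_addgt0Pr => e e0; rewrite add0r.
have [c c0 hc] := obound_ex (f2 n).
have [_ [s ->] hs] := hw (e / (4 * c)) (divr_gt0 e0 (mulr_gt0 (ltr0Sn _ 3) c0)).
have -> : w * f2 n - f2 n * w = comm (w - tsum f0 f1 s) (f2 n).
  rewrite commB -[LHS]subr0; congr (_ - _); apply/esym/eqP; rewrite subr_eq0.
  rewrite /tsum mulr_suml mulr_sumr; apply/eqP; apply: eq_bigr => p _.
  by rewrite -mulrA (tf_comm12 tf) !mulrA (tf_comm02 tf).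
rewrite q_comm_sym (le_trans (q_comm_le _ (ltW c0) hc))//.
by rewrite ler_pdivlMr ?mulr_gt0// in hs; lra.
Qed.

Lemma trv_alg2 s n : trv (tsum f0 f1 s * f2 n) = trv (tsum f0 f1 s) * trv n.
Proof.
rewrite /tsum mulr_suml !trv_sum mulr_suml; apply: eq_bigr => p _.
rewrite (tf_trace tf) -[f0 p.1 * f1 p.2]mulr1 -(sh1 h2) (tf_trace tf) trv1.
by rewrite mulr1.
Qed.

(** For the trace-free part n0 of n, the functional u -> trv (u * f2 n0) vanishes on the algebra,
    and on its 2-norm closure by Cauchy-Schwarz. The imaginary part is the real part at i w. *)
Lemma trv_qclos w n : Q1 w -> trv (w * f2 n) = trv w * trv n.
Proof.
pose n0 := n - trv n *: 1.
have tr0 s : trv (tsum f0 f1 s * f2 n0) = 0.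
  by rewrite trv_alg2 /n0 trvB trvZ trv1 mulr1 subrr mulr0.
have re0 u : Q1 u -> rt (u * f2 n0) = 0.
  move=> hu; apply/eqP; rewrite -sqrf_eq0 eq_le sqr_ge0 andbT.
  apply/ler_addgt0Pr => e e0; rewrite add0r.
  have q1 : 0 < q (f2 n0) + 1 by rewrite ltr_wpDl// q_ge0.
  have [_ [s ->] hs] := hu (e / (q (f2 n0) + 1)) (divr_gt0 e0 q1).
  have -> : rt (u * f2 n0) = rt (star (star (u - tsum f0 f1 s)) * f2 n0).
    by rewrite starK mulrBl rtB [X in _ - X]/rt tr0 cre0 subr0.
  rewrite (le_trans (rt_CS _ _))// q_star.
  rewrite ler_pdivlMr// in hs; have := q_ge0 (u - tsum f0 f1 s); lra.
move=> hw; have z0 : trv (w * f2 n0) = 0.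
  apply: cplx_eq; first exact: re0.
  have := re0 (ci R *: w) _; rewrite -scalerAl /rt trvZ cre_ci => h.
  apply/eqP; rewrite -oppr_eq0 h//.
  rewrite -[w]mul1r scalerAl.
  by apply: (qclosM alg) => //; apply: qclosW; apply: (ssaZ alg); exact: (ssa1 alg).
move: z0; rewrite /n0 (shB h2) (shZ h2) (sh1 h2) mulrBr -scalerAr mulr1 trvB trvZ.
by move/eqP; rewrite subr_eq0 => /eqP ->; rewrite mulrC.
Qed.

Definition wsum (s : seq (vop P * vop N2)) : vop P := \sum_(p <- s) p.1 * f2 p.2.

(** Pythagoras with coefficients in M (x) N1: the trace of (w n)^* (w' n') factors into those of w^*
    w' and n^* n'. *)
Lemma q_wsum s : (forall p, p \in s -> Q1 p.1) -> orthonormal_seq (map snd s) ->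
  q (wsum s) = \sum_(p <- s) q p.1.
Proof.
rewrite /wsum; elim: s => [|[w n] s IH] hs; first by rewrite !big_nil q0.
move=> /= [qn on hon]; rewrite !big_cons /= qD.
rewrite IH//; last by move=> p ps; apply: hs; rewrite in_cons ps orbT.
have hw : Q1 w by apply: (hs (w, n)); rewrite in_cons eqxx.
have key w' n' : Q1 w' -> trv (star (w * f2 n) * (w' * f2 n')) =
    trv (star w * w') * trv (star n * n').
  move=> hw'; have hww : Q1 (star w * w').
    by apply: (qclosM alg) => //; apply: (qclos_star alg).
  rewrite starM -(sh_star h2) -mulrA trvC mulrA -mulrA -(shM h2) trv_qclos//.
  by congr (_ * _); exact: trvC.
have hws : forall p, p \in s -> Q1 p.1 by move=> p ps; apply: hs; rewrite in_cons ps orbT.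
have -> : q (w * f2 n) = q w.
  by rewrite /q /rt key// !trv_q qn rc1 mulr1.
rewrite mulr_sumr rt_sum big_seq big1 ?mulr0 ?addr0// => p ps.
by rewrite /rt (key _ _ (hws p ps)) on ?mulr0//; exact: map_f.
Qed.

Lemma q_tsum_w (w : vop M -> vop P) s : (forall a, Q1 (w a)) -> orthonormal_seq (map snd s) ->
  q (\sum_(p <- s) w p.1 * f2 p.2) = \sum_(p <- s) q (w p.1).
Proof.
move=> hw hs; pose s' := [seq (w p.1, p.2) | p <- s].
have e : map snd s' = map snd s by rewrite -map_comp.
have h : forall p, p \in s' -> Q1 p.1 by move=> _ /mapP[p _ ->]; exact: hw.
by have := q_wsum h; rewrite e /wsum !big_map => /(_ hs).
Qed.

Lemma Q1_f0 a : Q1 (f0 a).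
Proof. by apply: qclosW; apply: alg2_l. Qed.

Lemma q_tsum s : orthonormal_seq (map snd s) -> q (tsum f0 f2 s) = \sum_(p <- s) q p.1.
Proof.
move=> hs; rewrite /tsum (q_tsum_w Q1_f0)//.
by apply: eq_bigr => p _; rewrite q_f0.
Qed.

Lemma q_comm_tsum x s : Q1 x -> orthonormal_seq (map snd s) ->
  q (comm x (tsum f0 f2 s)) = \sum_(p <- s) q (comm x (f0 p.1)).
Proof.
move=> hx hs; have -> : comm x (tsum f0 f2 s) = \sum_(p <- s) comm x (f0 p.1) * f2 p.2.
  rewrite /comm /tsum mulr_sumr mulr_suml -sumrB; apply: eq_bigr => p _.
  by rewrite mulrBl -!mulrA (qclos_comm p.2 hx).
apply: (q_tsum_w (w := fun a => comm x (f0 a))) => // a.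
rewrite /comm -scaleN1r addrC; have hfa := Q1_f0 a.
apply: (qclosD alg); last exact: (qclosM alg).
rewrite -[f0 a * x]mul1r scalerAl; apply: (qclosM alg); last exact: (qclosM alg).
by apply: qclosW; apply: (ssaZ alg); exact: (ssa1 alg).
Qed.

(** With z the tensor and m_j its M-components, for fixed j the sum over i of |m_i m_j^*|_2^2 is |z
    m_j^*|_2^2 by Pythagoras, hence at most c |m_j|_2^2. *)
Lemma tsum_row_bound c s : 0 <= c -> orthonormal_seq (map snd s) -> obound c (tsum f0 f2 s) ->
  \sum_(i <- s) \sum_(j <- s) q (i.1 * star j.1) <= c * \sum_(j <- s) q j.1.
Proof.
move=> c0 hs hc; rewrite exchange_big mulr_sumr; apply: ler_sum => j _.
have := q_mull (f0 (star j.1)) c0 hc; rewrite q_f0 q_star.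
have -> : tsum f0 f2 s * f0 (star j.1) = \sum_(p <- s) f0 (p.1 * star j.1) * f2 p.2.
  rewrite /tsum mulr_suml; apply: eq_bigr => p _.
  by rewrite (shM h0) -!mulrA (tf_comm02 tf).
rewrite (q_tsum_w (w := fun a => f0 (a * star j.1)))// => [|a]; last exact: Q1_f0.
by congr (_ <= _); apply: eq_bigr => p _; rewrite q_f0.
Qed.

Lemma star_tsum s : star (tsum f0 f2 s) = tsum f0 f2 [seq (star p.1, star p.2) | p <- s].
Proof.
rewrite /tsum star_sum big_map; apply: eq_bigr => p _.
by rewrite starM -(sh_star h0) -(sh_star h2) (tf_comm02 tf).
Qed.

Lemma tsum_col_bound c s : 0 <= c -> orthonormal_seq (map snd s) -> obound c (tsum f0 f2 s) ->
  \sum_(i <- s) \sum_(j <- s) q (star i.1 * j.1) <= c * \sum_(j <- s) q j.1.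
Proof.
move=> c0 hs hc; have := @tsum_row_bound c [seq (star p.1, star p.2) | p <- s] c0.
rewrite -star_tsum -map_comp => /(_ _ (obound_star c0 hc)).
rewrite (_ : map _ s = [seq star n | n <- map snd s]); last by rewrite -map_comp.
move=> /(_ (orthonormal_star hs)); rewrite !big_map /=.
under eq_bigr do rewrite big_map /=.
under eq_bigr do under eq_bigr do rewrite starK.
by under [in leRHS]eq_bigr do rewrite q_star.
Qed.

Definition left_parts (s : seq (vop M * vop N2)) := map fst s.

Lemma fourth_bound_tsum c s : 0 <= c -> orthonormal_seq (map snd s) -> obound c (tsum f0 f2 s) ->
  fourth_bound (left_parts s) 0 <= 3 * c ^+ 2.
Proof.
move=> c0 hs hc; rewrite /fourth_bound star0 mul0r q0 mul0r mul0r rt0 !mulr0 !add0r.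
have e1 : rt (qsum (left_parts s) * qsum (left_parts s)) =
    \sum_(i <- s) \sum_(j <- s) q (i.1 * star j.1).
  rewrite /qsum /left_parts !big_map mulr_suml rt_sum; apply: eq_bigr => i _.
  rewrite mulr_sumr rt_sum; apply: eq_bigr => j _.
  by rewrite /q starM starK mulrA rtC !mulrA.
have e2 : rt (qsum' (left_parts s) * qsum' (left_parts s)) =
    \sum_(i <- s) \sum_(j <- s) q (star i.1 * j.1).
  rewrite /qsum' /left_parts !big_map mulr_suml rt_sum; apply: eq_bigr => i _.
  rewrite mulr_sumr rt_sum; apply: eq_bigr => j _.
  by rewrite /q starM starK mulrA rtC !mulrA.
rewrite e1 e2; have b1 := tsum_row_bound c0 hs hc; have b2 := tsum_col_bound c0 hs hc.
have qz : \sum_(j <- s) q j.1 <= c.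
  by rewrite -q_tsum//; have := q_mull 1 c0 hc; rewrite mulr1 q1 mulr1.
have : c * \sum_(j <- s) q j.1 <= c * c by rewrite ler_wpM2l.
by rewrite expr2; lra.
Qed.

End Expansion.

Section Quadratic.
Variables (R : realType) (H : hilbertType R) (P : tracial_vNa H).
Implicit Types (Phi Psi : vop P -> R).

Lemma quadratic_lin c Phi Psi : quadratic Phi -> quadratic Psi ->
  quadratic (fun x => c * Phi x + Psi x).
Proof. by move=> h h' x m; have := h x m; have := h' x m => e e'; rewrite addrACA e -mulrDr e'; ring. Qed.

Lemma quadratic0 : quadratic (fun _ : vop P => 0 : R).
Proof. by move=> x m; rewrite mulr0. Qed.

Lemma quadratic_sum (T : Type) (s : seq T) (Phi : T -> vop P -> R) :
  (forall t, quadratic (Phi t)) -> quadratic (fun x => \sum_(t <- s) Phi t x).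
Proof.
move=> h x m; rewrite !mulr_sumr -!big_split; apply: eq_bigr => t _; exact: h.
Qed.

Lemma quadratic_at0 Phi : quadratic Phi -> Phi 0 = 0.
Proof. by move=> h; have := h 0 0; rewrite addr0 subr0; lra. Qed.

End Quadratic.

Lemma quadratic_comp (R : realType) (H H' : hilbertType R) (P : tracial_vNa H)
    (P' : tracial_vNa H') (Phi : vop P' -> R) (g : vop P -> vop P') :
  quadratic Phi ->
  (forall x m, g (x + m) = g x + g m) -> (forall x m, g (x - m) = g x - g m) ->
  quadratic (fun x => Phi (g x)).
Proof. by move=> h gD gB x m; rewrite gD gB h. Qed.

(** * Choice of signs, followed by truncation *)

Section Selection.
Variables (R : realType) (H0 H1 H2 K : hilbertType R).
Variables (M : tracial_vNa H0) (N1 : tracial_vNa H1) (N2 : tracial_vNa H2).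
Variable P : tracial_vNa K.
Variables (f0 : vop M -> vop P) (f1 : vop N1 -> vop P) (f2 : vop N2 -> vop P).
Hypothesis tf : tensor_factors f0 f1 f2.
Let h0 := tf_hom0 tf.
Local Notation Q1 := (qclos (alg2 f0 f1)).
Local Notation Q2 := (qclos (alg2 f0 f2)).

Definition rtrunc (r : R) (b : vop M) : vop M := rc r^-1 *: vtrunc (rc r *: b).

Lemma rtrunc_obound r b : obound (r ^- 2) (rtrunc r b).
Proof. by have := oboundZ r^-1 (trunc_obound (rc r *: b)); rewrite mulr1 exprVn. Qed.

Lemma sub_rtrunc r b : 0 < r -> q (b - rtrunc r b) <= r ^+ 2 * q (b * star b).
Proof.
move=> r0; have := sub_trunc_q (rc r *: b).
have -> : b - rtrunc r b = rc r^-1 *: (rc r *: b - vtrunc (rc r *: b)).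
  by rewrite scalerBr scalerA -rcM mulVf ?gt_eqF// scale1r.
rewrite qZr starZ conj_rc -scalerAl -scalerAr !qZr exprVn => h.
by rewrite ler_pdivrMl ?exprn_gt0.
Qed.

Lemma commZl (c : Cplx R) (a b : vop M) : comm (c *: a) b = c *: comm a b.
Proof. by rewrite /comm -scalerAl -scalerAr scalerBr. Qed.

(** Independent of r, as the scalings by r and r^-1 cancel. The commutator of b^* with f is
    rewritten as that of b with f^*, which [q_comm_tsum] evaluates on average. *)
Lemma comm_rtrunc r b f : 0 < r ->
  q (comm (rtrunc r b) f) <= 3 * (2 * q (comm b f) + q (comm b (star f))).
Proof.
move=> r0; rewrite commZl qZr exprVn ler_pdivrMl ?exprn_gt0//.
have := trunc_comm_q (rc r *: b) f (rc r *: b).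
rewrite -/(comm _ _) -/(comm _ _) -/(comm _ _) starZ conj_rc !commZl !qZr q_comm_star.
lra.
Qed.

Lemma comm_f0 a b : comm (f0 a) (f0 b) = f0 (comm a b).
Proof. by rewrite /comm (shB h0) !(shM h0). Qed.

(** The averaged functional is 1/2 |[x, b]|_2^2 - 4 D r^2 |b|_4^4 minus mu times the commutator
    bound of [comm_rtrunc]. The 1/2 and the 4 D are what it costs to replace b by [rtrunc r b] in
    [x, b]; 12 is 4 times the constant 3 of the fourth moment. *)
Lemma select_step (x : vop P) (D c r mu : R) s (fs : seq (vop M)) :
  Q1 x -> 0 <= D -> obound D x -> orthonormal_seq (map snd s) ->
  0 <= c -> obound c (tsum f0 f2 s) -> 0 < r -> 0 <= mu ->
  exists2 b, obound (r ^- 2) b &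
    2^-1 * q (comm x (tsum f0 f2 s)) - 12 * D * r ^+ 2 * c ^+ 2
    - mu * (\sum_(f <- fs) 3 * (2 * q (comm (tsum f0 f2 s) (f0 f)) +
              q (comm (tsum f0 f2 s) (f0 (star f))))) <=
    q (comm x (f0 b)) - mu * \sum_(f <- fs) q (comm b f).
Proof.
move=> Qx D0 hD hs c0 hc r0 mu0; set z := tsum f0 f2 s.
pose Psi1 b := q (comm x (f0 b)).
pose Psi2 b := \sum_(f <- fs) 3 * (2 * q (comm b f) + q (comm b (star f))).
pose Psi b := 2^-1 * Psi1 b + (- mu * Psi2 b + 0).
pose c1 := - (4 * D * r ^+ 2).
pose L := 2^-1 * q (comm x z) - 12 * D * r ^+ 2 * c ^+ 2 -
  mu * (\sum_(f <- fs) 3 * (2 * q (comm z (f0 f)) + q (comm z (f0 (star f))))).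
have qc (g : vop M) : quadratic (fun b => q (comm b g)).
  apply: quadratic_comp; first exact: quadratic_q.
    by move=> u m; rewrite commD.
  by move=> u m; rewrite commB.
have quad1 : quadratic Psi1.
  apply: (quadratic_comp (g := fun b => f0 b)) (_ : quadratic (fun u => q (comm x u))) _ _.
  - apply: quadratic_comp; first exact: quadratic_q.
      by move=> u m; rewrite commDr.
    by move=> u m; rewrite commBr.
  - exact: (shD h0).
  - exact: (shB h0).
have quad2 : quadratic Psi2.
  apply: quadratic_sum => f u m.
  have := qc f u m; have := qc (star f) u m => /=; lra.
have quadP : quadratic Psi.
  by apply: quadratic_lin => //; apply: quadratic_lin => //; exact: quadratic0.
have avgPsi : sgn_avg (left_parts s) 0 Psi =
    2^-1 * q (comm x z) - mu * (\sum_(f <- fs) 3 * (2 * q (comm z (f0 f)) + q (comm z (f0 (star f))))).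
  rewrite sgn_avg_quad// quadratic_at0// add0r /Psi /left_parts big_map.
  transitivity (2^-1 * (\sum_(p <- s) Psi1 p.1) - mu * \sum_(p <- s) Psi2 p.1).
    by rewrite !mulr_sumr -sumrB; apply: eq_bigr => p _; rewrite addr0 mulNr.
  congr (_ * _ - _ * _).
    by rewrite /z (q_comm_tsum tf Qx hs).
  rewrite /Psi2 exchange_big /=; apply: eq_bigr => f _.
  rewrite -mulr_sumr big_split -mulr_sumr /=.
  have E g : q (comm z (f0 g)) = \sum_(j <- s) q (comm j.1 g).
    rewrite q_comm_sym /z (q_comm_tsum tf (Q1_f0 tf g) hs).
    by apply: eq_bigr => j _; rewrite comm_f0 (q_f0 tf) q_comm_sym.
  by rewrite !E.
have avg4 : sgn_avg (left_parts s) 0 (fun b => q (b * star b)) <= 3 * c ^+ 2.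
  by rewrite (le_trans (sgn_avg_fourth _ _))// (fourth_bound_tsum tf).
have [b hb] : exists b, 0 <= c1 * q (b * star b) + (Psi b - L).
  apply: (@sgn_avg_ge0 _ _ _ (left_parts s) 0).
  rewrite (sgn_avg_lin _ _ c1 (fun b => q (b * star b)) (fun b => Psi b - L)).
  have -> : sgn_avg (left_parts s) 0 (fun b => Psi b - L) =
      sgn_avg (left_parts s) 0 Psi - L.
    have := sgn_avg_lin (left_parts s) 0 1 Psi (fun=> - L).
    have -> : sgn_avg (left_parts s) 0 (fun=> - L) = - L.
      by elim: (left_parts s) (0 : vop M) => [|m l IH] u //=; rewrite !IH; field.
    rewrite mul1r => <-; congr sgn_avg; apply/funext => u; by rewrite mul1r.
  rewrite avgPsi /L /c1.
  have : 4 * D * r ^+ 2 * sgn_avg (left_parts s) 0 (fun b => q (b * star b)) <=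
      4 * D * r ^+ 2 * (3 * c ^+ 2).
    apply: ler_wpM2l => //; apply: mulr_ge0; last exact: sqr_ge0.
    exact: mulr_ge0.
  lra.
exists (rtrunc r b); first exact: rtrunc_obound.
rewrite -/L.
have i1 : 2^-1 * Psi1 b - 4 * D * (r ^+ 2 * q (b * star b)) <= q (comm x (f0 (rtrunc r b))).
  have e : f0 b = f0 (rtrunc r b) + f0 (b - rtrunc r b) by rewrite -(shD h0) addrC subrK.
  have := qDle (comm x (f0 (rtrunc r b))) (comm x (f0 (b - rtrunc r b))).
  rewrite -commDr -e -/(Psi1 b).
  have := q_comm_le (f0 (b - rtrunc r b)) D0 hD; rewrite (q_f0 tf).
  have : 4 * D * q (b - rtrunc r b) <= 4 * D * (r ^+ 2 * q (b * star b)).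
    by rewrite ler_wpM2l ?mulr_ge0// sub_rtrunc.
  lra.
have i2 : mu * (\sum_(f <- fs) q (comm (rtrunc r b) f)) <= mu * Psi2 b.
  by rewrite ler_wpM2l// ler_sum// => f _; apply: comm_rtrunc.
move: hb; rewrite /Psi /c1; lra.
Qed.

End Selection.

(** * Central sequences *)

Section NullSequences.
Variables (R : realType) (omega : free_ultrafilter).
Local Notation F := (fu_sets omega).

Lemma free_cofinite N : F [set n | (N <= n)%N].
Proof.
elim: N => [|N IH]; first by apply: filterS filterT.
have [FN|FN] := in_ultra_setVsetC [set N] (fu_ultra omega).
  by have := fu_free FN.
apply: filterS (filterI IH FN) => n /= [Nn nN].
by rewrite ltn_neqAle Nn andbT eq_sym; apply/eqP.
Qed.

(** One-sided: for the nonnegative sequences at hand this is convergence to 0 along omega. *)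
Definition null (u : nat -> R) := forall e, 0 < e -> F [set n | u n <= e].

Lemma nullS u v : null v -> (forall n, u n <= v n) -> null u.
Proof. by move=> nv uv e e0; apply: filterS (nv e e0) => n /=; apply: le_trans. Qed.
Lemma nullD u v : null u -> null v -> null (fun n => u n + v n).
Proof.
move=> nu nv e e0; have e2 : 0 < e / 2 by rewrite divr_gt0.
apply: filterS (filterI (nu _ e2) (nv _ e2)) => n /= [h h']; lra.
Qed.
Lemma nullZ c u : 0 <= c -> null u -> null (fun n => c * u n).
Proof.
move=> c0 nu e e0; have c1 : 0 < c + 1 by lra.
apply: filterS (nu (e / (c + 1)) (divr_gt0 e0 c1)) => n /=.
rewrite ler_pdivlMr// => h; have [u0|u0] := leP 0 (u n); first by lra.
have := mulr_ge0 c0 (ltW (_ : 0 < - u n)); rewrite oppr_gt0 u0 => /(_ isT); lra.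
Qed.
Lemma null_sum (T : Type) (s : seq T) (u : T -> nat -> R) :
  (forall t, null (u t)) -> null (fun n => \sum_(t <- s) u t n).
Proof.
move=> nu; elim: s => [|t s IH].
  by move=> e e0; apply: filterS filterT => n _ /=; rewrite big_nil ltW.
by apply: nullS (nullD (nu t) IH) _ => n; rewrite big_cons.
Qed.
Lemma null_harmonic : null (fun n => n.+1%:R^-1).
Proof.
move=> e e0; have [N hN] := harmonic_small e0.
by apply: filterS (free_cofinite N) => n /=; exact: hN.
Qed.
Lemma null_contra u e : 0 < e -> null u -> F [set n | e <= u n] -> False.
Proof.
move=> e0 nu Fe; have e2 : 0 < e / 2 by rewrite divr_gt0.
apply: (@filter_not_empty _ F _).
apply: filterS (filterI (nu _ e2) Fe) => n /= [h h']; lra.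
Qed.
(** Maximality of omega yields a lower bound on a set of omega, so that no subsequence has to be
    taken. *)
Lemma not_null u : ~ null u -> exists2 e, 0 < e & F [set n | e <= u n].
Proof.
move=> /existsNP[e /not_implyP[e0 nF]]; exists e => //.
have [//|] := in_ultra_setVsetC [set n | u n <= e] (fu_ultra omega).
by apply: filterS => n /= /negP; rewrite -ltNge => /ltW.
Qed.

End NullSequences.

Section Commutation.
Variables (R : realType) (omega : free_ultrafilter) (H0 H1 H2 K : hilbertType R).
Variables (M : tracial_vNa H0) (N1 : tracial_vNa H1) (N2 : tracial_vNa H2).
Variable P : tracial_vNa K.
Variables (f0 : vop M -> vop P) (f1 : vop N1 -> vop P) (f2 : vop N2 -> vop P).
Hypothesis tf : tensor_factors f0 f1 f2.
Local Notation F := (fu_sets omega).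
Local Notation null := (null omega).
Let h0 := tf_hom0 tf.
Local Notation Q1 := (qclos (alg2 f0 f1)).
Local Notation Q2 := (qclos (alg2 f0 f2)).

Definition centralizing (b : nat -> vop M) :=
  (exists c, forall n, obound c (b n)) /\ forall f, null (fun n => q (comm (b n) f)).

(* The selected b n serves all the indices k <= n for which a good element exists. *)
Lemma diagonal_selection (d : nat -> vop M) (c B : R) (ok : nat -> vop M -> Prop) :
  0 <= c ->
  (forall k, F [set n | exists b, [/\ obound c b, ok n b &
     \sum_(f <- map d (iota 0 k)) q (comm b f) <= B / k.+1%:R]]) ->
  exists b : nat -> vop M, [/\ forall n, obound c (b n),
    F [set n | ok n (b n)] & forall i, null (fun n => q (comm (b n) (d i)))].
Proof.
move=> c0 hF.
pose good k n b := [/\ obound c b, ok n b &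
     \sum_(f <- map d (iota 0 k)) q (comm b f) <= B / k.+1%:R].
have /choice[b hb] n : exists b, obound c b /\ forall k, (k <= n)%N ->
    (exists b', good k n b') -> good k n b.
  suff step m : exists b, obound c b /\ forall k, (k <= m)%N ->
    (exists b', good k n b') -> good k n b by exact: step.
  elim: m => [|m [b [b1 b2]]].
    have [[b hb]|nb] := pselect (exists b', good 0%N n b').
      by exists b; split=> [|k]; [case: hb|rewrite leqn0 => /eqP -> _].
    exists 0; split=> [v|k]; first by rewrite vzeroE nsq0 mulr_ge0// nsq_ge0.
    by rewrite leqn0 => /eqP ->.
  have [[b' hb']|nb] := pselect (exists b', good m.+1 n b'); last first.
    exists b; split=> // k; rewrite leq_eqVlt => /orP[/eqP -> //|]; exact: b2.
  (* Being good for m + 1 is at least as strong as for any smaller k: the sum has more terms and the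
     bound B / (m + 2) is smaller. *)
  exists b'; have [p1 p2 p3] := hb'; split=> // k km [b'' [_ _ hk]]; split=> //.
  have B0 : 0 <= B.
    have : 0 <= B / k.+1%:R.
      by apply: le_trans hk; apply: sumr_ge0 => f _; exact: q_ge0.
    by rewrite pmulr_lge0// invr_gt0.
  apply: (@le_trans _ _ (B / m.+2%:R)).
    apply: le_trans p3; rewrite -(subnKC km) iotaD map_cat big_cat /= lerDl.
    by apply: sumr_ge0 => f _; exact: q_ge0.
  by rewrite ler_wpM2l// lef_pV2 ?posrE// ler_nat.
exists b; split=> [n||i]; first by case: (hb n).
  apply: filterS (hF 0%N) => n /= h; have [_ /(_ 0%N (leq0n n) h)[]] := hb n.
  by [].
move=> e e0.
have [k ik Bk] : exists2 k, (i < k)%N & B / k.+1%:R <= e.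
  exists (i.+1 + Num.bound (`|B| / e))%N; first by rewrite leq_addr.
  have p0 : 0 <= `|B| / e by rewrite divr_ge0// ltW.
  rewrite ler_pdivrMr// mulrC -ler_pdivrMr//.
  apply: (le_trans _ (le_trans (ltW (archi_boundP p0)) _)).
    by rewrite ler_pM2r ?invr_gt0// ler_norm.
  by rewrite ler_nat (leq_trans (leq_addl _ _) (leqnSn _)).
apply: filterS (filterI (hF k) (free_cofinite omega k)) => n /= [h kn].
have [_ /(_ k kn h)[_ _ h3]] := hb n.
apply: le_trans Bk; apply: le_trans h3; rewrite big_map.
rewrite (bigD1_seq i) ?mem_iota ?iota_uniq//= lerDl.
by apply: sumr_ge0 => j _; exact: q_ge0.
Qed.

(** Of x only a bound, membership in the closure and commutation with centralizing sequences are
    asked; hence it may also be replaced by the image of a centralizing sequence of M. *)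
Lemma comm_centralizing_tensor (x y : nat -> vop P) (D c : R) (d : nat -> vop M) :
  (forall f e, 0 < e -> exists k, q (f - d k) <= e) ->
  0 < D -> 0 < c ->
  (forall n, Q1 (x n)) -> (forall n, obound D (x n)) ->
  (forall n, Q2 (y n)) -> (forall n, obound c (y n)) ->
  (forall f, null (fun n => q (comm (y n) (f0 f)))) ->
  (forall b, centralizing b -> null (fun n => q (comm (x n) (f0 (b n))))) ->
  null (fun n => q (comm (x n) (y n))).
Proof.
move=> dense D0 c0 Qx hD Qy hc cy hx; apply: contrapT => /not_null[e e0 Fe].
pose C := 64 * c; have C0 : 0 < C by rewrite mulr_gt0.
have alg := alg2_star h0 (tf_hom2 tf) (tf_comm02 tf).
(* With b summed over signs, [select_step] produces b n at distance e / 32 from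
   commuting with x n although (b n)_n centralizes M, against the assumption. *)
have /choice[z hz] n : exists z, [/\ alg2 f0 f2 z, obound C z &
    q (z - y n) <= Num.min (e / (16 * D)) n.+1%:R^-1].
  apply: (qclos_bounded alg (Qy n) c0 (hc n)).
  by rewrite lt_min invr_gt0 ltr0n andbT divr_gt0// mulr_gt0.
have /choice[s hs] n : exists s, orthonormal_seq (map snd s) /\ z n = tsum f0 f2 s.
  have [[s ->] _ _] := hz n.
  by have [s' [on ->]] := gram_schmidt h0 (tf_hom2 tf) s; exists s'.
(* The bound e / (16 D) preserves a definite commutator with x n; the bound 1 / (n + 1) makes z
   asymptotically commute with M, as y does. *)
have zy n : q (z n - y n) <= e / (16 * D).
  by have [_ _] := hz n; rewrite le_min => /andP[].
have zy_null : null (fun n => q (z n - y n)).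
  apply: nullS (null_harmonic omega) _ => n.
  by have [_ _] := hz n; rewrite le_min => /andP[].
have cz f : null (fun n => q (comm (z n) (f0 f))).
  have [c' c'0 hf] := obound_ex (f0 f).
  have c8 : 0 <= 8 * c' by lra.
  have := nullD (nullZ c8 zy_null) (nullZ (ler0n R 2) (cy f)).
  move/nullS; apply => n; have := qDle (comm (z n - y n) (f0 f)) (comm (y n) (f0 f)).
  rewrite -commD subrK; have := q_comm_le (z n - y n) (ltW c'0) hf.
  rewrite (q_comm_sym (f0 f)); lra.
have xz n : e <= q (comm (x n) (y n)) -> e / 4 <= q (comm (x n) (z n)).
  move=> h; have := qDle (comm (x n) (z n)) (comm (x n) (y n - z n)).
  rewrite -commDr addrC subrK.
  have := q_comm_le (y n - z n) (ltW D0) (hD n); rewrite (qC (y n)).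
  have : 4 * D * q (z n - y n) <= e / 4.
    have := zy n; rewrite ler_pdivlMr ?mulr_gt0//; lra.
  lra.
(* Half of q (comm (x n) (z n)) is at least e / 8. The truncation costs e / 32 by this choice of r
   and the penalty at most e / 32, so that e / 16 is left. *)
pose r := Num.sqrt (e / (384 * D * C ^+ 2)).
have DC : 0 < 384 * D * C ^+ 2 by rewrite !mulr_gt0// exprn_gt0.
have r0 : 0 < r by rewrite sqrtr_gt0 divr_gt0.
have r2 : 12 * D * r ^+ 2 * C ^+ 2 = e / 32.
  rewrite sqr_sqrtr; last by rewrite divr_ge0// ltW.
  by field; rewrite !gt_eqF.
pose B := 4 * D * r ^- 2.
have rm : 0 <= r ^- 2 by rewrite invr_ge0 sqr_ge0.
have sel k : F [set n | exists b, [/\ obound (r ^- 2) b,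
    e / 32 <= q (comm (x n) (f0 b)) &
    \sum_(f <- map d (iota 0 k)) q (comm b f) <= B / k.+1%:R]].
  (* The value left over is positive, so mu times the sum of commutators is at most q (comm (x n)
     (f0 b)) <= B. The weight k + 1 turns this uniform bound into B / (k + 1). *)
  pose mu : R := k.+1%:R.
  have mu0 : 0 < mu by rewrite ltr0n.
  pose S n := \sum_(f <- map d (iota 0 k)) 3 * (2 * q (comm (z n) (f0 f)) +
              q (comm (z n) (f0 (star f)))).
  have nS : null S.
    apply: null_sum => f; apply: nullZ => //; apply: nullD; last exact: cz.
    by apply: nullZ => //; exact: cz.
  have eS : 0 < e / 32 / mu by rewrite !divr_gt0.
  apply: filterS (filterI Fe (nS _ eS)) => n /= [ne nSn].
  have [hs1 hs2] := hs n; have [_ Cz _] := hz n; rewrite hs2 in Cz.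
  have [b hb1 hb2] := select_step tf (map d (iota 0 k)) (Qx n) (ltW D0) (hD n)
    hs1 (ltW C0) Cz r0 (ltW mu0).
  rewrite -hs2 -/(S n) r2 in hb2.
  have muS : mu * S n <= e / 32 by rewrite mulrC -ler_pdivlMr.
  have := xz n ne => xzn.
  have q1 : q (comm (x n) (f0 b)) <= B.
    have := q_comm_le (f0 b) (ltW D0) (hD n); rewrite (q_f0 tf).
    have := q_mull 1 rm hb1; rewrite mulr1 q1 mulr1 => qb h.
    by apply: (le_trans h); rewrite /B ler_wpM2l// mulr_ge0// ltW.
  have s0 : 0 <= mu * \sum_(f <- map d (iota 0 k)) q (comm b f).
    by rewrite mulr_ge0 ?(ltW mu0)// sumr_ge0// => f _; exact: q_ge0.
  exists b; split=> //; first by lra.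
  by rewrite ler_pdivlMr// mulrC; lra.
have [b [b1 b2 b3]] := diagonal_selection
  (ok := fun n b => e / 32 <= q (comm (x n) (f0 b))) rm sel.
have cb : centralizing b.
  split=> [|f]; first by exists (r ^- 2).
  move=> a a0.
  have p0 : 0 < a / 4 / (4 * r ^- 2 + 1).
    by rewrite !divr_gt0// ltr_wpDl// mulr_ge0.
  have [k hk] := dense f _ p0.
  have a4 : 0 < a / 4 by rewrite divr_gt0.
  apply: filterS (b3 k _ a4) => n /= hn.
  have := qDle (comm (b n) (d k)) (comm (b n) (f - d k)).
  rewrite -commDr addrC subrK.
  have := q_comm_le (f - d k) rm (b1 n).
  rewrite ler_pdivlMr in hk; last by lra.
  have := q_ge0 (f - d k); lra.
apply: (null_contra _ (hx b cb) b2); lra.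
Qed.

End Commutation.

(** * Operators on a tensor product *)

(** Young's inequality |u|^2 <= (1 + th) |v|^2 + (1 + 1 / th) |u - v|^2 with th close to 0, used for
    w and for z'. The cruder factor 2 of [nsqDle] would spoil the constant c. *)
Lemma nsq_limit_le (R : realType) (H K : hilbertType R) (w : H) (z : K) (c : R) :
  0 <= c ->
  (forall e, 0 < e -> exists w' z', [/\ nsq (w - w') <= e, nsq (z - z') <= e &
    nsq w' <= c * nsq z']) -> nsq w <= c * nsq z.
Proof.
move=> c0 h; have young (L : hilbertType R) (u v : L) th : 0 < th ->
    nsq u <= (1 + th) * nsq v + (1 + th^-1) * nsq (u - v).
  move=> th0; have th1 : th * th^-1 = 1 by rewrite divff ?gt_eqF.
  have i := nsq_ge0 (rc th *: v - (u - v)).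
  rewrite (nsqB (rc th *: v)) nsqZr rdotZl in i.
  have : nsq u = nsq v + 2 * rdot v (u - v) + nsq (u - v) by rewrite -nsqD addrC subrK.
  have : 0 <= th^-1 by rewrite invr_ge0 ltW.
  move: i th1; move: (th^-1) (nsq v) (nsq (u - v)) (rdot _ _) => th' a b r i th1 t'0 ->.
  have := mulr_ge0 t'0 i.
  have -> : th' * (th ^+ 2 * a - 2 * (th * r) + b) =
    (th * th') * (th * a) - 2 * (th * th') * r + th' * b by ring.
  by rewrite th1; lra.
apply/ler_addgt0Pr => d d0; set Z := nsq z; have Z0 : 0 <= Z := nsq_ge0 z.
have cZ : 0 <= c * Z by rewrite mulr_ge0.
(* For th <= 1, (1 + th)^2 <= 1 + 3 th; this choice makes 3 th c Z at most d / 2. *)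
pose th := Num.min 1 (d / 2 / (3 * (c * Z) + 1)).
have p1 : 0 < 3 * (c * Z) + 1 by lra.
have th0 : 0 < th by rewrite lt_min ltr01 !divr_gt0.
have th1 : th <= 1 by rewrite ge_min lexx.
have thZ : 3 * th * (c * Z) <= d / 2.
  have : th <= d / 2 / (3 * (c * Z) + 1) by rewrite ge_min lexx orbT.
  by rewrite ler_pdivlMr//; lra.
have t'0 : 0 <= th^-1 by rewrite invr_ge0 ltW.
have p2 : 0 < 1 + 2 * c by lra.
have t1 : 0 < 1 + th^-1 by lra.
pose X := d / 2 / (1 + 2 * c).
have X0 : 0 < X by rewrite !divr_gt0.
have XE : X + 2 * (c * X) = d / 2.
  by rewrite /X; field; rewrite gt_eqF.
have [w' [z' [hw hz hwz]]] := h (X / (1 + th^-1)) (divr_gt0 X0 t1).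
rewrite ler_pdivlMr// mulrC in hw; rewrite ler_pdivlMr// mulrC in hz.
have i1 := young _ w w' th th0; have i2 := young _ z' z th th0.
have zz : nsq (z' - z) = nsq (z - z') by rewrite -nsqN opprB.
rewrite zz -/Z in i2.
have i3 : (1 + th) * nsq w' <= (1 + th) * (c * ((1 + th) * Z + X)).
  apply: ler_wpM2l; first lra.
  by apply: le_trans hwz _; apply: ler_wpM2l => //; lra.
have i4 : th * (th * (c * Z)) <= th * (c * Z).
  by rewrite ler_piMl// mulr_ge0// ltW.
have i5 : (1 + th) * (c * X) <= 2 * (c * X).
  have cX : 0 <= c * X by rewrite mulr_ge0// ltW.
  by rewrite ler_wpM2r//; lra.
lra.
Qed.

(** * Extending m (x) 1 (x) 1 from algebraic tensors *)

Section TensorExtension.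
Variables (R : realType) (H0 H1 H2 K : hilbertType R) (t : H0 -> H1 -> H2 -> K).
Hypothesis tt : is_hilbert_tensor t.
Implicit Types (s : seq (H0 * H1 * H2)).

(** A list represents an algebraic tensor and operators act on lists; independence of the list
    follows from [elem_bound] applied to differences. *)
Definition elem s : K := \sum_(p <- s) t p.1.1 p.1.2 p.2.

Lemma elem_cons p s : elem (p :: s) = t p.1.1 p.1.2 p.2 + elem s.
Proof. exact: big_cons. Qed.
Lemma elem_cat s s' : elem (s ++ s') = elem s + elem s'.
Proof. exact: big_cat. Qed.

Lemma elem_dense z e : 0 < e -> exists s, nsq (z - elem s) <= e.
Proof.
move=> e0; have : closure [set z | exists n (u : 'I_n -> H0) (v : 'I_n -> H1)
    (w : 'I_n -> H2), z = \sum_(i < n) t (u i) (v i) (w i)] z.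
  by rewrite (tensor_dense tt).
have se : 0 < Num.sqrt e by rewrite sqrtr_gt0.
have rse : 0 < rc (Num.sqrt e) by rewrite -rc0 ltr_rc.
move/(_ _ (nbhsx_ballx z _ rse)) => [_ [[n [u [v [w ->]]]]]].
rewrite -ball_normE /= => h.
exists [seq (u i, v i, w i) | i <- enum 'I_n].
rewrite /elem big_map big_enum /=.
rewrite -ler_rc -nsq_norm -(sqr_sqrtr (ltW e0)) rcX ler_pXn2r ?nnegrE//.
  exact: ltW.
exact: ltW.
Qed.

Definition amap (m : H0 -> H0) s := [seq (m p.1.1, p.1.2, p.2) | p <- s].

Lemma nsq_t u v w : nsq (t u v w) = nsq u * nsq v * nsq w.
Proof.
by rewrite {1}/nsq /rdot (tensor_dot tt) !hdot_nsq -!rcM.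
Qed.

Lemma tZ c u v w : t (c *: u) v w = c *: t u v w.
Proof.
have t0 : t 0 v w = 0.
  by apply: (addrI (t 0 v w)); rewrite addr0 -{1}[t 0 v w]scale1r -(tensor_linear0 tt) scale1r addr0.
by rewrite -[c *: u]addr0 (tensor_linear0 tt) t0 addr0.
Qed.
Lemma elemZ c s : c *: elem s = elem (amap (fun u => c *: u) s).
Proof.
by rewrite /elem big_map scaler_sumr; apply: eq_bigr => p _; rewrite tZ.
Qed.

Lemma elem_ext (x y : K) :
  (forall u v w, rdot x (t u v w) = rdot y (t u v w)) -> x = y.
Proof.
move=> h; apply/eqP; rewrite -subr_eq0; apply/eqP; apply: nsq_eq0; apply/eqP.
rewrite eq_le nsq_ge0 andbT; apply/ler_addgt0Pr => e e0; rewrite add0r.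
have [s hs] := elem_dense (x - y) e0.
have o : rdot (x - y) (elem s) = 0.
  rewrite /elem; elim: s {hs} => [|p s IH]; first by rewrite big_nil rdot0r.
  by rewrite big_cons rdotDr IH addr0 rdotDl rdotNl h subrr.
rewrite nsqB o in hs; have := nsq_ge0 (elem s); lra.
Qed.

Lemma bounded_ext (f g : K -> K) : bounded_operators f -> bounded_operators g ->
  (forall u v w, f (t u v w) = g (t u v w)) -> f = g.
Proof.
move=> hf hg fg; have hfg := boundedB hf hg.
have [c c0 hc] := bounded_operators_ex hfg.
apply/funext => z; apply/eqP; rewrite -subr_eq0; apply/eqP.
apply: nsq_eq0; apply/eqP; rewrite eq_le nsq_ge0 andbT.
apply/ler_addgt0Pr => e e0; rewrite add0r.
have c1 : 0 < c + 1 by lra.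
have [s hs] := elem_dense z (divr_gt0 e0 c1).
have D u v : (f - g) (u + v) = (f - g) u + (f - g) v.
  by have [lfg _] := hfg; rewrite -[u in LHS]scale1r lfg scale1r.
have z0 : (f - g) 0 = 0 by apply: (addrI ((f - g) 0)); rewrite -D !addr0.
have s0 : (f - g) (elem s) = 0.
  rewrite /elem; elim: (s) => [|p s' IH]; first by rewrite big_nil.
  by rewrite big_cons D IH addr0 /= fctE fg subrr.
have := hc (z - elem s); rewrite (bounded_opB _ _ hfg) s0 subr0 => h.
rewrite (le_trans h)//; rewrite ler_pdivlMr// in hs.
by have := nsq_ge0 (z - elem s); lra.
Qed.

Section Operator.
Variable M : tracial_vNa H0.
Implicit Types a b m : vop M.

Lemma amap_comp a b s : amap (a * b) s = amap a (amap b s).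
Proof. by rewrite /amap -map_comp. Qed.

Lemma rdot_amap a s s' :
  rdot (elem (amap a s)) (elem s') = rdot (elem s) (elem (amap (star a) s')).
Proof.
have suml (I : Type) (r : seq I) (F : I -> K) y :
    rdot (\sum_(i <- r) F i) y = \sum_(i <- r) rdot (F i) y.
  elim: r => [|i r IH]; first by rewrite !big_nil rdot0l.
  by rewrite !big_cons rdotDl IH.
rewrite /elem !big_map !suml; apply: eq_bigr => p _.
rewrite rdotC suml [RHS]rdotC suml; apply: eq_bigr => p' _.
by rewrite rdotC [RHS]rdotC /rdot !(tensor_dot tt) hdot_star.
Qed.

(** B depends on the list but not on m, so it serves all powers of m^* m at once, as [power_growth]
    requires. *)
Lemma elem_crude (c : R) s : exists2 B, 0 <= B & forall m d, 0 <= d -> obound d m ->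
  nsq (elem (amap m s)) <= B * d.
Proof.
elim: s => [|p s [B B0 IH]].
  by exists 0 => // m d _ _; rewrite /elem big_nil nsq0 mul0r.
have b0 : 0 <= nsq p.1.1 * nsq p.1.2 * nsq p.2 by rewrite !mulr_ge0// nsq_ge0.
exists (2 * (nsq p.1.1 * nsq p.1.2 * nsq p.2) + 2 * B); first by lra.
move=> m d d0 hm; rewrite elem_cons (le_trans (nsqDle _ _))//=.
have := IH m d d0 hm; rewrite nsq_t.
have : nsq (m p.1.1) * nsq p.1.2 * nsq p.2 <= d * nsq p.1.1 * nsq p.1.2 * nsq p.2.
  by rewrite !ler_wpM2r ?nsq_ge0.
lra.
Qed.

(* The log-convexity argument of [q_mull], with the crude bound [elem_crude]. *)
Lemma elem_bound_gt0 m (c : R) s : 0 < c -> obound c m ->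
  nsq (elem (amap m s)) <= c * nsq (elem s).
Proof.
move=> c0 hm; pose S := star m * m.
have Ss : star S = S by rewrite starM starK.
have [B B0 hB] := elem_crude 1 s.
have cc : 0 <= c * c by rewrite mulr_ge0// ltW.
have hS : obound (c * c) S.
  by apply: oboundM => //; [exact: ltW|apply: obound_star => //; exact: ltW].
have id_s : amap (1 : vop M) s = s.
  by rewrite /amap -[RHS]map_id; apply: eq_map => -[[]].
have N1 : nsq (elem (amap (S ^+ 1) s)) <= c * c * nsq (elem (amap (S ^+ 0) s)).
  apply: (@power_growth _ (fun k => nsq (elem (amap (S ^+ k) s))) B) => //.
  - by move=> k; exact: nsq_ge0.
  - move=> k r r0.
    have := nsq_ge0 (elem (amap (S ^+ k.+2) s) - rc r *: elem (amap (S ^+ k) s)).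
    rewrite nsqB nsqZr rdotZr.
    have -> : rdot (elem (amap (S ^+ k.+2) s)) (elem (amap (S ^+ k) s)) =
        nsq (elem (amap (S ^+ k.+1) s)).
      by rewrite exprS amap_comp rdot_amap Ss -amap_comp -exprS.
    lra.
  - by move=> k; apply: hB; [exact: exprn_ge0|exact: oboundX].
rewrite expr1 expr0 id_s in N1.
have e : nsq (elem (amap m s)) = rdot (elem (amap S s)) (elem s).
  by rewrite /S amap_comp rdot_amap starK.
have := rdot_amgm (elem (amap S s)) (rc c *: elem s).
rewrite rdotZr nsqZr -e => h.
by rewrite -(ler_pM2l c0); nra.
Qed.

Lemma elem_bound m (c : R) s : 0 <= c -> obound c m ->
  nsq (elem (amap m s)) <= c * nsq (elem s).
Proof.
move=> c0 hm; apply/ler_addgt0Pr => e e0; set N := nsq (elem s).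
have N0 : 0 <= N := nsq_ge0 _; have N1 : 0 < N + 1 by lra.
have d0 : 0 < e / (N + 1) by rewrite divr_gt0.
have cd : 0 < c + e / (N + 1) by lra.
apply: le_trans (elem_bound_gt0 s cd (oboundW _ hm)) _; first lra.
rewrite mulrDl lerD2l -/N mulrAC ler_pdivrMr//; nra.
Qed.

Definition elem_sub s s' := s ++ amap (fun u => (-1 : Cplx R) *: u) s'.

Lemma elem_subE s s' : elem (elem_sub s s') = elem s - elem s'.
Proof. by rewrite elem_cat -elemZ scaleN1r. Qed.
Lemma amapZ m (c : Cplx R) s :
  amap m (amap (fun u => c *: u) s) = amap (fun u => c *: u) (amap m s).
Proof. by rewrite /amap -!map_comp; apply: eq_map => p /=; rewrite vopZ. Qed.
Lemma amap_cat (m : H0 -> H0) s s' : amap m (s ++ s') = amap m s ++ amap m s'.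
Proof. exact: map_cat. Qed.
Lemma amap_subE m s s' :
  elem (amap m (elem_sub s s')) = elem (amap m s) - elem (amap m s').
Proof. by rewrite /elem_sub amap_cat amapZ -elem_subE. Qed.

(** The closure of the graph of m (x) 1 (x) 1 on algebraic tensors. *)
Definition ext m z w := forall e : R, 0 < e ->
  exists s, nsq (z - elem s) <= e /\ nsq (w - elem (amap m s)) <= e.

Lemma ext_ex m z : exists w, ext m z w.
Proof.
have [c c0 hm] := obound_ex m.
have /choice[s hs] n : exists s, nsq (z - elem s) <= n.+1%:R^-1.
  by apply: elem_dense; rewrite invr_gt0.
have [|w hw] := @nsq_complete _ _ (fun n => elem (amap m (s n))).
  move=> e e0; have [N hN] := harmonic_small (e := e / (4 * c)) (divr_gt0 e0 (mulr_gt0 (ltr0Sn _ 3) c0)).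
  exists N => k l Nk Nl; rewrite -amap_subE (le_trans (elem_bound _ (ltW c0) hm))//.
  rewrite elem_subE.
  have := nsqBle (z - elem (s l)) (z - elem (s k)).
  rewrite opprB addrC addrA subrK => h.
  have := le_trans (hs k) (hN k Nk); have := le_trans (hs l) (hN l Nl).
  rewrite !(ler_pdivlMr _ _ (mulr_gt0 (ltr0Sn R 3) c0)) => h1 h2.
  have := ler_wpM2l (ltW c0) h; have := ler_wpM2l (ltW c0) h1.
  have := ler_wpM2l (ltW c0) h2; lra.
exists w => e e0; have [N hN] := harmonic_small e0; have [N' hN'] := hw e e0.
exists (s (maxn N N')); split.
  by rewrite (le_trans (hs _))// hN// leq_maxl.
by rewrite -nsqN opprB hN'// leq_maxr.
Qed.

Lemma ext_bound m c z w : 0 <= c -> obound c m -> ext m z w -> nsq w <= c * nsq z.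
Proof.
move=> c0 hm h; apply: nsq_limit_le => // e /h[s [h1 h2]].
by exists (elem (amap m s)), (elem s); split=> //; exact: elem_bound.
Qed.

Lemma ext_lin m c z w z' w' : ext m z w -> ext m z' w' ->
  ext m (c *: z + z') (c *: w + w').
Proof.
move=> h h' e e0; set r := cre c ^+ 2 + cim c ^+ 2.
have r0 : 0 <= r by rewrite addr_ge0// sqr_ge0.
have r1 : 0 < r + 1 by lra.
have [s [s1 s2]] := h _ (divr_gt0 (divr_gt0 e0 (ltr0Sn _ 3)) r1).
have [s' [s1' s2']] := h' _ (divr_gt0 e0 (ltr0Sn _ 3)).
exists (amap (fun u => c *: u) s ++ s').
rewrite amap_cat amapZ !elem_cat -!elemZ.
have key (u u' v v' : K) : nsq (u - v) <= e / 4 / (r + 1) -> nsq (u' - v') <= e / 4 ->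
    nsq (c *: u + u' - (c *: v + v')) <= e.
  move=> k1 k2; rewrite opprD addrACA -scalerBr.
  have := nsqDle (c *: (u - v)) (u' - v'); rewrite nsqZ -/r.
  rewrite ler_pdivlMr// in k1; have := nsq_ge0 (u - v); lra.
by split; apply: key.
Qed.

Lemma ext_elem m s : ext m (elem s) (elem (amap m s)).
Proof. by move=> e e0; exists s; rewrite !subrr !nsq0 ltW. Qed.

Lemma ext_uniq m z w w' : ext m z w -> ext m z w' -> w = w'.
Proof.
move=> h h'; have [c c0 hm] := obound_ex m.
have := ext_bound (ltW c0) hm (ext_lin (-1) h h').
rewrite !scaleN1r addNr nsq0 mulr0 => h0.
have /eqP : - w + w' = 0.
  by apply: nsq_eq0; apply/eqP; rewrite eq_le nsq_ge0 andbT.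
by rewrite addrC subr_eq0 => /eqP.
Qed.

Lemma tensor_op_ex m : exists T : K -> K, [/\ bounded_operators T,
  forall u v w, T (t u v w) = t (m u) v w &
  forall c, 0 <= c -> obound c m -> forall z, nsq (T z) <= c * nsq z].
Proof.
have /choice[T hT] := ext_ex m.
have Tb c : 0 <= c -> obound c m -> forall z, nsq (T z) <= c * nsq z.
  by move=> c0 hm z; apply: ext_bound (hT z).
have [c c0 hm] := obound_ex m.
exists T; split=> // [|u v w].
  apply: (@bounded_operators_nsq _ _ _ c) => [d u v|]; last exact: Tb (ltW c0) hm.
  by apply: ext_uniq (hT _) _; apply: ext_lin.
have := ext_elem m [:: (u, v, w)]; rewrite /elem /= !big_seq1 /=.
exact: ext_uniq (hT _).
Qed.

End Operator.

End TensorExtension.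

Section Permutation.
Variables (R : realType) (H0 H1 H2 K : hilbertType R) (t : H0 -> H1 -> H2 -> K).
Hypothesis tt : is_hilbert_tensor t.

(** Permuting the factors lets [factor_ex], stated for the first one, serve all three. *)
Lemma hilbert_tensor_swap01 : is_hilbert_tensor (fun v u w => t u v w).
Proof.
split.
- by move=> u w; exact: (tensor_linear1 tt).
- by move=> v w; exact: (tensor_linear0 tt).
- by move=> v u; exact: (tensor_linear2 tt).
- by move=> v u w v' u' w'; rewrite (tensor_dot tt) (mulrC (hdot H1 _ _)).
- rewrite -(tensor_dense tt); congr closure; apply/seteqP.
  by split=> z [n [u [v [w ->]]]]; exists n, v, u, w.
Qed.

Lemma hilbert_tensor_swap02 : is_hilbert_tensor (fun w v u => t u v w).
Proof.
split.
- by move=> v u; exact: (tensor_linear2 tt).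
- by move=> w u; exact: (tensor_linear1 tt).
- by move=> w v; exact: (tensor_linear0 tt).
- by move=> w v u w' v' u'; rewrite (tensor_dot tt) mulrC mulrA mulrAC.
- rewrite -(tensor_dense tt); congr closure; apply/seteqP.
  by split=> z [n [u [v [w ->]]]]; exists n, w, v, u.
Qed.

End Permutation.

Section OneFactor.
Variables (R : realType) (H0 H1 H2 K : hilbertType R) (t : H0 -> H1 -> H2 -> K).
Hypothesis tt : is_hilbert_tensor t.
Variables (M : tracial_vNa H0) (P : tracial_vNa K).

Lemma vop_elem_ext (a b : vop P) :
  (forall u v w, a (t u v w) = b (t u v w)) -> a = b.
Proof.
move=> h; have e := bounded_ext tt (vNa_bounded (vnaP P) (vfunP a))
  (vNa_bounded (vnaP P) (vfunP b)) h.
by apply: vop_ext => v; rewrite e.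
Qed.

Lemma factor_star_hom (f : vop M -> vop P) :
  (forall m u v w, f m (t u v w) = t (m u) v w) ->
  (forall c m, 0 <= c -> obound c m -> obound c (f m)) -> star_hom f.
Proof.
move=> hf hb; split=> //.
- move=> c a b; apply: vop_elem_ext => u v w.
  by rewrite vaddE vscaleE !hf vaddE vscaleE (tensor_linear0 tt).
- by move=> a b; apply: vop_elem_ext => u v w; rewrite vmulE !hf.
- by apply: vop_elem_ext => u v w; rewrite hf.
- move=> m; apply/esym; apply: vop_elem_ext => u v w; rewrite hf.
  apply: (elem_ext tt) => u' v' w'; rewrite -rdot_starr hf /rdot !(tensor_dot tt).
  by rewrite -[m in LHS]starK -hdot_star.
Qed.

Lemma factor_ex :
  (forall (m : vop M) T, bounded_operators T -> (forall u v w, T (t u v w) = t (m u) v w) ->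
     vna P T) ->
  exists2 f : vop M -> vop P, star_hom f &
    forall m u v w, f m (t u v w) = t (m u) v w.
Proof.
move=> hP.
have /choice[f hf] (m : vop M) : exists f : vop P,
    (forall u v w, f (t u v w) = t (m u) v w) /\
    forall c, 0 <= c -> obound c m -> obound c f.
  have [T [Tb Tt Tc]] := tensor_op_ex tt m.
  by exists (Vop (hP m T Tb Tt)).
have ft m u v w : f m (t u v w) = t (m u) v w by have [] := hf m.
exists f => //; apply: factor_star_hom => // c m c0 hm.
by have [_] := hf m; apply.
Qed.

End OneFactor.

Section Factors.
Variables (R : realType) (H0 H1 H2 K : hilbertType R) (t : H0 -> H1 -> H2 -> K).
Hypothesis tt : is_hilbert_tensor t.
Variables (M : tracial_vNa H0) (N1 : tracial_vNa H1) (N2 : tracial_vNa H2).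
Variable P : tracial_vNa K.
Hypothesis tp : is_tracial_tensor t M N1 N2 P.

Lemma vna_tensor_op x0 x1 x2 T : vna M x0 -> vna N1 x1 -> vna N2 x2 ->
  is_tensor_op t x0 x1 x2 T -> vna P T.
Proof.
move=> m0 m1 m2 hT; rewrite tp.1; split; first exact: hT.1.
move=> g [_ hg]; apply/esym; apply: hg; left; exists x0, x1, x2.
by split.
Qed.

Lemma tensor_factors_ex : exists (f0 : vop M -> vop P) (f1 : vop N1 -> vop P)
    (f2 : vop N2 -> vop P),
  [/\ tensor_factors f0 f1 f2,
      forall m u v w, f0 m (t u v w) = t (m u) v w,
      forall m u v w, f1 m (t u v w) = t u (m v) w &
      forall m u v w, f2 m (t u v w) = t u v (m w)].
Proof.
have [f0 s0 h0] : exists2 f : vop M -> vop P, star_hom f &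
    forall m u v w, f m (t u v w) = t (m u) v w.
  apply: (factor_ex tt) => // m T bT hT.
  by apply: (vna_tensor_op (vfunP m) (vna_id N1) (vna_id N2)); split.
have [f1 s1 h1] : exists2 f : vop N1 -> vop P, star_hom f &
    forall m v u w, f m (t u v w) = t u (m v) w.
  apply: (factor_ex (hilbert_tensor_swap01 tt)) => // m T bT hT.
  by apply: (vna_tensor_op (vna_id M) (vfunP m) (vna_id N2)); split.
have [f2 s2 h2] : exists2 f : vop N2 -> vop P, star_hom f &
    forall m w v u, f m (t u v w) = t u v (m w).
  apply: (factor_ex (hilbert_tensor_swap02 tt)) => // m T bT hT.
  by apply: (vna_tensor_op (vna_id M) (vna_id N1) (vfunP m)); split.
exists f0, f1, f2; split=> //; split=> //.
- by move=> a b; apply: (vop_elem_ext tt) => u v w; rewrite !vmulE h0 h1 h1 h0.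
- by move=> a b; apply: (vop_elem_ext tt) => u v w; rewrite !vmulE h0 h2 h2 h0.
- by move=> a b; apply: (vop_elem_ext tt) => u v w; rewrite !vmulE h1 h2 h2 h1.
- move=> a b c; apply: tp.2; [exact: vfunP|exact: vfunP|exact: vfunP|].
  split=> [|u v w]; first exact: (vNa_bounded (vnaP P) (vfunP _)).
  by rewrite !vmulE h2 h1 h0.
Qed.

Variables (f0 : vop M -> vop P) (f1 : vop N1 -> vop P) (f2 : vop N2 -> vop P).
Hypothesis tf : tensor_factors f0 f1 f2.
Hypothesis h0 : forall m u v w, f0 m (t u v w) = t (m u) v w.
Hypothesis h1 : forall m u v w, f1 m (t u v w) = t u (m v) w.
Hypothesis h2 : forall m u v w, f2 m (t u v w) = t u v (m w).

Lemma tensor_opE (a : vop M) (b : vop N1) (c : vop N2) T :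
  is_tensor_op t a b c T -> T = f0 a * f1 b * f2 c :> (K -> K).
Proof.
move=> [bT hT]; apply: (bounded_ext tt bT) => [|u v w].
  exact: (vNa_bounded (vnaP P) (vfunP _)).
by rewrite hT !vmulE h2 h1 h0.
Qed.

(** An operator commuting with A commutes with S and with the adjoints of its elements, hence with
    x: this is the hypothesis of [bicommutant_dense]. *)
Lemma qclos_vNa_generated (S : set (K -> K)) (A : set (vop P)) (x : vop P) :
  star_subalgebra A -> (forall T, S T -> exists2 a : vop P, A a & T = a :> (K -> K)) ->
  vNa_generated S x -> qclos A x.
Proof.
move=> algA hS [_ hx] e e0; apply: bicommutant_dense => // g bg hg v.
have /(_ _)/(congr1 (@^~ v)) /= -> // := hx g.
split=> // T [/hS[a Aa ->]|[f /hS[a Aa ->] fT]].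
  by apply/funext => u; exact: hg.
have -> : T = star a :> (K -> K) by rewrite /star /= (adjE fT).
by apply/funext => u; apply: hg; apply: (ssa_star algA).
Qed.

Lemma scalarE (H : hilbertType R) (N : tracial_vNa H) (f : H -> H) : scalar_operators f ->
  exists c, f = c *: (1 : vop N) :> (H -> H).
Proof. by move=> [c ->]; exists c. Qed.

Lemma qclos_left x : vNa_tensor t (vna M) (vna N1) (@scalar_operators R H2) (vfun x) ->
  qclos (alg2 f0 f1) x.
Proof.
apply: qclos_vNa_generated; first exact: (alg2_star (tf_hom0 tf) (tf_hom1 tf) (tf_comm01 tf)).
move=> T [x0 [x1 [x2 [m0 m1 /(scalarE N2)[c ->] hT]]]].
have := @tensor_opE (Vop m0) (Vop m1) (c *: 1) T hT.
rewrite (shZ (tf_hom2 tf)) (sh1 (tf_hom2 tf)) -scalerAr mulr1 scalerAl => ->.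
exists (c *: f0 (Vop m0) * f1 (Vop m1)) => //.
by exists [:: (c *: Vop m0, Vop m1)]; rewrite /tsum big_seq1 /= (shZ (tf_hom0 tf)).
Qed.

Lemma qclos_right x : vNa_tensor t (vna M) (@scalar_operators R H1) (vna N2) (vfun x) ->
  qclos (alg2 f0 f2) x.
Proof.
apply: qclos_vNa_generated; first exact: (alg2_star (tf_hom0 tf) (tf_hom2 tf) (tf_comm02 tf)).
move=> T [x0 [x1 [x2 [m0 /(scalarE N1)[c ->] m2 hT]]]].
have := @tensor_opE (Vop m0) (c *: 1) (Vop m2) T hT.
rewrite (shZ (tf_hom1 tf)) (sh1 (tf_hom1 tf)) -scalerAr mulr1 => ->.
exists (c *: f0 (Vop m0) * f2 (Vop m2)) => //.
by exists [:: (c *: Vop m0, Vop m2)]; rewrite /tsum big_seq1 /= (shZ (tf_hom0 tf)).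
Qed.

End Factors.

(** * Ultraproducts *)

Section Ultra.
Variables (R : realType) (H : hilbertType R) (omega : free_ultrafilter).
Variable M : tracial_vNa H.
Local Notation null := (null omega).
Local Notation U := (ultraproduct omega M).

Definition bop (x : bounded_seq M) n : vop M := Vop (bseq_in x n).

Lemma bop_bounded x : exists2 c : R, 0 < c & forall n, obound c (bop x n).
Proof.
have [c c0 h] := bseq_bounded x.
have cE : c = rc (cre c) by rewrite rc_cre.
exists (cre c ^+ 2 + 1); first by rewrite ltr_wpDl// sqr_ge0.
move=> n v; have := h n v; rewrite {1}cE => /norm_le_nsq.
by have := nsq_ge0 v; rewrite /= mulrDl mul1r => v0 /le_trans; apply; rewrite lerDl.
Qed.

Lemma bseq_of_bounded (b : nat -> vop M) : (exists c, forall n, obound c (b n)) ->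
  exists x : bounded_seq M, forall n, bop x n = b n.
Proof.
move=> [c hc].
have hb : exists2 C : Cplx R, 0 <= C & forall n v, `|b n v| <= C * `|v|.
  exists (rc (Num.sqrt (Num.max c 0))); first by rewrite -rc0 ler_rc sqrtr_ge0.
  move=> n v; apply: nsq_le_norm; last exact: sqrtr_ge0.
  rewrite sqr_sqrtr; last by rewrite le_max lexx orbT.
  by rewrite (le_trans (hc n v))// ler_wpM2r ?nsq_ge0// le_max lexx.
by exists (BoundedSeq (fun n => vfunP (b n)) hb) => n; apply: vop_ext.
Qed.

Lemma norm2E (a b : vop M) : norm2 M ((a : H -> H) - (b : H -> H)) ^+ 2 = rc (q (a - b)).
Proof.
have -> : (a : H -> H) - (b : H -> H) = (a - b : vop M) :> (H -> H).
  by apply/funext => v; rewrite vsubE.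
by rewrite /norm2 sqrtCK -trv_q.
Qed.

Lemma norm2_lt (a b : vop M) (e : R) : 0 < e ->
  (norm2 M ((a : H -> H) - (b : H -> H)) < rc e) = (q (a - b) < e ^+ 2).
Proof.
move=> e0; rewrite -ltr_rc -norm2E rcX ltr_pXn2r// nnegrE.
  by apply: norm2_ge0; apply: vnaB; exact: vfunP.
by rewrite -rc0 ler_rc ltW.
Qed.

Lemma null_differenceP x y :
  null_difference omega x y <-> null (fun n => q (bop x n - bop y n)).
Proof.
have n0 n : 0 <= norm2 M (x n - y n) by apply: norm2_ge0; apply: vnaB; exact: bseq_in.
split=> [h e e0|h].
  have se : 0 < Num.sqrt e by rewrite sqrtr_gt0.
  have rse : 0 < rc (Num.sqrt e) by rewrite -rc0 ltr_rc.
  have /cvgr0Pnorm_lt/(_ _ rse) := h; apply: filterS => n /=.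
  rewrite ger0_norm// => hn; have := norm2_lt (bop x n) (bop y n) se.
  by rewrite [X in X = _]hn sqr_sqrtr ?(ltW e0)// => /esym/ltW.
apply/cvgr0Pnorm_lt => e /gt0_cplx[e0 ->].
have e2 : 0 < cre e ^+ 2 / 2 by rewrite divr_gt0// exprn_gt0.
apply: filterS (h _ e2) => n /= hn; rewrite ger0_norm//.
rewrite [X in is_true X](norm2_lt (bop x n) (bop y n) e0) (le_lt_trans hn)//.
by have := exprn_gt0 2 e0; lra.
Qed.

Lemma ultra_eqP x y : (\pi_U x = \pi_U y) <-> null (fun n => q (bop x n - bop y n)).
Proof.
rewrite -null_differenceP; split=> [/eqmodP/asboolP//|h].
by apply/eqmodP/asboolP.
Qed.

(** Independence of representatives: x' y' - x y = (x' - x) y' + x (y' - y), where the factors y'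
    and x are bounded in operator norm. *)
Lemma ultra_mulE x y : ultra_mul (\pi_U x) (\pi_U y) = \pi_U (bseq_comp x y).
Proof.
rewrite /ultra_mul; apply/ultra_eqP.
set x' := repr _; set y' := repr _.
have hx : null (fun n => q (bop x' n - bop x n)) by apply/ultra_eqP; rewrite reprK.
have hy : null (fun n => q (bop y' n - bop y n)) by apply/ultra_eqP; rewrite reprK.
have [c c0 hc] := bop_bounded x; have [d d0 hd] := bop_bounded y'.
apply: nullS (nullD (nullZ _ hx) (nullZ _ hy)) _ => [||n]; last first.
  have -> : bop (bseq_comp x' y') n - bop (bseq_comp x y) n =
      (bop x' n - bop x n) * bop y' n + bop x n * (bop y' n - bop y n).
    rewrite mulrBl mulrBr addrA subrK.
    by congr (_ - _); apply: vop_ext.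
  rewrite (le_trans (qDle _ _))// lerD//.
    have := q_mulr (bop x' n - bop x n) (ltW d0) (hd n) => h.
    by rewrite -(ler_pM2l (ltr0Sn R 1)) mulrA in h; apply: h.
  have := q_mull (bop y' n - bop y n) (ltW c0) (hc n) => h.
  by rewrite -(ler_pM2l (ltr0Sn R 1)) mulrA in h; apply: h.
all: by rewrite mulr_ge0// ltW.
Qed.

Lemma ultra_commP x y : ultra_mul (\pi_U x) (\pi_U y) = ultra_mul (\pi_U y) (\pi_U x) <->
  null (fun n => q (comm (bop x n) (bop y n))).
Proof.
rewrite !ultra_mulE ultra_eqP.
suff -> : (fun n => q (bop (bseq_comp x y) n - bop (bseq_comp y x) n)) =
          (fun n => q (comm (bop x n) (bop y n))) by [].
by apply/funext => n; congr (q (_ - _)); apply: vop_ext.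
Qed.

Lemma relative_commutantP (S : set (H -> H)) x : relative_commutant S (\pi_U x) <->
  forall f : vop M, S f -> null (fun n => q (comm (bop x n) f)).
Proof.
split=> [h f Sf|h f Mf Sf].
  have := h _ (vfunP f) Sf; rewrite /ultra_cst ultra_commP => nf.
  apply: nullS nf _ => n; rewrite q_comm_sym.
  by rewrite (_ : bop (bseq_cst _) n = f)//; apply: vop_ext.
rewrite /ultra_cst ultra_commP; apply: nullS (h (Vop Mf) Sf) _ => n.
by rewrite q_comm_sym (_ : bop (bseq_cst _) n = Vop Mf)//; apply: vop_ext.
Qed.

Lemma separable_seq : separable M ->
  exists d : nat -> vop M, forall f e, 0 < e -> exists k, q (f - d k) <= e.
Proof.
move=> [D [/countable_injP[i inj_i] DM dense]].
(* An inverse of the injection i on D; an index outside its range gets the default 0, which is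
   harmless for density. *)
exists (fun k => xget 0 [set v : vop M | D v /\ i v = k]) => f e e0.
have se : 0 < Num.sqrt e by rewrite sqrtr_gt0.
have rse : 0 < rc (Num.sqrt e) by rewrite -rc0 ltr_rc.
have [g Dg hg] := dense f _ (vfunP f) rse.
have Mg := DM _ Dg; exists (i g); case: xgetP => [v _ [Dv iv]|/(_ (Vop Mg))].
  have vg : v = Vop Mg.
    by apply: vop_ext => u; have -> : vfun v = g by apply: inj_i; rewrite ?inE.
  have := norm2_lt f (Vop Mg) se; rewrite [X in X = _]hg sqr_sqrtr ?(ltW e0)// => /esym.
  by rewrite vg => /ltW.
by move=> /(_ (conj Dg erefl)).
Qed.

End Ultra.

Lemma centralizing_abelian (R : realType) (omega : free_ultrafilter) (H : hilbertType R)
    (M : tracial_vNa H) :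
  (forall x y : ultraproduct omega M,
    relative_commutant (vna M) x -> relative_commutant (vna M) y ->
    ultra_mul x y = ultra_mul y x) ->
  forall b b' : nat -> vop M, centralizing omega b -> centralizing omega b' ->
  null omega (fun n => q (comm (b n) (b' n))).
Proof.
move=> ab b b' [/bseq_of_bounded[x hx] cb] [/bseq_of_bounded[x' hx'] cb'].
have /ultra_commP : ultra_mul (\pi_(ultraproduct omega M)%qT x) (\pi_(ultraproduct omega M)%qT x') =
    ultra_mul (\pi_(ultraproduct omega M)%qT x') (\pi_(ultraproduct omega M)%qT x).
  apply: ab; apply/relative_commutantP => f _.
    by apply: nullS (cb f) _ => n; rewrite hx.
  by apply: nullS (cb' f) _ => n; rewrite hx'.
by move=> h; apply: nullS h _ => n; rewrite hx hx'.
Qed.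

Theorem theorem3p3 (R : realType) (omega : free_ultrafilter)
  (H0 H1 H2 K : hilbertType R) (t : H0 -> H1 -> H2 -> K)
  (tensorK : is_hilbert_tensor t)
  (M : tracial_vNa H0) (N1 : tracial_vNa H1) (N2 : tracial_vNa H2)
  (sepM : separable M) (sepN1 : separable N1) (sepN2 : separable N2)
  (P : tracial_vNa K) (tensorP : is_tracial_tensor t M N1 N2 P)
  (abelian_central : forall x y : ultraproduct omega M,
    relative_commutant (vna M) x -> relative_commutant (vna M) y ->
    ultra_mul x y = ultra_mul y x) :
  forall x y : ultraproduct omega P,
    (relative_commutant (elementary_tensors t (vna M) [set idfun] [set idfun])
     `&` sub_ultraproduct
           (vNa_tensor t (vna M) (vna N1) (@scalar_operators R H2))) x ->
    (relative_commutant (elementary_tensors t (vna M) [set idfun] [set idfun])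
     `&` sub_ultraproduct
           (vNa_tensor t (vna M) (@scalar_operators R H1) (vna N2))) y ->
    ultra_mul x y = ultra_mul y x.
Proof.
move=> _ _ [/[swap] -[x Qx ->] cx] [/[swap] -[y Qy ->] cy].
have [f0 [f1 [f2 [tf e0 e1 e2]]]] := tensor_factors_ex tensorK tensorP.
have [d dense] := separable_seq sepM.
have [D D0 hD] := bop_bounded x; have [c c0 hc] := bop_bounded y.
have f0S f : elementary_tensors t (vna M) [set idfun] [set idfun] (f0 f : K -> K).
  exists f, idfun, idfun; split=> //; first exact: vfunP.
  by split=> [|u v w]; [exact: (vNa_bounded (vnaP P) (vfunP _))|exact: e0].
have cX f : null omega (fun n => q (comm (bop x n) (f0 f))).
  by move/relative_commutantP: cx; apply.
have cY f : null omega (fun n => q (comm (bop y n) (f0 f))).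
  by move/relative_commutantP: cy; apply.
have QX n : qclos (alg2 f0 f1) (bop x n).
  by apply: (qclos_left tensorK tf e0 e1 e2); exact: Qx.
have QY n : qclos (alg2 f0 f2) (bop y n).
  by apply: (qclos_right tensorK tf e0 e1 e2); exact: Qy.
apply/ultra_commP.
apply: (comm_centralizing_tensor tf dense D0 c0 QX hD QY hc cY) => b cb.
have [[c' hb] _] := cb.
(* The bound c' of a centralizing sequence carries no sign, and a positive one is required below. *)
have hf0b n : obound (Num.max c' 1) (f0 (b n)).
  apply: (sh_bound (tf_hom0 tf)); first by rewrite le_max ler01 orbT.
  by apply: oboundW (hb n); rewrite le_max lexx.
have c'0 : 0 < Num.max c' 1 by rewrite lt_max ltr01 orbT.
(* Here f0 (b n) plays the part of x, and x n that of y. The sequences b' against which b is tested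
   are centralizing for M, so commutativity of the central sequence algebra applies. *)
have key : null omega (fun n => q (comm (f0 (b n)) (bop x n))).
  apply: (comm_centralizing_tensor (tensor_factors_swap tf) dense c'0 D0 _ hf0b QX hD cX).
    by move=> n; exact: (Q1_f0 (tensor_factors_swap tf)).
  move=> b' cb'; apply: nullS (centralizing_abelian abelian_central cb cb') _ => n.
  by rewrite (comm_f0 tf) (q_f0 tf).
by apply: nullS key _ => n; rewrite q_comm_sym.
Qed.
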